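(* Let $K$ be an algebraically closed field of characteristic zero, let $(W,\{x_i\})$ be a finite-dimensional structure over $K$, and let $K_0\subseteq K$ be its field of invariants. Assume that $K_0$ has a subfield $L$ such that $K/L$ is a Galois extension, and let $\Gamma:=\mathrm{Gal}(K/L)$. The group $\Gamma$ acts on the set of isomorphism classes of structures over $K$ of the same type as $W$ and of dimension $\dim(W)$ (by the Galois action on structure constants). Let $H<\Gamma$ be the stabilizer of the isomorphism class of $W$. Then $K^H=K_0$.
   Context: Structures. $\mathrm{Vec}_K$ is the category of finite-dimensional $K$-vector spaces. In a rigid symmetric monoidal category put $W^{p,q}=W^{\otimes p}\otimes (W^* )^{\otimes q}$. A structure is a pair $(W,\{x_i\}_{i\in I})$ of an object $W$ and morphisms (tensors) $x_i:\mathbf 1\to W^{p_i,q_i}$; $(p_i,q_i)$ is the type of $x_i$. Two structures have the same type if they are indexed by the same set and corresponding tensors have equal types. An isomorphism of structures is an isomorphism $\psi$ of objects such that $\psi^{\otimes p_i}\otimes((\psi^* )^{-1})^{\otimes q_i}$ carries each tensor to the corresponding one. A finite-dimensional structure over $K$ is a structure in $\mathrm{Vec}_K$ (so $x_i\in W^{p_i,q_i}$). Galois action. For $\gamma\in\Gamma$, ${}^\gamma W$ is $W$ as an abelian group with scalar action $x\cdot w=\gamma^{-1}(x)w$, with the induced tensors ${}^\gamma x_i$: in terms of a basis of $W$ (which is also a basis of ${}^\gamma W$) the coefficients of ${}^\gamma x_i$ are obtained by applying $\gamma$ to those of $x_i$. $\gamma$ sends the class of $W$ to that of ${}^\gamma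 W$. Kernel completion. Let $\mathcal C$ be a small additive symmetric monoidal rigid category with a faithful additive symmetric monoidal functor $F:\mathcal C\to\mathcal A$ to an abelian symmetric monoidal rigid category. A sequence in $\mathcal C$ is good if $F$ maps it to an exact sequence; $\mathcal C$ is good if every $f:A\to B$ fits in a good sequence $X\to A\to B$ (this is automatic if $\mathcal A=\mathrm{Vec}_K$). For $\mathcal C$ good, let $X^{f,g}\subseteq \mathrm{Hom}_{\mathcal A}(\ker F(f),\ker F(g))$ ($f,g$ morphisms of $\mathcal C$) be the smallest collection of abelian subgroups such that: (1) if $X\xrightarrow{f_1}Y\xrightarrow{f_0}A\xrightarrow{f}B$ is good, $g:C\to D$, $h:Y\to C$, $gh=0$, $hf_1=0$, then the induced map $\ker F(f)\cong \mathrm{coker} F(f_1)\to\ker F(g)$ is in $X^{f,g}$; (2) it is closed under composition; (3) if $a\in X^{f,g}$ is invertible in $\mathcal A$ then $a^{-1}\in X^{g,f}$. The category $\mathrm{Ker}(\mathcal C)_F$ has one object $K(f)$ for each morphism $f$ of $\mathcal C$, $\mathrm{Hom}(K(f),K(g))=X^{f,g}$, and composition as in $\mathcal A$. It is additive rigid symmetric monoidal, with $K(f)\otimes K(g)=K(f\otimes 1\oplus 1\otimes g)$ and tensor product of morphisms and symmetry as in $\mathcal A$; it has faithful additive symmetric monoidal functors $\widetilde F:K(f)\mapsto\ker F(f)$ to $\mathcal A$ and $I:A\mapsto K(A\to0)$ from $\mathcal C$, with $\widetilde FI\cong F$. Fundamental category. Let $S^{p,q}\subseteq W^{p,q}$ be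 the smallest collection of $\mathbb Q$-subspaces such that: $x_i\in S^{p_i,q_i}$; $\mathrm{Id}_W\in S^{1,1}$; $x\in S^{p,q},y\in S^{r,s}$ implies $x\otimes y\in S^{p+r,q+s}$ (after rearranging factors); evaluating the first copy of $W^*$ on the first copy of $W$ sends $S^{p,q}$ to $S^{p-1,q-1}$; $S^{p,q}$ is stable under $S_p\times S_q$ permuting tensor factors; if $0\ne x\in S^{0,0}\subseteq K$ then $x^{-1}\in S^{0,0}$. Let $\mathcal C_0$ have objects $(p,q)\in\mathbb N^2$, $\mathrm{Hom}((p,q),(a,b))=S^{a+q,b+p}\subseteq W^{a+q,b+p}=\mathrm{Hom}_K(W^{p,q},W^{a,b})$ with composition of linear maps, $(p,q)\otimes(a,b)=(p+a,q+b)$, $(p,q)^*=(q,p)$, and $F_0((p,q))=W^{p,q}$. Let $\mathcal C_1$ be its additive envelope (formal finite direct sums), with $F_1$ induced by $F_0$, and $\mathcal C_{n+1}=\mathrm{Ker}(\mathcal C_n)_{F_n}$, $F_{n+1}=\widetilde{F_n}$ for $n\ge1$. Put $\mathcal C_W=\varinjlim \mathcal C_n$, with induced functor $F:\mathcal C_W\to\mathrm{Vec}_K$. Then $\mathcal C_W$ is an abelian rigid symmetric monoidal category and $F$ is exact, faithful, additive and symmetric monoidal. The field of invariants of $W$ is $K_0=\mathrm{End}_{\mathcal C_W}(\mathbf 1)$, a subfield of $K$ via $F$. *)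

(* Defs.v *)
From HB Require Import structures.
From mathcomp Require Import all_boot all_order all_fingroup all_algebra all_field.

Set Implicit Arguments.
Unset Strict Implicit.
Unset Printing Implicit Defensive.

Import GRing.Theory.
Local Open Scope ring_scope.

Section LinfunFacts.
Variables (R : fieldType) (U V : vectType R).
Import VectorInternalTheory.

Fact linfun_lin (f : U -> V) : linear f -> linfun f =1 f.
Proof.
move=> fL; pose m := GRing.isLinear.Build R U V _ f fL.
pose F : {linear U -> V} := HB.pack f m.
exact: (lfunE F).
Qed.

Fact linfun_sum (f : U -> V) v :
  linfun f v = \sum_i v2r v 0 i *: f (r2v (delta_mx 0 i)).
Proof.
rewrite 2!unlock /= {1}(row_sum_delta (v2r v)) mulmx_suml linear_sum.
apply: eq_bigr => i _; rewrite -scalemxAl linearZ /= -rowE.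
by congr (_ *: _); rewrite -[RHS]v2rK; congr r2v; apply/rowP=> j; rewrite !mxE.
Qed.

Fact linfun_comb a (f g h : U -> V) :
  (forall v, h v = a *: f v + g v) -> linfun h = a *: linfun f + linfun g.
Proof.
move=> hE; apply/lfunP=> v; rewrite add_lfunE scale_lfunE !linfun_sum.
rewrite scaler_sumr -big_split; apply: eq_bigr => i _ /=.
by rewrite hE scalerDr !scalerA mulrC.
Qed.

Fact eq_linfun (f g : U -> V) : f =1 g -> linfun f = linfun g.
Proof.
by move=> fg; apply/lfunP=> v; rewrite !linfun_sum; apply: eq_bigr => i _;
  rewrite fg.
Qed.

Fact linfun0 (f : U -> V) : (forall v, f v = 0) -> linfun f = 0.
Proof.
move=> f0; apply/lfunP=> v; rewrite zero_lfunE linfun_sum big1 // => i _.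
by rewrite f0 scaler0.
Qed.
End LinfunFacts.

Section Tensors.
Variables (K : fieldType) (W : vectType K).
Implicit Types p q : nat.

Definition dual : vectType K := 'Hom(W, K^o).

(* The tensor product U (x) V of finite-dimensional spaces is taken to be
   Hom(U^*, V), and W^* (x) V to be Hom(W, V).  Thus W^{p,q} is the space of
   (curried) multilinear forms on p covectors and q vectors, the pure tensor
   u_1 .. u_p alpha_1 .. alpha_q being the form
   (phi, w) |-> prod_i phi_i(u_i) * prod_j alpha_j(w_j).
   In particular W^{0,0} is K. *)
Fixpoint cotens q : vectType K :=
  if q is q'.+1 then 'Hom(W, cotens q') else K^o.

Fixpoint tens p q : vectType K :=
  if p is p'.+1 then 'Hom(dual, tens p' q) else cotens q.

Fixpoint coev q : cotens q -> q.-tuple W -> K :=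
  if q is q'.+1 then fun x w => coev (x (thead w)) [tuple of behead w]
  else fun x _ => x.

Fixpoint ev p q : tens p q -> p.-tuple dual -> q.-tuple W -> K :=
  if p is p'.+1 then
    fun x phi w => ev (x (thead phi)) [tuple of behead phi] w
  else fun x _ w => coev x w.

(* As with [linfun], [tens_of f] is the tensor with values [f] whenever [f] is
   multilinear (lemma [tens_ofE]). *)
Fixpoint cotens_of q : (q.-tuple W -> K) -> cotens q :=
  if q is q'.+1 then
    fun f => linfun (fun w => cotens_of (fun ws => f [tuple of w :: ws]))
  else fun f => f [tuple].

Fixpoint tens_of p q : (p.-tuple dual -> q.-tuple W -> K) -> tens p q :=
  if p is p'.+1 then
    fun f => linfun (fun a => tens_of (fun phi w => f [tuple of a :: phi] w))
  else fun f => cotens_of (f [tuple]).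

Definition dimW : nat := \dim (fullv : {vspace W}).
Definition base (i : 'I_dimW) : W := tnth (vbasis (fullv : {vspace W})) i.
Definition cobase (i : 'I_dimW) : dual :=
  linfun (fun w : W => coord (vbasis (fullv : {vspace W})) i w : K^o).

Definition tens_id : tens 1 1 :=
  tens_of (fun phi w => (thead phi : 'Hom(W, K^o)) (thead w)).

(* x (x) y, with the factors rearranged so as to lie in W^{p+r,q+s}. *)
Definition tens_mul p q r s (x : tens p q) (y : tens r s) :
    tens (p + r) (q + s) :=
  tens_of (fun phi w =>
    ev x [tuple tnth phi (lshift r i) | i < p]
         [tuple tnth w (lshift s j) | j < q] *
    ev y [tuple tnth phi (rshift p i) | i < r]
         [tuple tnth w (rshift q j) | j < s]).

(* The natural pairing of W^* with W is contraction with sum_i e_i^* (x) e_i. *)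
Definition tens_contr p q (x : tens p.+1 q.+1) : tens p q :=
  tens_of (fun phi w =>
    \sum_(i < dimW) ev x [tuple of cobase i :: phi] [tuple of base i :: w]).

Definition tens_perm p q (s : 'S_p) (t : 'S_q) (x : tens p q) : tens p q :=
  tens_of (fun phi w => ev x [tuple tnth phi (s i) | i < p]
                             [tuple tnth w (t j) | j < q]).

End Tensors.

Section TensFacts.
Variables (K : fieldType) (W : vectType K).

Fact cotens_of0 q (f : q.-tuple W -> K) :
  (forall w, f w = 0) -> cotens_of f = 0.
Proof.
elim: q f => [|q IHq] f f0 //=; apply: linfun0 => w.
by apply: IHq => ws; apply: f0.
Qed.

Fact tens_of0 p q (f : p.-tuple (dual W) -> q.-tuple W -> K) :
  (forall phi w, f phi w = 0) -> tens_of f = 0.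
Proof.
elim: p f => [|p IHp] f f0 /=; first exact: cotens_of0.
by apply: linfun0 => a; apply: IHp => phi w; apply: f0.
Qed.

Fact cotens_of_comb q a (f g h : q.-tuple W -> K) :
  (forall w, h w = a * f w + g w) ->
  cotens_of h = a *: cotens_of f + cotens_of g.
Proof.
elim: q f g h => [|q IHq] f g h hE /=; first exact: hE.
by apply: linfun_comb => w; apply: IHq => ws; apply: hE.
Qed.

Fact tens_of_comb p q a (f g h : p.-tuple (dual W) -> q.-tuple W -> K) :
  (forall phi w, h phi w = a * f phi w + g phi w) ->
  tens_of h = a *: tens_of f + tens_of g.
Proof.
elim: p f g h => [|p IHp] f g h hE /=; first exact: cotens_of_comb.
by apply: linfun_comb => u; apply: IHp => phi w; apply: hE.
Qed.

Fact coev_lin q a (x y : cotens W q) w :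
  coev (a *: x + y) w = a * coev x w + coev y w.
Proof.
elim: q x y w => [|q IHq] x y w //=.
by rewrite add_lfunE scale_lfunE IHq.
Qed.

Fact ev_lin p q a (x y : tens W p q) phi w :
  ev (a *: x + y) phi w = a * ev x phi w + ev y phi w.
Proof.
elim: p x y phi => [|p IHp] x y phi /=; first exact: coev_lin.
by rewrite add_lfunE scale_lfunE IHp.
Qed.

Fact ev0 p q phi w : ev (0 : tens W p q) phi w = 0.
Proof.
by have := ev_lin (-1) (0 : tens W p q) 0 phi w; rewrite scaler0 addr0 mulN1r addNr.
Qed.

Definition tset (V : Type) n (w : n.-tuple V) (i : 'I_n) (v : V) :=
  [tuple if j == i then v else tnth w j | j < n].

Definition multilinear (V : vectType K) n (f : n.-tuple V -> K) : Prop :=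
  forall w i a u v,
    f (tset w i (a *: u + v)) = a * f (tset w i u) + f (tset w i v).

Fact tset0 (V : Type) n (w : n.-tuple V) u v :
  tset [tuple of u :: w] ord0 v = [tuple of v :: w].
Proof.
apply: eq_from_tnth => j; rewrite tnth_mktuple.
by case: (unliftP ord0 j) => [k|] -> //=; rewrite !tnthS.
Qed.

Fact tsetS (V : Type) n (w : n.-tuple V) u v i :
  tset [tuple of u :: w] (lift ord0 i) v = [tuple of u :: tset w i v].
Proof.
apply: eq_from_tnth => j; rewrite tnth_mktuple.
case: (unliftP ord0 j) => [k|] -> //=.
by rewrite !tnthS tnth_mktuple (inj_eq lift_inj).
Qed.

Fact multilinear_hd (V : vectType K) n (f : n.+1.-tuple V -> K)
    (w : n.-tuple V) (a : K) (u v : V) :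
  multilinear f -> f [tuple of (a *: u + v) :: w] =
    a * f [tuple of u :: w] + f [tuple of v :: w].
Proof. by move/(_ [tuple of u :: w] ord0 a u v); rewrite !tset0. Qed.

Fact multilinear_tl (V : vectType K) n (f : n.+1.-tuple V -> K) u :
  multilinear f -> multilinear (fun w => f [tuple of u :: w]).
Proof.
by move=> fM w i a v v'; have := fM [tuple of u :: w] (lift ord0 i) a v v';
  rewrite !tsetS.
Qed.

Fact cotens_ofE q (f : q.-tuple W -> K) w :
  multilinear f -> coev (cotens_of f) w = f w.
Proof.
elim: q f w => [|q IHq] f w fM /=; first by rewrite [w]tuple0.
rewrite linfun_lin => [|a u v].
  by rewrite IHq; [rewrite -tuple_eta | apply: multilinear_tl].
by apply: cotens_of_comb => ws; apply: multilinear_hd.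
Qed.

Fact tens_ofE p q (f : p.-tuple (dual W) -> q.-tuple W -> K) phi w :
  (forall w, multilinear (fun phi => f phi w)) ->
  (forall phi, multilinear (f phi)) -> ev (tens_of f) phi w = f phi w.
Proof.
elim: p f phi => [|p IHp] f phi fL fR /=.
  by rewrite [phi]tuple0 cotens_ofE.
rewrite linfun_lin => [|a u v].
  rewrite IHp => [|ws|phi']; [by rewrite -tuple_eta | | exact: fR].
  exact: (multilinear_tl (f := f^~ ws)).
by apply: tens_of_comb => psi ws; apply: (multilinear_hd (f := f^~ ws)).
Qed.

Fact coev_multi q (x : cotens W q) : multilinear (coev x).
Proof.
elim: q x => [|q IHq] x w i a u v; first by case: i.
rewrite (tuple_eta w); case: (unliftP ord0 i) => [k|] ->.
  by rewrite !tsetS /= !theadE;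
    have := IHq (x (thead w)) [tuple of behead w] k a u v;
    congr (_ = _ * _ + _); congr coev; apply/val_inj.
rewrite !tset0 /= !theadE linearD linearZ coev_lin.
by congr (_ * _ + _); congr coev; apply/val_inj.
Qed.

Fact ev_multiR p q (x : tens W p q) phi : multilinear (ev x phi).
Proof. by elim: p x phi => [|p IHp] x phi //=; apply: coev_multi. Qed.

Fact ev_multiL p q (x : tens W p q) w : multilinear (fun phi => ev x phi w).
Proof.
elim: p x w => [|p IHp] x w phi i a u v; first by case: i.
rewrite (tuple_eta phi); case: (unliftP ord0 i) => [k|] ->.
  rewrite !tsetS /= !theadE.
  have := IHp (x (thead phi)) w [tuple of behead phi] k a u v.
  by congr (_ = _ * _ + _); congr ev; apply/val_inj.
rewrite !tset0 /= !theadE linearD linearZ ev_lin.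
by congr (_ * _ + _); congr ev; apply/val_inj.
Qed.

End TensFacts.

(* The identification W^{a+q,b+p} = Hom_K(W^{p,q}, W^{a,b}): the last q
   contravariant and the last p covariant slots of t are paired with the
   argument v. *)
Definition hom_of_tens (K : fieldType) (W : vectType K) (p q a b : nat)
    (t : tens W (a + q) (b + p)) : 'Hom(tens W p q, tens W a b) :=
  linfun (fun v : tens W p q => tens_of (fun phi w =>
    \sum_(i : p.-tuple 'I_(dimW W)) \sum_(j : q.-tuple 'I_(dimW W))
      ev v [tuple of map (@cobase K W) i] [tuple of map (@base K W) j] *
      ev t [tuple of phi ++ map (@cobase K W) j]
           [tuple of w ++ map (@base K W) i])).

(* psi^{(x) p} (x) ((psi^* )^{-1})^{(x) q}, for psi' the inverse of psi. *)
Definition tens_push (K : fieldType) (W W' : vectType K) (psi : 'Hom(W, W'))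
    (psi' : 'Hom(W', W)) (p q : nat) (x : tens W p q) : tens W' p q :=
  tens_of (fun phi w =>
    ev x [tuple (tnth phi i \o psi)%VF | i < p]
         [tuple psi' (tnth w j) | j < q]).

Record tstruct (K : fieldType) (I : Type) (ty : I -> nat * nat) := TStruct {
  carrier :> vectType K;
  tensor : forall i : I, tens carrier (ty i).1 (ty i).2 }.

Definition tstruct_iso (K : fieldType) (I : Type) (ty : I -> nat * nat)
    (W W' : tstruct K ty) : Prop :=
  exists (psi : 'Hom(carrier W, carrier W'))
         (psi' : 'Hom(carrier W', carrier W)),
    [/\ cancel psi psi', cancel psi' psi
      & forall i, tens_push psi psi' (tensor W i) = tensor W' i].

Record field_aut (K : fieldType) := FieldAut {
  aut :> {rmorphism K -> K};
  aut_inv : {rmorphism K -> K};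
  autK : cancel aut aut_inv;
  aut_invK : cancel aut_inv aut }.

Section Twist.
Variables (K : fieldType) (g : field_aut K).

Definition twist (W : vectType K) : Type := W.

Section TwistVect.
Import VectorInternalTheory.
Variable W : vectType K.
Local Notation gW := (twist W).

HB.instance Definition _ := GRing.Zmodule.on gW.

Definition twist_scale (a : K) (w : gW) : gW := aut_inv g a *: (w : W).

Fact twist_scaleA a b w :
  twist_scale a (twist_scale b w) = twist_scale (a * b) w.
Proof. by rewrite /twist_scale scalerA rmorphM. Qed.
Fact twist_scale1 : left_id 1 twist_scale.
Proof. by move=> w; rewrite /twist_scale rmorph1 scale1r. Qed.
Fact twist_scaleDr : right_distributive twist_scale +%R.
Proof. by move=> a u v; rewrite /twist_scale scalerDr. Qed.
Fact twist_scaleDl w : {morph twist_scale^~ w : a b / a + b}.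
Proof. by move=> a b; rewrite /twist_scale rmorphD scalerDl. Qed.

HB.instance Definition _ := GRing.Zmodule_isLmodule.Build K gW
  twist_scaleA twist_scale1 twist_scaleDr twist_scaleDl.

Fact twist_vect_axiom : Vector.axiom (dim W) gW.
Proof.
exists (fun w : gW => map_mx g (v2r (w : W))).
  move=> a u v; rewrite -[a *: u]/(aut_inv g a *: (u : W)) linearP.
  by rewrite map_mxD map_mxZ aut_invK.
exists (fun x => r2v (map_mx (aut_inv g) x)) => [w|x].
  rewrite -map_mx_comp -[RHS](v2rK (w : W)); congr r2v.
  by apply/matrixP=> i j; rewrite mxE /= autK.
by rewrite r2vK; apply/matrixP=> i j; rewrite !mxE aut_invK.
Qed.

HB.instance Definition _ := Lmodule_hasFinDim.Build K gW twist_vect_axiom.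

End TwistVect.

(* A covector phi of the twisted space yields the covector
   w |-> g^{-1}(phi(w)) of W; if phi is dual to a vector of a basis of W then
   this is the corresponding dual vector, so [twist_tens] applies g to the
   coefficients in any basis of W. *)
Definition untwist_dual (W : vectType K) (phi : dual (twist W)) : dual W :=
  linfun (fun w : W =>
    aut_inv g ((phi : 'Hom(twist W, K^o)) (w : twist W)) : K^o).

Definition twist_tens (W : vectType K) p q (x : tens W p q) :
    tens (twist W) p q :=
  tens_of (fun phi w =>
    g (ev x [tuple untwist_dual (tnth phi i) | i < p]
            [tuple (tnth w j : W) | j < q])).

Fact untwist_dualE (W : vectType K) (phi : dual (twist W)) (w : W) :
  untwist_dual phi w = aut_inv g ((phi : 'Hom(twist W, K^o)) (w : twist W)).
Proof.
rewrite linfun_lin // => a u v.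
have -> : a *: u + v = g a *: (u : twist W) + (v : twist W) :> twist W.
  by rewrite -[g a *: _]/(aut_inv g (g a) *: u) autK.
by rewrite linearP rmorphD rmorphM autK.
Qed.

Fact twist_tensE (W : vectType K) p q (x : tens W p q) phi w :
  ev (twist_tens x) phi w =
    g (ev x [tuple untwist_dual (tnth phi i) | i < p]
            [tuple (tnth w j : W) | j < q]).
Proof.
have gM n (V V' : vectType K) (f : n.-tuple V' -> K) (h : V -> V') :
    multilinear f ->
    (forall a u v, h (a *: u + v) = aut_inv g a *: h u + h v) ->
  multilinear (fun w : n.-tuple V => g (f [tuple h (tnth w i) | i < n])).
  move=> fM hM t i a u v.
  have E v1 : [tuple h (tnth (tset t i v1) j) | j < n] =
              tset [tuple h (tnth t j) | j < n] i (h v1).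
    by apply: eq_from_tnth => j; rewrite !tnth_mktuple; case: (j == i).
  by rewrite !E hM fM rmorphD rmorphM aut_invK.
apply: tens_ofE => [ws|psi].
  apply: (gM _ _ _ (fun psi => ev x psi _)) => [|a u v]; first exact: ev_multiL.
  apply/lfunP=> v1; rewrite add_lfunE scale_lfunE !untwist_dualE.
  by rewrite add_lfunE scale_lfunE rmorphD rmorphM.
exact: (gM _ _ _ (ev x _) (fun v : twist W => (v : W)) (ev_multiR x _)).
Qed.

Definition twist_struct (I : Type) (ty : I -> nat * nat) (W : tstruct K ty) :
    tstruct K ty :=
  @TStruct K I ty (twist (carrier W)) (fun i => twist_tens (tensor W i)).

End Twist.

(* A category with a faithful functor [fib] to Vec_K, each Hom-set being
   identified with its image under [fib], together with a choice of zero object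
   and of monoidal unit.  The tensor product itself is not recorded: neither
   the kernel completion nor End(1) refers to it. *)
Record vcat (K : fieldType) := VCat {
  ob : Type;
  fib : ob -> vectType K;
  hom : forall A B : ob, 'Hom(fib A, fib B) -> Prop;
  hom0 : forall A B : ob, hom (0 : 'Hom(fib A, fib B));
  zob : ob;
  unit_ob : ob }.

Section Fundamental.
Variables (K : fieldType) (I : Type) (ty : I -> nat * nat) (W : tstruct K ty).
Local Notation T := (tens (carrier W)).

Inductive S_tens : forall p q : nat, T p q -> Prop :=
| S_tensor i : S_tens (tensor W i)
| S_id : S_tens (tens_id W)
| S_mul p q r s (x : T p q) (y : T r s) :
    S_tens x -> S_tens y -> S_tens (tens_mul x y)
| S_contr p q (x : T p.+1 q.+1) : S_tens x -> S_tens (tens_contr x)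
| S_perm p q (s : 'S_p) (t : 'S_q) (x : T p q) :
    S_tens x -> S_tens (tens_perm s t x)
| S_inv (x : K) :
    x != 0 -> S_tens (x : T 0 0) -> S_tens (x^-1 : T 0 0)
| S_zero p q : S_tens (0 : T p q)
| S_add p q (x y : T p q) : S_tens x -> S_tens y -> S_tens (x + y)
| S_scale p q (a : rat) (x : T p q) : S_tens x -> S_tens (ratr a *: x).

Definition ob0 : Type := (nat * nat)%type.
Definition fib0 (A : ob0) : vectType K := T A.1 A.2.
Definition hom_C0 (A B : ob0) (f : 'Hom(fib0 A, fib0 B)) : Prop :=
  exists2 t : T (B.1 + A.2) (B.2 + A.1), S_tens t & f = hom_of_tens t.

(* The additive envelope: the list [:: A_1; ..; A_n] stands for the formal sum
   of the A_i, and a linear map between sums is a morphism when all its matrix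
   entries are. *)
Fixpoint fib1 (s : seq ob0) : vectType K :=
  if s is A :: s' then (fib0 A * fib1 s')%type else 'rV[K]_0.

Fixpoint hom_to_sum (A : ob0) (t : seq ob0) : 'Hom(fib0 A, fib1 t) -> Prop :=
  if t is B :: t' then fun f =>
    hom_C0 (linfun (fun v => (f v).1)) /\
    hom_to_sum (linfun (fun v => (f v).2))
  else fun=> True.

Fixpoint hom_C1 (s t : seq ob0) : 'Hom(fib1 s, fib1 t) -> Prop :=
  if s is A :: s' then fun f =>
    hom_to_sum (linfun (fun v : fib0 A => f (v, 0))) /\
    hom_C1 (linfun (fun v : fib1 s' => f (0, v)))
  else fun=> True.

Fact hom_of_tens0 (p q a b : nat) :
  hom_of_tens (0 : T (a + q) (b + p)) = 0 :> 'Hom(T p q, T a b).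
Proof.
apply: linfun0 => v; apply: tens_of0 => phi w.
by rewrite big1 // => i _; rewrite big1 // => j _; rewrite ev0 mulr0.
Qed.

Fact hom_C0_0 (A B : ob0) : hom_C0 (0 : 'Hom(fib0 A, fib0 B)).
Proof. by exists 0; [apply: S_zero | rewrite hom_of_tens0]. Qed.

Fact hom_to_sum0 (A : ob0) (t : seq ob0) :
  hom_to_sum (0 : 'Hom(fib0 A, fib1 t)).
Proof.
elim: t => //= B t IHt; rewrite !linfun0 => [|v|v]; try by rewrite zero_lfunE.
by split; first exact: hom_C0_0.
Qed.

Fact hom_C1_0 (s t : seq ob0) : hom_C1 (0 : 'Hom(fib1 s, fib1 t)).
Proof.
elim: s => //= A s IHs; rewrite !linfun0 => [|v|v]; try by rewrite zero_lfunE.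
by split; first exact: hom_to_sum0.
Qed.

Definition C1 : vcat K :=
  {| ob := seq ob0; fib := fib1; hom := hom_C1; hom0 := hom_C1_0;
     zob := [::]; unit_ob := [:: (0, 0)%N] |}.

End Fundamental.

Section KernelCompletion.
Variables (K : fieldType) (C : vcat K).

Record arrow := Arrow {
  src : ob C;
  tgt : ob C;
  arr : 'Hom(fib src, fib tgt);
  arrP : hom arr }.

Definition ker_fib (f : arrow) : vectType K := subvs_of (lker (arr f)).

Inductive ker_hom : forall f g : arrow, 'Hom(ker_fib f, ker_fib g) -> Prop :=
(* X --f1--> Y --f0--> A --f--> B is good, i.e. [fib] maps it to an exact
   sequence, and u is the map induced by h on ker f = im f0 = Y / im f1. *)
| ker_hom_induced (f g : arrow) (X Y : ob C)
    (f1 : 'Hom(fib X, fib Y)) (f0 : 'Hom(fib Y, fib (src f)))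
    (h : 'Hom(fib Y, fib (src g))) (u : 'Hom(ker_fib f, ker_fib g)) :
    hom f1 -> hom f0 -> hom h ->
    limg f1 = lker f0 -> limg f0 = lker (arr f) ->
    (arr g \o h)%VF = 0 -> (h \o f1)%VF = 0 ->
    (forall (k : ker_fib f) (y : fib Y), f0 y = vsval k -> vsval (u k) = h y) ->
    ker_hom u
| ker_hom_comp (f g k : arrow)
    (u : 'Hom(ker_fib f, ker_fib g)) (v : 'Hom(ker_fib g, ker_fib k)) :
    ker_hom u -> ker_hom v -> ker_hom (v \o u)%VF
| ker_hom_inv (f g : arrow)
    (u : 'Hom(ker_fib f, ker_fib g)) (v : 'Hom(ker_fib g, ker_fib f)) :
    ker_hom u -> cancel u v -> cancel v u -> ker_hom v
| ker_hom_zero (f g : arrow) : ker_hom (0 : 'Hom(ker_fib f, ker_fib g))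
| ker_hom_add (f g : arrow) (u v : 'Hom(ker_fib f, ker_fib g)) :
    ker_hom u -> ker_hom v -> ker_hom (u + v)
| ker_hom_opp (f g : arrow) (u : 'Hom(ker_fib f, ker_fib g)) :
    ker_hom u -> ker_hom (- u).

(* The functor I : A |-> K(A -> 0), and the isomorphism ker(F A -> F 0) = F A. *)
Definition incl (A : ob C) : arrow := Arrow (hom0 A (zob C)).
Definition incl_iso (A : ob C) : 'Hom(ker_fib (incl A), fib A) := linfun vsval.

Definition Ker : vcat K :=
  {| ob := arrow; fib := ker_fib; hom := ker_hom; hom0 := ker_hom_zero;
     zob := incl (zob C); unit_ob := incl (unit_ob C) |}.

End KernelCompletion.

Section DirectLimit.
Variables (K : fieldType) (C : vcat K).

Definition tower n : vcat K := iter n (@Ker K) C.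

(* [reaches A B i]: B is the image of A under an iterate of the inclusions
   I : tower n -> tower n.+1, and i : fib B -> fib A is the canonical
   isomorphism. *)
Inductive reaches n (A : ob (tower n)) :
    forall m (B : ob (tower m)), 'Hom(fib B, fib A) -> Prop :=
| reaches_refl : @reaches n A n A \1%VF
| reaches_incl m (B : ob (tower m)) (i : 'Hom(fib B, fib A)) :
    @reaches n A m B i -> @reaches n A m.+1 (incl B) (i \o incl_iso B)%VF.
Arguments reaches {n} A {m} B i.

Definition lim_ob : Type := {n : nat & ob (tower n)}.
Definition lim_fib (A : lim_ob) : vectType K := fib (tagged A).
Definition lim_hom (A B : lim_ob) (f : 'Hom(lim_fib A, lim_fib B)) : Prop :=
  exists n (A' B' : ob (tower n))
    (i : 'Hom(fib A', lim_fib A)) (j : 'Hom(fib B', lim_fib B))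
    (f' : 'Hom(fib A', fib B')),
  [/\ reaches (tagged A) A' i, reaches (tagged B) B' j, hom f'
    & (f \o i = j \o f')%VF].

Fact reaches_add n (A : ob (tower n)) k :
  exists (B : ob (tower (k + n))) i, reaches A B i.
Proof.
elim: k => [|k [B [i rB]]]; first by exists A, \1%VF; apply: reaches_refl.
by exists (incl B), (i \o incl_iso B)%VF; apply: reaches_incl.
Qed.

Fact lim_hom0 (A B : lim_ob) : lim_hom (0 : 'Hom(lim_fib A, lim_fib B)).
Proof.
case: A B => [n A] [m B].
have [A' [i rA]] := reaches_add A m.
have [B' [j rB]] := reaches_add B n.
move: B' j rB; rewrite addnC => B' j rB.
exists (m + n)%N, A', B', i, j, 0; split=> //; first exact: hom0.
by rewrite comp_lfun0l comp_lfun0r.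
Qed.

Definition lim : vcat K :=
  {| ob := lim_ob; fib := lim_fib; hom := lim_hom; hom0 := lim_hom0;
     zob := Tagged (fun n => ob (tower n)) (zob C : ob (tower 0));
     unit_ob := Tagged (fun n => ob (tower n)) (unit_ob C : ob (tower 0)) |}.

End DirectLimit.

Section Invariants.
Variables (K : fieldType) (I : Type) (ty : I -> nat * nat).

Definition fundamental_category (W : tstruct K ty) : vcat K := lim (C1 W).

(* fib 1 is one-dimensional, so End_K(fib 1) = K and K_0 = End(1) is the set of
   scalars a such that a id is a morphism 1 -> 1. *)
Definition field_of_invariants (W : tstruct K ty) (a : K) : Prop :=
  let C := fundamental_category W in
  hom (a *: \1%VF : 'Hom(fib (unit_ob C), fib (unit_ob C))).

End Invariants.

Section Galois.
Variables (L K : fieldType) (iota : {rmorphism L -> K}).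

(* L is identified with the subfield iota(L) of K. *)
Definition galois_extension : Prop :=
  (forall a : K, algebraicOver iota a) /\
  (forall p : {poly L}, irreducible_poly p ->
     (exists a : K, root (map_poly iota p) a) ->
     separable_poly p /\
     exists s : seq K, map_poly iota p %= \prod_(a <- s) ('X - a%:P)).

Definition in_galois_group (g : field_aut K) : Prop :=
  forall a : L, g (iota a) = iota a.

(* g fixes the isomorphism class of W in its action [W'] |-> [^g W']. *)
Definition in_stabilizer (I : Type) (ty : I -> nat * nat) (W : tstruct K ty)
    (g : field_aut K) : Prop :=
  in_galois_group g /\ tstruct_iso (twist_struct g W) W.

End Galois.

Definition fixed_field (K : fieldType) (H : field_aut K -> Prop) (a : K) :
    Prop :=
  forall g : field_aut K, H g -> g a = a.

(* Main.v *)
Require Import Defs.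
From HB Require Import structures.
From mathcomp Require Import all_boot all_order all_fingroup all_algebra all_field.
From mathcomp Require Import boolp classical_sets.
From mathcomp Require Import mpoly.
From mathcomp Require Import zify ring.

Set Implicit Arguments.
Unset Strict Implicit.
Unset Printing Implicit Defensive.

Import GRing.Theory.
Local Open Scope ring_scope.

(* Every semilinear isomorphism from W to itself that fixes the x_i acts on the
   fibres of all the categories C_n, compatibly with all morphisms; hence an
   automorphism in H commutes with the endomorphisms of 1, i.e. fixes K_0.

   For the converse, write S for the tensors in the S^{p,q}.  If x_0 = c x_1 with
   x_0, x_1 in S and x_1 <> 0, then c lies in K_0: contraction with x_1 presents
   the unit as the cokernel of a morphism of C_0, and contraction with x_0 induces
   c on this cokernel.  Eliminating by means of x (x) y - y (x) x, it follows that
   the K-linear relations between elements of S have coefficients in K_0 up to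
   linear combinations, so an automorphism g fixing K_0 maps the relations between
   the x in S to those between the g(x).  Every such g lies in H: evaluate the
   tensors on generic families of vectors and covectors of W.  The values span an
   integral domain D of polynomials, and by polarization (characteristic 0)
   sending the values of x to those of g(x) at a fixed frame is a well-defined
   homomorphism D -> K.  By Chevalley's extension theorem it is, for a suitable
   frame, the evaluation at another frame, and the change of frame is the required
   isomorphism.  As K is algebraic over L and K_0 is a field containing L, any
   element outside K_0 is moved by such a g. *)

(** * Extension of ring homomorphisms *)

(** An identity between polynomial values of tensors is not an identity between tensors: terms of
    different types are added, and one vector may fill several slots. Relations are only preserved
    type by type, so an identity must be polarized in every vector and covector before it can be
    carried to the other side and restituted there; this costs a factor N! N'!, invertible in
    characteristic zero. D need not be finitely generated, but it contains the constants, so the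
    polynomial ring is generated over D by the finitely many variables, which is what Chevalley's
    argument uses. The element a which it produces must stay nonzero under the homomorphism D -> K,
    and here it matters that relations are preserved in both directions: if the image of a vanished
    at every frame, polarizing backwards would give a = 0. A frame can then be chosen off the zeros
    of this image and of the Gram determinant. Partial homomorphisms are handled as graphs, subrings
    G of B * K with (0, y) in G only for y = 0; the same language serves the extension by Zorn's
    lemma to an automorphism of K. *)

Section Adjunction.
Variable R : comNzRingType.
Implicit Types (D : R -> Prop) (p q : {poly R}).

Definition is_subring (A : nzRingType) (D : A -> Prop) : Prop :=
  [/\ D 1, forall x y, D x -> D y -> D (x - y)
    & forall x y, D x -> D y -> D (x * y)].

Lemma subring0 (A : nzRingType) (D : A -> Prop) : is_subring D -> D 0.
Proof. by case=> D1 DB _; rewrite -(subrr 1); apply: DB. Qed.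

Lemma subringN (A : nzRingType) (D : A -> Prop) x :
  is_subring D -> D x -> D (- x).
Proof.
by move=> sD Dx; rewrite -sub0r; case: (sD) => _ DB _; apply: DB => //; apply: subring0.
Qed.

Lemma subringD (A : nzRingType) (D : A -> Prop) x y :
  is_subring D -> D x -> D y -> D (x + y).
Proof.
move=> sD Dx Dy; rewrite -[y]opprK; case: (sD) => _ DB _; apply: DB => //.
exact: subringN.
Qed.

Lemma subring_sum (A : nzRingType) (D : A -> Prop) I (r : seq I) (P : pred I) F :
  is_subring D -> (forall i, P i -> D (F i)) -> D (\sum_(i <- r | P i) F i).
Proof.
move=> sD DF; apply: (big_ind D) => //; first exact: subring0.
by move=> x y; apply: subringD.
Qed.

Lemma subring_prod (A : nzRingType) (D : A -> Prop) I (r : seq I) (P : pred I) F :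
  is_subring D -> (forall i, P i -> D (F i)) -> D (\prod_(i <- r | P i) F i).
Proof. by case=> D1 _ DM DF; apply: (big_ind D). Qed.

Lemma subringX (A : nzRingType) (D : A -> Prop) x n :
  is_subring D -> D x -> D (x ^+ n).
Proof. by move=> sD Dx; elim: n => [|n IH]; rewrite ?exprS; case: sD => // D1 _; apply. Qed.

Definition coefs_in D p : Prop := forall i, D p`_i.

Definition adjoin D (t : R) : R -> Prop :=
  fun x => exists2 p, coefs_in D p & x = p.[t].

Lemma coefs_inC D c : is_subring D -> D c -> coefs_in D c%:P.
Proof. by move=> sD Dc i; rewrite coefC; case: eqP => // _; apply: subring0. Qed.

Lemma coefs_inXn D n : is_subring D -> coefs_in D 'X^n.
Proof.
by move=> sD i; rewrite coefXn; case: eqP => _; [case: sD | apply: subring0].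
Qed.

Lemma coefs_in_subring D : is_subring D -> is_subring (coefs_in D).
Proof.
move=> sD; split=> [|p q Dp Dq i|p q Dp Dq i].
- by rewrite -polyC1; apply: coefs_inC => //; case: sD.
- by rewrite coefB; case: sD => _ DB _; apply: DB.
- by rewrite coefM; apply: subring_sum => // j _; case: sD => _ _; apply.
Qed.

Lemma coefs_inZ D c p : is_subring D -> D c -> coefs_in D p -> coefs_in D (c *: p).
Proof. by move=> [_ _ DM] Dc Dp i; rewrite coefZ; apply: DM. Qed.

Lemma adjoin_subring D t : is_subring D -> is_subring (adjoin D t).
Proof.
move=> sD; have [D1 DB DM] := coefs_in_subring sD; split.
- by exists 1; rewrite ?hornerC.
- by move=> _ _ [p Dp ->] [q Dq ->]; exists (p - q); [apply: DB | rewrite !hornerE].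
- by move=> _ _ [p Dp ->] [q Dq ->]; exists (p * q); [apply: DM | rewrite hornerM].
Qed.

Lemma adjoin_base D t x : is_subring D -> D x -> adjoin D t x.
Proof. by move=> sD Dx; exists x%:P; [apply: coefs_inC | rewrite hornerC]. Qed.

Lemma adjoin_gen D t : is_subring D -> adjoin D t t.
Proof. by move=> sD; exists 'X; [apply: (coefs_inXn 1) | rewrite hornerX]. Qed.

End Adjunction.

(** Degrees are measured after applying [f]. With [f] the first projection of B * K this divides
    polynomials over a graph, the remainder being small in its first component; with [f] the
    identity it is ordinary pseudo-division. Coefficients of [P] beyond its leading image are killed
    by [f], so subtracting a multiple of [P] from [a *: Q] lowers the size of the image of [Q]. *)
Lemma pseudo_division (A : comNzRingType) (B : idomainType)
    (f : {rmorphism A -> B}) (G : A -> Prop) (P Q : {poly A}) :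
  is_subring G -> coefs_in G P -> map_poly f P != 0 -> coefs_in G Q ->
  exists k S M, [/\ coefs_in G S, coefs_in G M,
    P`_(size (map_poly f P)).-1 ^+ k *: Q = P * S + M
    & (size (map_poly f M) < size (map_poly f P))%N].
Proof.
move=> sG GP nP; set n := size _; set a := P`_n.-1.
have [_ GB GM] := coefs_in_subring sG.
elim: {Q}(size (map_poly f Q)) {-2}Q (leqnn (size (map_poly f Q))) => [|m IH] Q leQ GQ.
  exists 0%N, 0, Q; split=> //.
  + by move=> i; rewrite coef0; apply: subring0.
  + by rewrite expr0 scale1r mulr0 add0r.
  + by rewrite (leq_ltn_trans leQ) // lt0n size_poly_eq0.
have [lt|ge] := ltnP (size (map_poly f Q)) n.
  exists 0%N, 0, Q; split=> //.
  + by move=> i; rewrite coef0; apply: subring0.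
  + by rewrite expr0 scale1r mulr0 add0r.
have n0 : (0 < n)%N by rewrite lt0n size_poly_eq0.
set s := size (map_poly f Q) in leQ ge.
pose c := Q`_s.-1; pose S0 := c *: 'X^(s - n).
have GS0 : coefs_in G S0 := coefs_inZ sG (GQ _) (coefs_inXn _ sG).
have Ga : G a by apply: GP.
pose Q1 := a *: Q - P * S0.
have GQ1 : coefs_in G Q1 by apply: GB; [apply: coefs_inZ | apply: GM].
have sz : (size (map_poly f Q1) <= m)%N.
  apply/leq_sizeP => j lej; rewrite coef_map /Q1 coefB coefZ -scalerAr coefZ coefMXn.
  have nz j' : (n <= j')%N -> f P`_j' = 0.
    by move=> le; rewrite -coef_map nth_default.
  have sj : (s.-1 <= j)%N by lia.
  have s0 : (0 < s)%N by apply: leq_trans n0 ge.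
  rewrite ltnNge (leq_trans _ sj) /=; last by rewrite -ltnS prednK // ltn_subrL n0.
  case: (eqVneq j s.-1) => [->|nej].
    rewrite (_ : (s.-1 - (s - n) = n.-1)%N); last by lia.
    by rewrite mulrC subrr rmorph0.
  have ltj : (s <= j)%N by rewrite -(prednK s0) ltn_neqAle eq_sym nej.
  rewrite rmorphB !rmorphM /= -[f Q`_j]coef_map (nth_default _ ltj).
  rewrite (nz (j - (s - n))%N) ?mulr0 ?subr0 //.
  by lia.
have [k [S [M [GS GM1 E lt]]]] := IH Q1 sz GQ1.
exists k.+1, (a ^+ k *: S0 + S), M; split=> //.
  apply: (subringD (coefs_in_subring sG)) => //.
  by apply: coefs_inZ => //; apply: subringX.
rewrite exprSr -scalerA -[a *: Q](subrK (P * S0)) scalerDr E mulrDr -scalerAr.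
by rewrite -!scalerAr addrC addrA.
Qed.

Section Extension.
Variables (B : idomainType) (K : closedFieldType).
Implicit Types (G : B * K -> Prop) (D : B -> Prop).

(* A subring G of B * K satisfying this is the graph of a ring homomorphism to K
   from the subring [dom G] of B. *)
Definition functional G : Prop := forall y, G (0, y) -> y = 0.

Definition dom G (x : B) : Prop := exists y, G (x, y).

Local Notation pr1 := (map_poly (@fst B K)).
Local Notation pr2 := (map_poly (@snd B K)).

Lemma horner_pair (P : {poly B * K}) t r : P.[(t, r)] = ((pr1 P).[t], (pr2 P).[r]).
Proof.
rewrite [LHS]surjective_pairing.
congr pair; first exact/esym/(horner_map (@fst B K) P (t, r)).
exact/esym/(horner_map (@snd B K) P (t, r)).
Qed.

Lemma lift_coefs G p : is_subring G -> coefs_in (dom G) p ->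
  exists2 P, coefs_in G P & pr1 P = p.
Proof.
move=> sG Dp; have [c Gc] := choice Dp.
exists (\poly_(i < size p) (p`_i, c i)).
  by move=> i; rewrite coef_poly; case: ifP => // _; apply: subring0.
apply/polyP=> i; rewrite coef_map coef_poly; case: ltnP => //= le.
by rewrite nth_default.
Qed.

Lemma dom_adjoin G t r : is_subring G ->
  forall x, adjoin (dom G) t x <-> dom (adjoin G (t, r)) x.
Proof.
move=> sG x; split=> [[p Dp ->]|[y [P GP]]].
  have [P GP <-] := lift_coefs sG Dp.
  by exists (pr2 P).[r]; exists P => //; rewrite horner_pair.
rewrite horner_pair => -[-> _]; exists (pr1 P) => // i.
by exists (P`_i).2; rewrite coef_map /= -surjective_pairing.
Qed.

(* P lifts a polynomial p of minimal degree vanishing at t, and r is a root of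
   the image of p. *)
Lemma functional_algebraic G P t r :
  is_subring G -> functional G -> coefs_in G P -> pr1 P != 0 ->
  (forall q, coefs_in (dom G) q -> q.[t] = 0 -> q != 0 ->
     (size (pr1 P) <= size q)%N) ->
  (P`_(size (pr1 P)).-1).2 != 0 -> (pr1 P).[t] = 0 -> (pr2 P).[r] = 0 ->
  functional (adjoin G (t, r)).
Proof.
move=> sG fG GP nP minP nlc Pt Pr y [Q GQ]; rewrite horner_pair => -[Qt ->].
(* The first component of the remainder [M] vanishes at t and is smaller than the minimal one of
   [P], so it is 0, and then [M] = 0 because [G] is functional. The second components show that
   [a.2 ^+ k] times the value of [Q] at r is 0. *)
have [k [S [M [GS GM E lt]]]] := pseudo_division (f := @fst B K) sG GP nP GQ.
have GX := subringX k sG (GP (size (pr1 P)).-1).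
set a := P`_ _ in nlc E GX.
have := congr1 (fun Z => Z.[(t, r)]) E.
rewrite hornerZ hornerD hornerM !horner_pair Pt Pr -Qt => -[/=].
rewrite !mul0r !add0r !mulr0 => Mt Mr.
have M0 : pr1 M = 0.
  apply/eqP/negPn/negP => nM; have := minP (pr1 M).
  rewrite leqNgt lt => H; suff: false by [].
  apply: H => //; first by move=> i; exists (M`_i).2; rewrite coef_map /= -surjective_pairing.
have: M = 0.
  apply/polyP=> i; rewrite coef0 [M`_i]surjective_pairing.
  have E1 : (M`_i).1 = 0 by have := congr1 (fun Z : {poly B} => Z`_i) M0; rewrite coef_map coef0.
  rewrite E1 (fG (M`_i).2) // -E1 -surjective_pairing; exact: GM.
move=> M00; move: Mr; rewrite M00 rmorph0 horner0 => /eqP.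
have -> : (a ^+ k).2 = a.2 ^+ k by rewrite rmorphXn.
by rewrite mulf_eq0 expf_eq0 (negPf nlc) andbF /= => /eqP.
Qed.

Lemma minimal_element (T : Type) (Q : T -> Prop) (f : T -> nat) :
  (exists x, Q x) -> exists2 x, Q x & forall y, Q y -> (f x <= f y)%N.
Proof.
case=> x; elim: {x}(f x) {-2}x (leqnn (f x)) => [|n IH] x lex Qx.
  by exists x => // y _; apply: leq_trans lex _.
case: (pselect (exists2 y, Q y & (f y <= n)%N)) => [[y Qy ley]|H]; first exact: IH Qy.
by exists x => // y Qy; rewrite (leq_trans lex) // ltnNge; apply/negP => le; apply: H; exists y.
Qed.

(** Among the nonzero combinations of [p] and [q] take [h] of least degree: by pseudo-division a
    power of its leading coefficient times [p], and likewise [q], is a multiple of [h]. Since q(t)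
    is nonzero, so is h(t); hence the cofactor [s] of [p] vanishes at t, has at least the degree of
    [p], and [h] is constant. The identity inverts q(t) up to the denominator [a], without
    fractions. *)
Lemma bezout_minpoly D t p q : is_subring D -> coefs_in D p -> p != 0 ->
  p.[t] = 0 ->
  (forall u, coefs_in D u -> u.[t] = 0 -> u != 0 -> (size p <= size u)%N) ->
  coefs_in D q -> q.[t] != 0 ->
  exists u v a, [/\ coefs_in D u, coefs_in D v, D a, a != 0
                  & u * p + v * q = a%:P].
Proof.
move=> sD Dp np pt minp Dq qt.
have sP := coefs_in_subring sD; have [P1 PB PM] := sP.
pose Q (h : {poly B}) := h != 0 /\
  exists u v, [/\ coefs_in D u, coefs_in D v & u * p + v * q = h].
have [|h [nh [u [v [Du Dv E]]]] minh] := @minimal_element _ Q (fun h => size h).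
  exists p; split=> //; exists 1, 0; split=> //; first exact: subring0 sP.
  by rewrite mul1r mul0r addr0.
have Dh : coefs_in D h by rewrite -E; apply: (subringD sP); apply: PM.
have div g : coefs_in D g -> (exists u v, [/\ coefs_in D u, coefs_in D v & u * p + v * q = g]) ->
    exists k s, coefs_in D s /\ lead_coef h ^+ k *: g = h * s.
  move=> Dg [u1 [v1 [Du1 Dv1 Eg]]].
  have := pseudo_division (f := idfun) sD Dh _ Dg.
  rewrite !map_poly_id // => /(_ nh) [k [S [M [DS DM E1 lt]]]].
  have Dl : D (lead_coef h ^+ k) by apply: subringX => //; apply: Dh.
  exists k, S; split=> //.
  rewrite E1; case: (eqVneq M 0) => [->|nM]; first by rewrite addr0.
  have: Q M.
    split=> //; exists (lead_coef h ^+ k *: u1 - S * u), (lead_coef h ^+ k *: v1 - S * v).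
    split; first by apply: PB; [apply: coefs_inZ | apply: PM].
      by apply: PB; [apply: coefs_inZ | apply: PM].
    have -> : M = lead_coef h ^+ k *: g - h * S by rewrite /lead_coef E1 addrC addKr.
    by rewrite -Eg -E -!mul_polyC; ring.
  by move/minh; rewrite map_poly_id // in lt *; rewrite leqNgt lt.
have [|k [s [Ds Es]]] := div p Dp.
  by exists 1, 0; split=> //; rewrite ?mul1r ?mul0r ?addr0 //; apply: subring0 sP.
have [|k2 [s2 [Ds2 Es2]]] := div q Dq.
  by exists 0, 1; split=> //; rewrite ?mul1r ?mul0r ?add0r //; apply: subring0 sP.
have ht : h.[t] != 0.
  apply/eqP => ht; move/(congr1 (fun z => z.[t])): Es2.
  rewrite hornerZ hornerM ht mul0r => /eqP.
  by rewrite mulf_eq0 expf_eq0 lead_coef_eq0 (negPf nh) (negPf qt) andbF.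
have ns : s != 0.
  apply: contraNneq np => s0; move/eqP: Es; rewrite s0 mulr0 -mul_polyC mulf_eq0 polyC_eq0.
  by rewrite expf_eq0 lead_coef_eq0 (negPf nh) andbF.
have st : s.[t] = 0.
  move/(congr1 (fun z => z.[t])): Es; rewrite hornerZ hornerM pt mulr0 => /esym/eqP.
  by rewrite mulf_eq0 (negPf ht) => /eqP.
have sz : size h = 1%N.
  have := minp s Ds st ns.
  have := congr1 (fun z : {poly B} => size z) Es.
  rewrite size_scale ?expf_eq0 ?lead_coef_eq0 ?(negPf nh) ?andbF // => ->.
  rewrite size_mul // => le; have h0 : (0 < size h)%N by rewrite lt0n size_poly_eq0.
  have s0 : (0 < size s)%N by rewrite lt0n size_poly_eq0.
  by move: le h0 s0; case: (size h) (size s) => [|[|m1]] [|m2] //=; lia.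
have hC := size1_polyC (eq_leq sz).
exists u, v, h`_0; split=> //; last by rewrite E.
by move: nh; rewrite {1}hC polyC_eq0.
Qed.

(** The element [a] is chosen before [G] and must serve every homomorphism on D. If t is algebraic
    over D, r is a root of the image of its minimal polynomial; otherwise r is any point where the
    image of [q], with b = q(t), does not vanish. *)
Lemma extend_step D t b : is_subring D -> adjoin D t b -> b != 0 ->
  exists a, [/\ D a, a != 0 & forall G, is_subring G -> functional G ->
    (forall x, D x <-> dom G x) -> (forall y, G (a, y) -> y != 0) ->
    exists r, functional (adjoin G (t, r)) /\
      forall y, adjoin G (t, r) (b, y) -> y != 0].
Proof.
move=> sD [q Dq bE] nb.
have Dco G (GD : forall x, D x <-> dom G x) p : coefs_in D p -> coefs_in (dom G) p.
  by move=> Dp i; apply/GD.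
have valb G r (sG : is_subring G) Q y : functional (adjoin G (t, r)) -> coefs_in G Q -> pr1 Q = q ->
    adjoin G (t, r) (b, y) -> y = (pr2 Q).[r].
  move=> fG GQ EQ Gb; apply/eqP; rewrite -subr_eq0; apply/eqP; apply: fG.
  have -> : (0, y - (pr2 Q).[r]) = (b, y) - Q.[(t, r)].
    by rewrite horner_pair EQ -bE; congr pair; rewrite subrr.
  by have [_ + _] := adjoin_subring (t, r) sG; apply=> //; exists Q.
case: (pselect (exists p, [/\ coefs_in D p, p != 0 & p.[t] = 0])) => [alg|tr].
  have [p [Dp np pt] minp] := @minimal_element _ _ (fun p : {poly B} => size p) alg.
  have minp' u : coefs_in D u -> u.[t] = 0 -> u != 0 -> (size p <= size u)%N.
    by move=> Du ut nu; apply: minp.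
  have [|u [v [a1 [Du Dv Da1 na1 E]]]] := bezout_minpoly sD Dp np pt minp' Dq.
    by rewrite -bE.
  (* The first factor keeps the degree of [p] under [G], so that its image has a root; the second is
     the denominator of the Bezout identity, whose image forces the value at [b] to be nonzero. *)
  exists (lead_coef p * a1); split; first by case: sD => _ _ DM; apply: DM => //; apply: Dp.
    by rewrite mulf_neq0 // lead_coef_eq0.
  move=> G sG fG GD na.
  have [P GP EP] := lift_coefs sG (Dco _ GD _ Dp).
  have [Q GQ EQ] := lift_coefs sG (Dco _ GD _ Dq).
  have [U GU EU] := lift_coefs sG (Dco _ GD _ Du).
  have [V GV EV] := lift_coefs sG (Dco _ GD _ Dv).
  have [a1' Ga1] := (GD a1).1 Da1.
  have [_ GB GM] := sG.
  set l := P`_(size p).-1.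
  have lE : l = (lead_coef p, l.2).
    by rewrite [LHS]surjective_pairing; congr pair; rewrite lead_coefE -{1}EP coef_map.
  have : l.2 * a1' != 0.
    apply: na; have -> : (lead_coef p * a1, l.2 * a1') = l * (a1, a1') by rewrite lE.
    by apply: GM => //; apply: GP.
  rewrite mulf_eq0 negb_or => /andP[nl na1'].
  have /closed_rootP[r /rootP rP] : size (pr2 P) != 1%N.
    have szp : (1 < size p)%N.
      rewrite ltnNge; apply/negP => le; have pC := size1_polyC le.
      by move: np pt; rewrite pC hornerC polyC_eq0 => /eqP.
    rewrite neq_ltn; apply/orP; right; apply: (leq_trans (szp)).
    rewrite -(ltn_predK szp) ltnNge; apply/negP => /leq_sizeP/(_ _ (leqnn _)).
    by rewrite coef_map => /eqP; apply/negP.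
  have fG' : functional (adjoin G (t, r)).
    apply: (functional_algebraic (P := P)) => //; rewrite ?EP //.
    by move=> z Dz; apply: minp' => i; apply/GD.
  exists r; split=> // y /(valb _ _ sG _ _ fG' GQ EQ) ->.
  (* Both sides have coefficients in [G] and equal first components, so functionality makes the
     Bezout identity hold in the second components too. *)
  have EE : U * P + V * Q = (a1, a1')%:P.
    apply/eqP; rewrite -subr_eq0; apply/eqP/polyP => i; rewrite coef0.
    have sP := coefs_in_subring sG; have [P1 PB PM] := sP.
    set Z := _ - _; have GZ : coefs_in G Z.
      by apply: PB; [apply: (subringD sP); apply: PM | apply: coefs_inC].
    have Z0 : pr1 Z = 0.
      by rewrite rmorphB rmorphD !rmorphM /= EP EQ EU EV E map_polyC /= subrr.
    have E1 : (Z`_i).1 = 0.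
      by have := congr1 (fun z : {poly B} => z`_i) Z0; rewrite coef_map coef0.
    rewrite [Z`_i]surjective_pairing E1 (fG (Z`_i).2) // -E1 -surjective_pairing; exact: GZ.
  have := congr1 (fun z => (pr2 z).[r]) EE.
  rewrite rmorphD !rmorphM map_polyC /= hornerC hornerD !hornerM rP mulr0 add0r => Ea.
  by apply: contraNneq na1' => Q0; rewrite -Ea Q0 mulr0.
(* In the transcendental case no relation constrains r; it suffices that the image of [q] is a
   nonzero polynomial. *)
exists (lead_coef q); split; first exact: Dq.
  by rewrite lead_coef_eq0; apply: contraNneq nb => q0; rewrite bE q0 horner0.
move=> G sG fG GD na.
have [Q GQ EQ] := lift_coefs sG (Dco _ GD _ Dq).
have nQ : pr2 Q != 0.
  have : (Q`_(size q).-1).2 != 0.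
    apply: na; rewrite lead_coefE -EQ coef_map -surjective_pairing EQ; exact: GQ.
  by apply: contraNneq => Q0; rewrite -coef_map Q0 coef0.
have /closed_nonrootP[r /rootP rQ] := nQ.
have fG' : functional (adjoin G (t, r)).
  move=> y [P GP]; rewrite horner_pair => -[Pt ->].
  have GP1 : coefs_in D (pr1 P).
    by move=> i; apply/GD; exists (P`_i).2; rewrite coef_map -surjective_pairing.
  have P0 : pr1 P = 0 by apply/eqP/negPn/negP => nP; apply: tr; exists (pr1 P).
  suff -> : P = 0 by rewrite rmorph0 horner0.
  apply/polyP=> i; rewrite coef0.
  have E1 : (P`_i).1 = 0.
    by have := congr1 (fun z : {poly B} => z`_i) P0; rewrite coef_map coef0.
  rewrite [P`_i]surjective_pairing E1 (fG (P`_i).2) // -E1 -surjective_pairing; exact: GP.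
by exists r; split=> // y /(valb _ _ sG _ _ fG' GQ EQ) ->; apply/eqP.
Qed.

(** The nonvanishing condition is pulled back from the last generator to the first; the homomorphism
    is then extended in the opposite order. *)
Lemma extend_seq ts D b : is_subring D -> foldl (@adjoin B) D ts b -> b != 0 ->
  exists a, [/\ D a, a != 0 & forall G, is_subring G -> functional G ->
    (forall x, D x <-> dom G x) -> (forall y, G (a, y) -> y != 0) ->
    exists2 rs, size rs = size ts &
      let G' := foldl (@adjoin _) G (zip ts rs) in
      functional G' /\ forall y, G' (b, y) -> y != 0].
Proof.
elim: ts D b => [|t ts IH] D b sD /= Db nb.
  by exists b; split=> // G sG fG GD nb'; exists [::].
have [a1 [Da1 na1 H1]] := IH _ _ (adjoin_subring t sD) Db nb.
have [a [Da na H]] := extend_step sD Da1 na1.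
exists a; split=> // G sG fG GD nGa.
have [r [fG1 nGa1]] := H G sG fG GD nGa.
have [|rs sz R] := H1 _ (adjoin_subring (t, r) sG) fG1 _ nGa1.
  move=> x; split=> [[p Dp E]|/(dom_adjoin t r sG x)[p Dp E]].
    by apply/(dom_adjoin t r sG x); exists p => // i; apply/GD.
  by exists p => // i; apply/GD.
by exists (r :: rs); rewrite //= sz.
Qed.

End Extension.

Section PolynomialPoints.
Variables (K : closedFieldType) (n : nat).
Local Notation B := {mpoly K[n]}.

Lemma foldl_adjoin (R : comNzRingType) (ts : seq R) D : is_subring D ->
  [/\ is_subring (foldl (@adjoin R) D ts),
      forall x, D x -> foldl (@adjoin R) D ts x
    & forall t, t \in ts -> foldl (@adjoin R) D ts t].
Proof.
elim: ts D => [|t ts IH] D sD //=.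
have [s1 s2 s3] := IH _ (adjoin_subring t sD); split=> // [x Dx|x].
  by apply: s2; apply: adjoin_base.
by rewrite inE => /predU1P[->|/s3 //]; apply: s2; apply: adjoin_gen.
Qed.

(* Chevalley's extension theorem for the inclusion of D in K[X_1,..,X_n]. *)
Lemma extend_to_point (D : B -> Prop) (b : B) :
  is_subring D -> (forall c, D c%:MP) -> b != 0 ->
  exists a, [/\ D a, a != 0 & forall G : B * K -> Prop,
    is_subring G -> functional G -> (forall c, G (c%:MP, c)) ->
    (forall x, D x <-> dom G x) -> (forall y, G (a, y) -> y != 0) ->
    exists2 v : 'I_n -> K, b.@[v] != 0 & forall d y, G (d, y) -> y = d.@[v]].
Proof.
move=> sD DC nb; pose ts := [seq 'X_i : B | i <- enum 'I_n].
(* D contains the constants, so adjoining the variables gives the whole polynomial ring. *)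
have mem P : foldl (@adjoin B) D ts P.
  have [sF F1 F2] := foldl_adjoin ts sD; rewrite [P]mpolyE.
  apply: subring_sum => // m _; rewrite -mul_mpolyC; case: (sF) => _ _; apply.
    exact/F1/DC.
  rewrite mpolyXE_id; apply: subring_prod => // i _; apply: subringX => //.
  by apply: F2; apply: map_f; rewrite mem_enum.
have [a [Da na H]] := extend_seq K sD (mem b) nb.
exists a; split=> // G sG fG GC GD nGa.
have [rs sz [fG' nGb]] := H G sG fG GD nGa.
pose v (i : 'I_n) := rs`_i; set G' := foldl _ _ _ in fG' nGb.
have [sF F1 F2] := foldl_adjoin (zip ts rs) sG; rewrite -/G' in sF F1 F2.
have szts : size ts = n by rewrite size_map size_enum_ord.
have memX i : G' ('X_i, v i).
  apply: F2; have -> : ('X_i, v i) = nth (0, 0) (zip ts rs) i.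
    rewrite nth_zip // (nth_map i) ?size_enum_ord //; congr ('X_ _, _).
    by apply: val_inj; rewrite /= nth_enum_ord.
  by apply: mem_nth; rewrite size_zip sz szts minnn.
(* The extended graph contains the graph of the evaluation at [v]; being functional, it agrees with
   it on [D]. *)
have memP P : G' (P, P.@[v]).
  have -> : (P, P.@[v]) =
      \sum_(m <- msupp P) ((P@_m)%:MP, P@_m) * \prod_(i < n) ('X_i, v i) ^+ (m i).
    rewrite [RHS]surjective_pairing; congr pair.
      rewrite (raddf_sum (@fst B K)) {1}[P]mpolyE; apply: eq_bigr => m _.
      rewrite -mul_mpolyC mpolyXE_id -[RHS]/(_ * _.1) rmorph_prod; congr (_ * _).
      by apply: eq_bigr => i _; rewrite (rmorphXn (@fst B K)).
    rewrite (raddf_sum (@snd B K)) mevalE; apply: eq_bigr => m _.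
    rewrite -[RHS]/(_ * _.2) rmorph_prod; congr (_ * _).
    by apply: eq_bigr => i _; rewrite (rmorphXn (@snd B K)).
  apply: subring_sum => // m _; case: (sF) => _ _; apply; first exact/F1/GC.
  by apply: subring_prod => // i _; apply: subringX.
exists v; first exact: nGb.
move=> d y Gd; apply/eqP; rewrite -subr_eq0; apply/eqP; apply: fG'.
have -> : (0, y - d.@[v]) = (d, y) - (d, d.@[v]) by congr pair; rewrite subrr.
by case: (sF) => _ + _; apply=> //; apply: F1.
Qed.

(** Chevalley's theorem for D = K and its identity homomorphism. *)
Lemma mpoly_nonroot (P : B) : P != 0 -> exists v, P.@[v] != 0.
Proof.
move=> nP; pose D (x : B) := exists c : K, x = c%:MP.
have sD : is_subring D.
  split=> [|_ _ [c ->] [d ->]|_ _ [c ->] [d ->]].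
  - by exists 1; rewrite mpolyC1.
  - by exists (c - d); rewrite mpolyCB.
  - by exists (c * d); rewrite mpolyCM.
have [|a [[c ->] na H]] := extend_to_point sD _ nP; first by move=> c; exists c.
pose G (z : B * K) := exists c : K, z = (c%:MP, c).
have [||||z|v nv _] := H G; last by exists v.
- split=> [|_ _ [d ->] [e ->]|_ _ [d ->] [e ->]].
  + by exists 1; rewrite mpolyC1.
  + by exists (d - e); rewrite mpolyCB.
  + by exists (d * e); rewrite mpolyCM.
- move=> y [d E]; have -> : y = d := congr1 snd E.
  have := congr1 (fun z : B * K => meval (fun=> 0) z.1) E.
  by rewrite /= mevalC => <-; apply: meval0.
- by move=> d; exists d.
- by move=> x; split=> [[d ->]|[y [d [-> _]]]]; [exists d, d | exists d].
case=> d E; have -> : z = d := congr1 snd E.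
apply: contraNneq na => d0; have -> : c%:MP = d%:MP := congr1 fst E.
by apply/eqP; rewrite d0; exact: mpolyC0.
Qed.

Lemma eq_mpoly_fun (P Q : B) : (forall v, P.@[v] = Q.@[v]) -> P = Q.
Proof.
move=> E; apply/eqP; rewrite -subr_eq0; apply/negPn/negP => /mpoly_nonroot[v].
by rewrite rmorphB /= E subrr eqxx.
Qed.

End PolynomialPoints.

(** * Multilinear calculus *)

Section Multilinear.
Variables (K : fieldType) (V : vectType K).
Implicit Types n m : nat.

Lemma multilinear_sum n (I : Type) (r : seq I) (P : pred I) (F : I -> n.-tuple V -> K) :
  (forall i, multilinear (F i)) -> multilinear (fun w => \sum_(i <- r | P i) F i w).
Proof.
move=> FM w i a u v; rewrite mulr_sumr -big_split.
by apply: eq_bigr => j _; apply: FM.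
Qed.

Lemma multilinearZ n c (F : n.-tuple V -> K) :
  multilinear F -> multilinear (fun w => c * F w).
Proof. by move=> FM w i a u v; rewrite FM mulrDr mulrCA. Qed.

Lemma multilinearZr n c (F : n.-tuple V -> K) :
  multilinear F -> multilinear (fun w => F w * c).
Proof. by move=> FM w i a u v; rewrite FM mulrDl mulrA. Qed.

Definition pull (T : Type) m n (s : 'I_m -> 'I_n) (w : n.-tuple T) : m.-tuple T :=
  [tuple tnth w (s i) | i < m].

Lemma pull_tset_in (T : Type) m n (s : 'I_m -> 'I_n) (w : n.-tuple T) j u :
  injective s -> pull s (tset w (s j) u) = tset (pull s w) j u.
Proof. by move=> sI; apply: eq_from_tnth => i; rewrite !tnth_mktuple (inj_eq sI). Qed.

Lemma pull_tset_out (T : Type) m n (s : 'I_m -> 'I_n) (w : n.-tuple T) i u :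
  (forall j, s j != i) -> pull s (tset w i u) = pull s w.
Proof.
by move=> sN; apply: eq_from_tnth => j; rewrite !tnth_mktuple (negPf (sN j)).
Qed.

Lemma multilinear_pull m n (s : 'I_m -> 'I_n) (F : m.-tuple V -> K) :
  bijective s -> multilinear F -> multilinear (fun w => F (pull s w)).
Proof.
move=> [t st ts] FM w i a u v; rewrite -(ts i) !pull_tset_in ?FM //; exact: can_inj st.
Qed.

Lemma multilinear_comp (V' : vectType K) n (f : {linear V' -> V}) (F : n.-tuple V -> K) :
  multilinear F -> multilinear (fun w => F [tuple f (tnth w i) | i < n]).
Proof.
move=> FM w i a u v.
have E x : [tuple f (tnth (tset w i x) j) | j < n] = tset [tuple f (tnth w j) | j < n] i (f x).
  by apply: eq_from_tnth => j; rewrite !tnth_mktuple; case: eqP.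
by rewrite !E linearP FM.
Qed.

Lemma multilinear_split m n N (s : 'I_m -> 'I_N) (t : 'I_n -> 'I_N)
    (F : m.-tuple V -> K) (G : n.-tuple V -> K) :
  injective s -> injective t -> (forall i j, s i != t j) ->
  (forall k, (exists i, k = s i) \/ (exists j, k = t j)) ->
  multilinear F -> multilinear G -> multilinear (fun w => F (pull s w) * G (pull t w)).
Proof.
move=> sI tI st cov FM GM w k a u v.
case: (cov k) => [[i ->]|[j ->]].
  have E x : pull t (tset w (s i) x) = pull t w.
    by apply: pull_tset_out => j; rewrite eq_sym.
  by rewrite !pull_tset_in // !E FM mulrDl mulrA.
have E x : pull s (tset w (t j) x) = pull s w by apply: pull_tset_out => i.
by rewrite !(pull_tset_in (s := t)) // !E GM mulrDr mulrCA.
Qed.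

Lemma split_cases m n (k : 'I_(m + n)) :
  (exists i, k = lshift n i) \/ (exists j, k = rshift m j).
Proof. by case: (splitP k) => i E; [left|right]; exists i; apply: val_inj. Qed.

Lemma lr_neq m n (i : 'I_m) (j : 'I_n) : lshift n i != rshift m j.
Proof. by apply/eqP => /(congr1 val) /= E; have := ltn_ord i; rewrite E ltnNge leq_addr. Qed.

Lemma multilinear_mul m n (F : m.-tuple V -> K) (G : n.-tuple V -> K) :
  multilinear F -> multilinear G ->
  multilinear (fun w : (m + n).-tuple V =>
    F (pull (lshift n) w) * G (pull (@rshift m _) w)).
Proof.
apply: multilinear_split; [exact: lshift_inj | exact: rshift_inj | exact: lr_neq |].
exact: split_cases.
Qed.

Lemma multilinear_cat m n (F : (m + n).-tuple V -> K) (t : n.-tuple V) :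
  multilinear F -> multilinear (fun w : m.-tuple V => F [tuple of w ++ t]).
Proof.
move=> FM w i a u v.
have E x : [tuple of tset w i x ++ t] = tset [tuple of w ++ t] (lshift n i) x.
  apply: eq_from_tnth => k; rewrite !tnth_mktuple.
  case: (split_cases k) => [[j ->]|[j ->]].
    by rewrite !tnth_lshift tnth_mktuple (inj_eq (@lshift_inj _ _)).
  by rewrite !tnth_rshift eq_sym (negPf (lr_neq _ _)).
by rewrite !E FM.
Qed.

Lemma multilinear_cat_l m n (F : (m + n).-tuple V -> K) (t : m.-tuple V) :
  multilinear F -> multilinear (fun w : n.-tuple V => F [tuple of t ++ w]).
Proof.
move=> FM w i a u v.
have E x : [tuple of t ++ tset w i x] = tset [tuple of t ++ w] (rshift m i) x.
  apply: eq_from_tnth => k; rewrite !tnth_mktuple.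
  case: (split_cases k) => [[j ->]|[j ->]].
    by rewrite !tnth_lshift (negPf (lr_neq _ _)).
  by rewrite !tnth_rshift tnth_mktuple (inj_eq (@rshift_inj _ _)).
by rewrite !E FM.
Qed.

End Multilinear.

Section TensorCalculus.
Variables (K : fieldType) (W : vectType K).
Implicit Types p q r s : nat.

Lemma evD p q (x y : tens W p q) phi w : ev (x + y) phi w = ev x phi w + ev y phi w.
Proof. by have := ev_lin 1 x y phi w; rewrite scale1r mul1r. Qed.

Lemma evZ p q a (x : tens W p q) phi w : ev (a *: x) phi w = a * ev x phi w.
Proof. by have := ev_lin a x 0 phi w; rewrite addr0 ev0 addr0. Qed.

Lemma ev_sum p q I (r : seq I) (P : pred I) (F : I -> tens W p q) phi w :
  ev (\sum_(i <- r | P i) F i) phi w = \sum_(i <- r | P i) ev (F i) phi w.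
Proof.
elim/big_rec2: _ => [|i y1 y2 _ <-]; [exact: ev0 | exact: evD].
Qed.

Lemma evB p q (x y : tens W p q) phi w : ev (x - y) phi w = ev x phi w - ev y phi w.
Proof. by rewrite evD -scaleN1r evZ mulN1r. Qed.

Section Extensionality.
Variables (n : nat) (f : 'I_n -> dual W) (e : 'I_n -> W).
Hypothesis fS : forall phi : dual W, exists c, phi = \sum_i c i *: f i.
Hypothesis eS : forall w : W, exists c, w = \sum_i c i *: e i.

Lemma coev_eq0 q (x : cotens W q) :
  (forall J : q.-tuple 'I_n, coev x [tuple of map e J] = 0) -> x = 0.
Proof.
elim: q x => [|q IHq] x x0; first by have := x0 [tuple]; apply.
apply/lfunP=> w; have [c ->] := eS w; rewrite zero_lfunE linear_sum big1 // => i _.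
rewrite linearZ /= (IHq (x (e i))) ?scaler0 // => J.
have := x0 [tuple of i :: J].
rewrite (_ : [tuple of map e _] = [tuple of e i :: [tuple of map e J]]); last exact: val_inj.
by rewrite /= theadE => <-; congr coev; apply: val_inj.
Qed.

Lemma ev_eq0 p q (x : tens W p q) :
  (forall (I : p.-tuple 'I_n) (J : q.-tuple 'I_n),
     ev x [tuple of map f I] [tuple of map e J] = 0) -> x = 0.
Proof.
elim: p x => [|p IHp] x x0; first by apply: coev_eq0 => J; exact: (x0 [tuple] J).
apply/lfunP=> w; have [c ->] := fS w; rewrite zero_lfunE linear_sum big1 // => i _.
rewrite linearZ /= (IHp (x (f i))) ?scaler0 // => I J.
have := x0 [tuple of i :: I] J.
rewrite (_ : [tuple of map f _] = [tuple of f i :: [tuple of map f I]]); last exact: val_inj.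
by rewrite /= theadE => <-; congr ev; apply: val_inj.
Qed.

Lemma eq_tens_on p q (x y : tens W p q) :
  (forall (I : p.-tuple 'I_n) (J : q.-tuple 'I_n),
     ev x [tuple of map f I] [tuple of map e J] =
     ev y [tuple of map f I] [tuple of map e J]) -> x = y.
Proof.
move=> E; apply/eqP; rewrite -subr_eq0; apply/eqP/ev_eq0 => I J.
by rewrite evB E subrr.
Qed.
End Extensionality.

Lemma coord_base (w : W) i : coord (vbasis (fullv : {vspace W})) i w = (cobase i : 'Hom(W, K^o)) w.
Proof. by rewrite linfun_lin // => a u v; rewrite linearP. Qed.

Lemma base_expansion (w : W) : w = \sum_i (cobase i : 'Hom(W, K^o)) w *: base i.
Proof.
rewrite {1}(coord_vbasis (memvf w)); apply: eq_bigr => i _.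
by rewrite coord_base /base (tnth_nth 0).
Qed.

Lemma cobase_base i j : (cobase i : 'Hom(W, K^o)) (base j) = (i == j)%:R.
Proof.
rewrite -coord_base /base (tnth_nth 0) coord_free ?(basis_free (vbasisP _)) //.
by rewrite eq_sym.
Qed.

Lemma cobase_expansion (phi : dual W) :
  phi = \sum_i (phi : 'Hom(W, K^o)) (base i) *: cobase i.
Proof.
apply/lfunP => w; rewrite {1}[w]base_expansion linear_sum sum_lfunE.
by apply: eq_bigr => i _; rewrite linearZ scale_lfunE; apply: mulrC.
Qed.

Lemma eq_tens_base p q (x y : tens W p q) :
  (forall (I : p.-tuple 'I_(dimW W)) (J : q.-tuple 'I_(dimW W)),
     ev x [tuple of map (@cobase K W) I] [tuple of map (@base K W) J] =
     ev y [tuple of map (@cobase K W) I] [tuple of map (@base K W) J]) -> x = y.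
Proof.
apply: eq_tens_on => [phi|w].
  by exists (fun i => (phi : 'Hom(W, K^o)) (base i)); apply: cobase_expansion.
by exists (fun i => (cobase i : 'Hom(W, K^o)) w); apply: base_expansion.
Qed.

Lemma eq_tens p q (x y : tens W p q) :
  (forall phi w, ev x phi w = ev y phi w) -> x = y.
Proof. by move=> E; apply: eq_tens_base => I J; apply: E. Qed.

Lemma tens_idE phi w :
  ev (tens_id W) phi w = (thead phi : 'Hom(W, K^o)) (thead w).
Proof.
have e1 (T : Type) (t : 1.-tuple T) i v : thead (tset t i v) = v.
  by rewrite /thead tnth_mktuple (ord1 i).
apply: tens_ofE => [w'|phi'] t i a u v; rewrite !e1 ?linearP //.
by rewrite add_lfunE scale_lfunE.
Qed.

Lemma tens_mulE p q r s (x : tens W p q) (y : tens W r s) phi w :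
  ev (tens_mul x y) phi w =
  ev x (pull (lshift r) phi) (pull (lshift s) w) *
  ev y (pull (@rshift p _) phi) (pull (@rshift q _) w).
Proof.
apply: tens_ofE => [w'|phi'].
  exact: (multilinear_mul (ev_multiL x _) (ev_multiL y _)).
exact: (multilinear_mul (ev_multiR x _) (ev_multiR y _)).
Qed.

(** A form of [tens_perm] between types that are not syntactically equal, which avoids casts along p
    = p' and q = q'; it is intended for bijections [s] and [t]. *)
Definition tens_reindex p q p' q' (s : 'I_p -> 'I_p') (t : 'I_q -> 'I_q') (x : tens W p q) :
    tens W p' q' := tens_of (fun phi w => ev x (pull s phi) (pull t w)).

Lemma tens_reindexE p q p' q' (s : 'I_p -> 'I_p') (t : 'I_q -> 'I_q') (x : tens W p q) phi w :
  bijective s -> bijective t ->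
  ev (tens_reindex s t x) phi w = ev x (pull s phi) (pull t w).
Proof.
move=> sB tB; apply: tens_ofE => [w'|phi'].
  exact: (multilinear_pull sB (ev_multiL x _)).
exact: (multilinear_pull tB (ev_multiR x _)).
Qed.

Lemma tens_reindex_perm p q (s : 'I_p -> 'I_p) (t : 'I_q -> 'I_q) (x : tens W p q)
    (sI : injective s) (tI : injective t) :
  tens_reindex s t x = tens_perm (perm sI) (perm tI) x.
Proof.
rewrite /tens_reindex /tens_perm; congr tens_of.
by apply: boolp.funext => phi; apply: boolp.funext => w; congr ev;
  apply: eq_from_tnth => i; rewrite !tnth_mktuple permE.
Qed.

Lemma bij_ord_eq p p' (s : 'I_p -> 'I_p') : bijective s -> p' = p.
Proof. by move=> /bij_eq_card; rewrite !card_ord. Qed.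

Lemma tens_contrE p q (x : tens W p.+1 q.+1) phi w :
  ev (tens_contr x) phi w =
  \sum_i ev x [tuple of cobase i :: phi] [tuple of base i :: w].
Proof.
apply: tens_ofE => [w'|phi']; apply: multilinear_sum => i.
  exact: (multilinear_tl (f := fun phi => ev x phi _) _ (ev_multiL _ _)).
exact: (multilinear_tl _ (ev_multiR _ _)).
Qed.

Lemma tens_permE p q (s : 'S_p) (t : 'S_q) (x : tens W p q) phi w :
  ev (tens_perm s t x) phi w = ev x (pull s phi) (pull t w).
Proof.
by apply: (tens_reindexE (s := s) (t := t)); [exists (s^-1)%g | exists (t^-1)%g] => i;
  rewrite ?permK ?permKV.
Qed.

Lemma hom_of_tensE p q a b (t : tens W (a + q) (b + p)) (v : tens W p q) phi w :
  ev (hom_of_tens t v) phi w =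
  \sum_(i : p.-tuple 'I_(dimW W)) \sum_(j : q.-tuple 'I_(dimW W))
      ev v [tuple of map (@cobase K W) i] [tuple of map (@base K W) j] *
      ev t [tuple of phi ++ map (@cobase K W) j]
           [tuple of w ++ map (@base K W) i].
Proof.
rewrite linfun_lin => [|c u u'].
  apply: tens_ofE => [w'|phi']; apply: multilinear_sum => i;
    apply: multilinear_sum => j; apply: multilinearZ.
    exact: (multilinear_cat (F := fun phi => ev t phi _) [tuple of map _ j] (ev_multiL _ _)).
  exact: (multilinear_cat [tuple of map _ i] (ev_multiR _ _)).
apply: tens_of_comb => phi' w'; rewrite mulr_sumr -big_split; apply: eq_bigr => i _.
rewrite mulr_sumr -big_split; apply: eq_bigr => j _.
by rewrite ev_lin mulrDl mulrA.
Qed.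

End TensorCalculus.

Lemma tens_pushE (K : fieldType) (W W' : vectType K) (psi : 'Hom(W, W'))
    (psi' : 'Hom(W', W)) p q (x : tens W p q) phi w :
  ev (tens_push psi psi' x) phi w =
  ev x [tuple (tnth phi i \o psi)%VF | i < p] [tuple psi' (tnth w j) | j < q].
Proof.
apply: tens_ofE => [w'|phi']; last exact: (multilinear_comp psi' (ev_multiR x _)).
move=> t i a u v.
have E y : [tuple (tnth (tset t i y) j \o psi)%VF | j < p] =
           tset [tuple (tnth t j \o psi)%VF | j < p] i (y \o psi)%VF.
  by apply: eq_from_tnth => j; rewrite !tnth_mktuple; case: eqP.
rewrite !E; have -> : ((a *: u + v) \o psi)%VF = a *: (u \o psi)%VF + (v \o psi)%VF.
  by rewrite comp_lfunDl comp_lfunZl.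
exact: (ev_multiL x).
Qed.

(** * Polarization *)

Lemma big_tuple_cons (R : nmodType) n (T : finType) (F : n.+1.-tuple T -> R) :
  \sum_(L : n.+1.-tuple T) F L =
  \sum_(a : T) \sum_(L : n.-tuple T) F [tuple of a :: L].
Proof.
rewrite pair_big /=.
pose h (z : T * n.-tuple T) : n.+1.-tuple T := [tuple of z.1 :: z.2].
rewrite (reindex h) //=; exists (fun L => (thead L, [tuple of behead L])).
  by case=> a L _; rewrite /h /= theadE; congr pair; apply: val_inj.
by move=> L _; rewrite /h /= -tuple_eta.
Qed.

Lemma big_tuple0 (R : nmodType) (T : finType) (F : 0.-tuple T -> R) :
  \sum_(L : 0.-tuple T) F L = F [tuple].
Proof.
rewrite (bigD1 [tuple]) //= big1 ?addr0 // => L /eqP[].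
exact: tuple0.
Qed.

Lemma map_tnth (A B : Type) n (f : A -> B) (t : n.-tuple A) :
  [tuple of map f t] = [tuple f (tnth t i) | i < n].
Proof. by apply: eq_from_tnth => i; rewrite tnth_map tnth_mktuple. Qed.

Lemma mktupleS (T : Type) n (F : 'I_n.+1 -> T) :
  [tuple F i | i < n.+1] = [tuple of F ord0 :: [tuple F (lift ord0 i) | i < n]].
Proof.
apply: eq_from_tnth => j; rewrite tnth_mktuple.
by case: (unliftP ord0 j) => [k|] -> //; rewrite tnthS tnth_mktuple.
Qed.

Section Expansion.
Variables (K : fieldType) (V : vectType K).

Lemma multilinear_hd_sum n (h : n.+1.-tuple V -> K) (w : n.-tuple V) N
    (c : 'I_N -> K) (u : 'I_N -> V) : multilinear h ->
  h [tuple of \sum_l c l *: u l :: w] = \sum_l c l * h [tuple of u l :: w].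
Proof.
move=> hM; have h0 : h [tuple of 0 :: w] = 0.
  have := multilinear_hd w (-1) 0 0 hM.
  by rewrite scaler0 addr0 mulN1r addNr.
elim/big_rec2: _ => [|l y1 y2 _ <-]; first exact: h0.
exact: multilinear_hd.
Qed.

Lemma multilinear_expand q (h : q.-tuple V -> K) N (c : 'I_q -> 'I_N -> K)
    (w : 'I_N -> V) : multilinear h ->
  h [tuple \sum_l c a l *: w l | a < q] =
  \sum_(L : q.-tuple 'I_N) (\prod_a c a (tnth L a)) * h [tuple of map w L].
Proof.
elim: q h c => [|q IH] h c hM.
  rewrite big_tuple0 big_ord0 mul1r; congr h.
  by rewrite [LHS]tuple0 [RHS]tuple0.
rewrite mktupleS multilinear_hd_sum // big_tuple_cons; apply: eq_bigr => l _.
rewrite (IH (fun t => h [tuple of w l :: t]) (fun a => c (lift ord0 a))); last first.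
  exact: multilinear_tl.
rewrite mulr_sumr; apply: eq_bigr => L _; rewrite mulrA; congr (_ * _).
  rewrite big_ord_recl; congr (_ * _); apply: eq_bigr => a _.
  by congr (c _ _); rewrite tnthS.
by congr h; apply: val_inj.
Qed.
End Expansion.

(** Each index occurs exactly once, so [L] is a bijection of index sets written as a tuple. These
    are the tuples whose monomial is s_1 .. s_N. *)
Definition listing q N (L : q.-tuple 'I_N) : bool :=
  [forall l : 'I_N, count_mem l L == 1%N].

Lemma listing_bij q N (L : q.-tuple 'I_N) : listing L -> bijective (tnth L).
Proof.
move=> /forallP H.
have memL l : l \in L by rewrite -has_pred1 has_count (eqP (H l)).
have uL : uniq L.
  by apply: count_mem_uniq => l; rewrite memL (eqP (H l)).
have inj : injective (tnth L) by apply/tuple_uniqP.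
apply: (inj_card_bij inj); rewrite !card_ord -[leqRHS](size_tuple L).
rewrite -{1}(size_enum_ord N); apply: uniq_leq_size; first exact: enum_uniq.
by move=> l _; apply: memL.
Qed.

Lemma listing_ord N : listing (ord_tuple N).
Proof.
apply/forallP => l; have -> : tval (ord_tuple N) = enum 'I_N by apply: val_ord_tuple.
by rewrite count_uniq_mem ?enum_uniq // mem_enum.
Qed.

(** N! for q = N and 0 otherwise: the multiplicity produced by polarizing a form in q arguments and
    restituting it. *)
Definition listings q N : nat := #|[pred L : q.-tuple 'I_N | listing L]|.

Lemma listings_neq q N : q != N -> listings q N = 0%N.
Proof.
move=> /eqP ne; apply: eq_card0 => L; rewrite !inE; apply/negP => /listing_bij/bij_eq_card.
by rewrite !card_ord => /ne.
Qed.

Lemma listings_gt0 N : (0 < listings N N)%N.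
Proof. by apply/card_gt0P; exists (ord_tuple N); rewrite inE listing_ord. Qed.

Section Polarization.
Variables (K : closedFieldType) (V : vectType K).

(* Substitute e_j = sum_{i_l = j} s_l w_l and compare the coefficients of
   s_1 .. s_N. *)
Lemma polarize (kT : finType) (q : kT -> nat) n (J : forall k, (q k).-tuple 'I_n)
    (h : forall k, (q k).-tuple V -> K) :
  (forall k, multilinear (h k)) ->
  (forall e : 'I_n -> V, \sum_k h k [tuple of map e (J k)] = 0) ->
  forall N (i : N.-tuple 'I_n) (w : 'I_N -> V),
    \sum_k \sum_(L : (q k).-tuple 'I_N | listing L && (map (tnth i) L == J k))
      h k [tuple of map w L] = 0.
Proof.
move=> hM H N i w.
pose P : {mpoly K[N]} := \sum_k \sum_(L : (q k).-tuple 'I_N | map (tnth i) L == J k)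
  h k [tuple of map w L] *: \prod_a 'X_(tnth L a).
have P0 : P = 0.
  apply: eq_mpoly_fun => s; rewrite meval0 -(H (fun j => \sum_l (s l *+ (tnth i l == j)) *: w l)).
  rewrite (raddf_sum (meval s)); apply: eq_bigr => k _.
  rewrite map_tnth (multilinear_expand (fun a l => s l *+ (tnth i l == tnth (J k) a))) //.
  rewrite (raddf_sum (meval s)) big_mkcond; apply: eq_bigr => L _.
  case: eqP => [E|NE].
    rewrite /= mevalZ rmorph_prod mulrC; congr (_ * _); apply: eq_bigr => a _.
    have Et : [tuple of map (tnth i) L] = J k by apply: val_inj.
    by rewrite /= mevalXU -Et tnth_map eqxx.
  have [a na] : exists a, tnth i (tnth L a) != tnth (J k) a.
    apply/existsP; rewrite -negb_forall; apply/negP => /forallP Ea; apply: NE.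
    have -> : map (tnth i) L = [tuple of map (tnth i) L] by [].
    by congr tval; apply: eq_from_tnth => a; rewrite tnth_map (eqP (Ea a)).
  by rewrite (bigD1 a) //= (negPf na) mulr0n !mul0r.
(* The exponent of s_l in the monomial of [L] is the number of occurrences of l in [L], so this
   coefficient selects the listings. *)
pose m1 : 'X_{1.. N} := [multinom 1%N | _ < N].
have: P@_m1 = 0 by rewrite P0 mcoeff0.
rewrite (raddf_sum (mcoeff m1)) => E; rewrite -[RHS]E; apply: eq_bigr => k _.
rewrite (raddf_sum (mcoeff m1)) big_mkcondl [RHS]big_mkcond [LHS]big_mkcond.
apply: eq_bigr => L _; case: ifP => // _.
have -> : \prod_a 'X_(tnth L a) = 'X_[\sum_a U_(tnth L a)] :> {mpoly K[N]}.
  by rewrite (big_morph (fun m => 'X_[m] : {mpoly K[N]}) (@mpolyXD _ _) (@mpolyX0 _ _)).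
rewrite /= mcoeffZ mcoeffX.
suff -> : listing L = ((\sum_a U_(tnth L a))%MM == m1) by case: eqP; rewrite ?mulr1 ?mulr0.
have cE l : (\sum_a U_(tnth L a))%MM l = count_mem l L.
  rewrite mnm_sumE -sum1_count big_tuple [RHS]big_mkcond; apply: eq_bigr => a _.
  by rewrite mnm1E /=; case: eqP.
apply/forallP/eqP => [Hl|Hm l].
  by apply/mnmP => l; rewrite cE mnmE; apply/eqP.
by rewrite -cE Hm mnmE.
Qed.

End Polarization.

(** * Tensors satisfying the same relations are isomorphic *)

Definition tens_rel (K : fieldType) (W W' : vectType K) : Type :=
  forall p q, tens W p q -> tens W' p q -> Prop.

(** By linearity and [compat_eq0], [S] is in each type the graph of a linear bijection between two
    spaces of tensors. A relation rather than a map makes the notion symmetric in the two sides. *)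
Record compatible (K : fieldType) (W W' : vectType K) (S : tens_rel W W') : Prop := {
  compat0 : forall p q, S p q 0 0;
  compat_lin : forall p q a (x y : tens W p q) (x' y' : tens W' p q),
    S p q x x' -> S p q y y' -> S p q (a *: x + y) (a *: x' + y');
  compat_mul : forall p q r s (x : tens W p q) (y : tens W r s) x' y',
    S p q x x' -> S r s y y' -> S (p + r)%N (q + s)%N (tens_mul x y) (tens_mul x' y');
  compat_reindex : forall p q p' q' (s : 'I_p -> 'I_p') (t : 'I_q -> 'I_q') x x',
    bijective s -> bijective t ->
    S p q x x' -> S p' q' (tens_reindex s t x) (tens_reindex s t x');
  compat_id : S 1%N 1%N (tens_id W) (tens_id W');
  compat1 : S 0%N 0%N (1 : K) (1 : K);
  compat_eq0 : forall p q x x', S p q x x' -> (x = 0 <-> x' = 0) }.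

Lemma compatible_sym (K : fieldType) (W W' : vectType K) (S : tens_rel W W') :
  compatible S -> compatible (fun p q x' x => S p q x x').
Proof.
case=> S0 Slin Smul Sre Sid S1 Seq; split=> // *; [exact: Slin | exact: Smul | exact: Sre |].
by apply: iff_sym; apply: Seq.
Qed.

Section Terms.
Variables (K : closedFieldType) (W W' : vectType K) (S : tens_rel W W') (n : nat).

(** A tensor of [S] and its partner, with slots filled by members of a frame of n covectors and n
    vectors, repetitions allowed. Finite sums of terms of varying types give the polynomials of the
    domain D. *)
Record term := Term {
  tp : nat; tq : nat; tx : tens W tp tq; tx' : tens W' tp tq; tS : S tx tx';
  tI : tp.-tuple 'I_n; tJ : tq.-tuple 'I_n }.

Definition val1 (t : term) (f : 'I_n -> dual W) (e : 'I_n -> W) : K :=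
  ev (tx t) [tuple of map f (tI t)] [tuple of map e (tJ t)].
Definition val2 (t : term) (f : 'I_n -> dual W') (e : 'I_n -> W') : K :=
  ev (tx' t) [tuple of map f (tI t)] [tuple of map e (tJ t)].

Hypothesis cS : compatible S.

Lemma compat_sum I (r : seq I) (P : pred I) p q (F : I -> tens W p q) F' :
  (forall i, P i -> S (F i) (F' i)) ->
  S (\sum_(i <- r | P i) F i) (\sum_(i <- r | P i) F' i).
Proof.
move=> SF; apply: (big_ind2 (@S p q)) => //; first exact: compat0 cS p q.
move=> x x' y y' Sx Sy; have := compat_lin cS 1 Sx Sy.
by rewrite !scale1r.
Qed.

Lemma pull_map (T : Type) m N (w : N.-tuple T) (L : m.-tuple 'I_N) :
  pull (tnth L) w = [tuple of map (tnth w) L].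
Proof. by apply: eq_from_tnth => a; rewrite tnth_mktuple tnth_map. Qed.

(** For each listing [L] exactly one [i] satisfies i o L = J, namely J composed with the inverse of
    [L]. *)
Lemma sum_listings q (J : q.-tuple 'I_n) N :
  \sum_(i : N.-tuple 'I_n)
    \sum_(L : q.-tuple 'I_N | listing L && (map (tnth i) L == J)) (1 : K) =
  (listings q N)%:R.
Proof.
rewrite (exchange_big_dep (@listing q N)) /=; last by move=> i L _ /andP[].
rewrite /listings -sum1_card natr_sum; apply: eq_bigr => L lL.
have [s sL Ls] := listing_bij lL.
rewrite (bigD1 [tuple tnth J (s l) | l < N]) /=; last first.
  rewrite lL /=; apply/eqP; have -> : tval J = [tuple of map (tnth [tuple tnth J (s l) | l < N]) L].
    congr tval; apply: eq_from_tnth => a.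
    by rewrite tnth_map tnth_mktuple sL.
  by [].
rewrite big1 ?addr0 // => i /andP[/andP[_ /eqP E] /eqP[]].
apply: eq_from_tnth => l; rewrite tnth_mktuple.
have -> : J = [tuple of map (tnth i) L] by apply: val_inj.
by rewrite tnth_map Ls.
Qed.

(** Polarizing the vanishing sum in the vectors and then in the covectors gives relations between
    tensors of a single type, and these pass through [S]. On the other side they are evaluated at
    the frame and summed over all index tuples, which returns every term of that type with the same
    nonzero multiplicity. *)
Lemma polarized_vanishing (ts : seq term) :
  (forall f e, \sum_(t <- ts) val1 t f e = 0) ->
  [pchar K] =i pred0 ->
  forall f e, \sum_(t <- ts) val2 t f e = 0.
Proof.
move=> H char0 f' e'.
pose t k := tnth (in_tuple ts) k.
pose p k := tp (t k); pose q k := tq (t k).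
have H1 f e : \sum_k val1 (t k) f e = 0 by rewrite -[RHS](H f e) [RHS]big_tnth.
rewrite big_tnth.
(* The multilinear component of multidegree (i', i): the terms of type (N', N) whose index tuples
   rearrange [i'] and [i], each with its slots reordered in all the matching ways. *)
pose Z (V : vectType K) (x : forall k, tens V (p k) (q k)) N N'
    (i : N.-tuple 'I_n) (i' : N'.-tuple 'I_n) : tens V N' N :=
  \sum_k \sum_(L : (q k).-tuple 'I_N | listing L && (map (tnth i) L == tJ (t k)))
    \sum_(L' : (p k).-tuple 'I_N' | listing L' && (map (tnth i') L' == tI (t k)))
       tens_reindex (tnth L') (tnth L) (x k).
have ZE V x N N' i i' phi w : ev (Z V x N N' i i') phi w =
    \sum_k \sum_(L : (q k).-tuple 'I_N | listing L && (map (tnth i) L == tJ (t k)))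
    \sum_(L' : (p k).-tuple 'I_N' | listing L' && (map (tnth i') L' == tI (t k)))
       ev (x k) [tuple of map (tnth phi) L'] [tuple of map (tnth w) L].
  rewrite ev_sum; apply: eq_bigr => k _; rewrite ev_sum; apply: eq_bigr => L /andP[lL _].
  rewrite ev_sum; apply: eq_bigr => L' /andP[lL' _].
  by rewrite tens_reindexE ?pull_map //; apply: listing_bij.
have Z0 N N' i i' : Z W (fun k => tx (t k)) N N' i i' = 0.
  apply: eq_tens => phi w; rewrite ZE ev0.
  have P1 (f : 'I_n -> dual W) :
    \sum_k \sum_(L : (q k).-tuple 'I_N | listing L && (map (tnth i) L == tJ (t k)))
      ev (tx (t k)) [tuple of map f (tI (t k))] [tuple of map (tnth w) L] = 0.
    apply: (polarize (h := fun k => ev (tx (t k)) [tuple of map f (tI (t k))])) => [k|e].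
      exact: ev_multiR.
    exact: H1.
  pose h k (phi : (p k).-tuple (dual W)) :=
    \sum_(L : (q k).-tuple 'I_N | listing L && (map (tnth i) L == tJ (t k)))
      ev (tx (t k)) phi [tuple of map (tnth w) L].
  have hM k : multilinear (h k) by apply: multilinear_sum => L; apply: ev_multiL.
  have := polarize hM P1 i' (tnth phi) => E; rewrite -[RHS]E.
  by apply: eq_bigr => k _; rewrite exchange_big.
have Z0' N N' i i' : Z W' (fun k => tx' (t k)) N N' i i' = 0.
  suff SZ : S (Z W (fun k => tx (t k)) N N' i i') (Z W' (fun k => tx' (t k)) N N' i i').
    by apply/(compat_eq0 cS SZ); apply: Z0.
  apply: compat_sum => k _; apply: compat_sum => L /andP[lL _].
  apply: compat_sum => L' /andP[lL' _]; apply: (compat_reindex cS); try exact: listing_bij.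
  exact: tS.
(* Putting the frame members named by [i] and [i'] back into the slots recovers the value of the
   original term, once for each pair of listings. *)
have C N N' : \sum_k (listings (q k) N)%:R * (listings (p k) N')%:R * val2 (t k) f' e' = 0.
  have : \sum_(i : N.-tuple 'I_n) \sum_(i' : N'.-tuple 'I_n)
      ev (Z W' (fun k => tx' (t k)) N N' i i') [tuple of map f' i'] [tuple of map e' i] = 0.
    by rewrite big1 // => i _; rewrite big1 // => i' _; rewrite Z0' ev0.
  move=> E; rewrite -[RHS]E; under [RHS]eq_bigr do under eq_bigr do rewrite ZE.
  under [RHS]eq_bigr do rewrite exchange_big.
  rewrite exchange_big; apply: eq_bigr => k _.
  rewrite -(sum_listings (tJ (t k)) N).
  rewrite -(sum_listings (tI (t k)) N').
  rewrite !mulr_suml; apply: eq_bigr => i _.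
  rewrite mulr_sumr mulr_suml; apply: eq_bigr => i' _.
  rewrite mulr_suml mulr_suml; apply: eq_bigr => L /andP[_ /eqP EL].
  rewrite mul1r mulr_suml; apply: eq_bigr => L' /andP[_ /eqP EL'].
  rewrite mul1r /val2; congr ev; apply: val_inj; rewrite /= -?EL -?EL' -map_comp.
    by apply: eq_map => a /=; rewrite tnth_map.
  by apply: eq_map => a /=; rewrite tnth_map.
(* Terms of another type have no listings, and the common factor of the remaining ones is nonzero in
   characteristic zero. *)
have D N N' : \sum_(k | (q k == N) && (p k == N')) val2 (t k) f' e' = 0.
  have := C N N'; rewrite (bigID (fun k => (q k == N) && (p k == N'))) /=.
  rewrite [X in _ + X]big1 ?addr0 => [|k]; last first.
    by rewrite negb_and => /orP[] ne; rewrite (listings_neq ne) !(mulr0, mul0r).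
  rewrite (eq_bigr (fun k => ((listings N N)%:R * (listings N' N')%:R) *
    val2 (t k) f' e')); last first.
    by move=> k /andP[/eqP-> /eqP->].
  rewrite -mulr_sumr => /eqP; rewrite !mulf_eq0 !((pcharf0P K).1 char0).
  by rewrite !(gtn_eqF (listings_gt0 _)) => /eqP.
pose M := \max_k (maxn (q k) (p k)).
have qM k : (q k < M.+1)%N by rewrite ltnS (leq_trans (leq_maxl _ (p k))) // (leq_bigmax k).
have pM k : (p k < M.+1)%N by rewrite ltnS (leq_trans (leq_maxr (q k) _)) // (leq_bigmax k).
rewrite (partition_big (fun k => (Ordinal (qM k), Ordinal (pM k))) xpredT) //=.
rewrite big1 // => -[N N'] _; rewrite -[RHS](D N N'); apply: eq_bigl => k.
by rewrite xpair_eqE.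
Qed.

End Terms.

(** * Frames of covectors and vectors with generic coordinates *)

Section Frames.
Variables (K : closedFieldType) (V : vectType K) (n : nat).
Let m := dimW V.
(** The first block holds the coordinates of n covectors, the second those of n vectors, with
    respect to [cobase] and [base]. *)
Definition nvars := (n * m + n * m)%N.
Implicit Types v : 'I_nvars -> K.

Definition covec_of v (i : 'I_n) : dual V :=
  \sum_a v (lshift _ (mxvec_index i a)) *: cobase a.
Definition vec_of v (i : 'I_n) : V :=
  \sum_a v (rshift _ (mxvec_index i a)) *: base a.

Lemma frames_of f e : exists v, covec_of v =1 f /\ vec_of v =1 e.
Proof.
pose A := \matrix_(i < n, a < m) (f i : 'Hom(V, K^o)) (base a) : 'M[K]_(n, m).
pose B := \matrix_(i < n, a < m) (cobase a : 'Hom(V, K^o)) (e i) : 'M[K]_(n, m).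
exists (fun k => row_mx (mxvec A) (mxvec B) 0 k); split=> i.
  rewrite [RHS]cobase_expansion; apply: eq_bigr => a _.
  by rewrite row_mxEl mxvecE mxE.
rewrite [RHS]base_expansion; apply: eq_bigr => a _.
by rewrite row_mxEr mxvecE mxE.
Qed.

Lemma ev_comb p q I (r : seq I) c (F : I -> tens V p q) phi w :
  ev (\sum_(a <- r) c a *: F a) phi w = \sum_(a <- r) c a * ev (F a) phi w.
Proof. by rewrite ev_sum; apply: eq_bigr => a _; rewrite evZ. Qed.

Lemma ev_poly p q (x : tens V p q) (I : p.-tuple 'I_n) (J : q.-tuple 'I_n) :
  exists P : {mpoly K[nvars]}, forall v,
    P.@[v] = ev x [tuple of map (covec_of v) I] [tuple of map (vec_of v) J].
Proof.
elim: p x I => [|p IH] x I.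
  elim: q x J => [|q IH] x J; first by exists (x : K)%:MP => v; rewrite mevalC.
  have [P PE] := choice (fun a => IH ((x : 'Hom(V, cotens V q)) (base a)) [tuple of behead J]).
  exists (\sum_a 'X_(rshift _ (mxvec_index (thead J) a)) * P a) => v.
  rewrite (tuple_eta J) (_ : [tuple of map _ _] =
    [tuple of vec_of v (thead J) :: [tuple of map (vec_of v) [tuple of behead J]]]);
    last exact: val_inj.
  rewrite [RHS]/= theadE.
  transitivity (\sum_a v (rshift _ (mxvec_index (thead J) a)) *
     ev (p := 0) ((x : 'Hom(V, cotens V q)) (base a) : tens V 0 q)
       [tuple of map (covec_of v) I] [tuple of map (vec_of v) [tuple of behead J]]).
    rewrite linear_sum; apply: eq_bigr => a _.
    by rewrite /= mevalM mevalXU PE.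
  rewrite -ev_comb /=; congr coev; last exact: val_inj.
  by rewrite linear_sum; apply: eq_bigr => a _; rewrite linearZ.
have [P PE] := choice (fun a => IH ((x : 'Hom(dual V, tens V p q)) (cobase a)) [tuple of behead I]).
exists (\sum_a 'X_(lshift _ (mxvec_index (thead I) a)) * P a) => v.
rewrite (tuple_eta I) (_ : [tuple of map (covec_of v) _] =
  [tuple of covec_of v (thead I) :: [tuple of map (covec_of v) [tuple of behead I]]]);
  last exact: val_inj.
rewrite [RHS]/= theadE.
transitivity (\sum_a v (lshift _ (mxvec_index (thead I) a)) *
   ev ((x : 'Hom(dual V, tens V p q)) (cobase a))
     [tuple of map (covec_of v) [tuple of behead I]] [tuple of map (vec_of v) J]).
  rewrite linear_sum; apply: eq_bigr => a _.
  by rewrite /= mevalM mevalXU PE.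
rewrite -ev_comb; congr ev; last exact: val_inj.
by rewrite linear_sum; apply: eq_bigr => a _; rewrite linearZ.
Qed.

(** Applying the f_i to a relation between the e_j shows that its coefficients are annihilated by
    the invertible Gram matrix, so the e_j are free and, by dimension, a basis. A covector is
    determined by its values on this basis, and multiplying these by the inverse matrix gives its
    coordinates in the f_i. *)
Lemma gram_spans (f : 'I_n -> dual V) (e : 'I_n -> V) :
  n = m -> \matrix_(i, j) (f i : 'Hom(V, K^o)) (e j) \in unitmx ->
  (forall w, exists c, w = \sum_i c i *: e i) /\
  (forall phi : dual V, exists c, phi = \sum_i c i *: f i).
Proof.
set M := \matrix_(i, j) _ => nm Mu.
have fe (c : 'I_n -> K) i : (f i : 'Hom(V, K^o)) (\sum_j c j *: e j) = \sum_j M i j * c j.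
  rewrite linear_sum; apply: eq_bigr => j _; rewrite linearZ mxE; exact: mulrC.
have freeE : free [tuple e i | i < n].
  apply/freeP => c c0 i.
  have Mc : M *m \col_j c j = 0.
    have c0' : \sum_j c j *: e j = 0.
      rewrite -[RHS]c0; apply: eq_bigr => j _.
      by rewrite -tnth_nth tnth_mktuple.
    apply/colP => k; rewrite !mxE; have := fe c k; rewrite c0' linear0 => E.
    by rewrite [RHS]E; apply: eq_bigr => j _; rewrite [X in _ * X]mxE.
  have : \col_j c j = 0 by rewrite -[LHS](mulKmx Mu) Mc mulmx0.
  by move/colP/(_ i); rewrite !mxE.
have basisE : basis_of (fullv : {vspace V}) [tuple e i | i < n].
  by rewrite basisEfree freeE subvf size_tuple /= nm leqnn.
have spanE w : exists c, w = \sum_i c i *: e i.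
  exists (fun i => coord [tuple e i | i < n] i w).
  rewrite {1}(coord_basis basisE (memvf w)); apply: eq_bigr => i _.
  by rewrite -tnth_nth tnth_mktuple.
split=> // phi.
pose c := (\row_j (phi : 'Hom(V, K^o)) (e j)) *m invmx M.
exists (fun i => c 0 i); apply/lfunP => w; have [d ->] := spanE w.
rewrite !linear_sum; apply: eq_bigr => j _; rewrite !linearZ; congr (_ *: _).
rewrite /= sum_lfunE; transitivity ((c *m M) 0 j); first by rewrite mulmxKV // mxE.
rewrite mxE; apply: eq_bigr => i _; rewrite scale_lfunE [M _ _]mxE.
done.
Qed.

End Frames.

Lemma thead_map1 (A B : Type) (f : A -> B) a : thead [tuple of map f [tuple a]] = f a.
Proof. by rewrite /thead tnth_map -[tnth _ _]/(thead _) theadE. Qed.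

(** * The ring of values of tensors and its homomorphism to the base field *)

Section TermOperations.
Variables (K : closedFieldType) (W W' : vectType K) (S : tens_rel W W') (n : nat).
Hypothesis cS : compatible S.
Local Notation term := (term S n).

Definition one_term : term := Term (compat1 cS) [tuple] [tuple].
Definition scale_term c (t : term) : term :=
  Term (compat_lin cS c (tS t) (compat0 cS _ _)) (tI t) (tJ t).
Definition mul_term (t u : term) : term :=
  Term (compat_mul cS (tS t) (tS u)) [tuple of tI t ++ tI u] [tuple of tJ t ++ tJ u].

Lemma pull_cat_l (A T : Type) (f : A -> T) m m' (I : m.-tuple A) (I' : m'.-tuple A) :
  pull (@lshift m m') [tuple of map f [tuple of I ++ I']] = [tuple of map f I].
Proof.
by apply: eq_from_tnth => i; rewrite tnth_mktuple !tnth_map tnth_lshift.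
Qed.

Lemma pull_cat_r (A T : Type) (f : A -> T) m m' (I : m.-tuple A) (I' : m'.-tuple A) :
  pull (@rshift m m') [tuple of map f [tuple of I ++ I']] = [tuple of map f I'].
Proof.
by apply: eq_from_tnth => i; rewrite tnth_mktuple !tnth_map tnth_rshift.
Qed.

Lemma val1_scale c t f e : val1 (scale_term c t) f e = c * val1 t f e.
Proof. by rewrite /val1 /= addr0 evZ. Qed.

Lemma val2_scale c t f e : val2 (scale_term c t) f e = c * val2 t f e.
Proof. by rewrite /val2 /= addr0 evZ. Qed.

Lemma val1_mul t u f e : val1 (mul_term t u) f e = val1 t f e * val1 u f e.
Proof. by rewrite /val1 tens_mulE !pull_cat_l !pull_cat_r. Qed.

Lemma val2_mul t u f e : val2 (mul_term t u) f e = val2 t f e * val2 u f e.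
Proof. by rewrite /val2 tens_mulE !pull_cat_l !pull_cat_r. Qed.

Lemma big_mul_terms (v : term -> K) ts us :
  (forall t u, v (mul_term t u) = v t * v u) ->
  \sum_(t <- [seq mul_term t u | t <- ts, u <- us]) v t =
  (\sum_(t <- ts) v t) * (\sum_(t <- us) v t).
Proof.
move=> vM; rewrite big_allpairs_dep mulr_suml; apply: eq_bigr => t _.
by rewrite mulr_sumr; apply: eq_bigr => u _.
Qed.

Lemma big_sub_terms (v : term -> K) ts us :
  (forall c t, v (scale_term c t) = c * v t) ->
  \sum_(t <- ts ++ map (scale_term (-1)) us) v t =
  \sum_(t <- ts) v t - \sum_(t <- us) v t.
Proof.
move=> vZ; rewrite big_cat big_map /= -sumrN; congr (_ + _).
by apply: eq_bigr => t _; rewrite vZ mulN1r.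
Qed.

Local Notation B := {mpoly K[nvars W n]}.

Definition represents (P : B) (ts : seq term) : Prop :=
  forall v, P.@[v] = \sum_(t <- ts) val1 t (covec_of v) (vec_of v).

Lemma represents1 : represents 1 [:: one_term].
Proof. by move=> v; rewrite big_seq1 rmorph1. Qed.

Lemma represents_sub P Q ts us : represents P ts -> represents Q us ->
  represents (P - Q) (ts ++ map (scale_term (-1)) us).
Proof.
move=> rP rQ v; rewrite mevalB rP rQ big_sub_terms // => c t; exact: val1_scale.
Qed.

Lemma represents_mul P Q ts us : represents P ts -> represents Q us ->
  represents (P * Q) [seq mul_term t u | t <- ts, u <- us].
Proof.
move=> rP rQ v; rewrite mevalM rP rQ big_mul_terms // => t u; exact: val1_mul.
Qed.

Lemma representsC c : represents c%:MP [:: scale_term c one_term].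
Proof. by move=> v; rewrite big_seq1 mevalC val1_scale mulr1. Qed.

Section Homomorphism.
Hypothesis char0 : [pchar K] =i pred0.
Variables (f' : 'I_n -> dual W') (e' : 'I_n -> W').

(** The domain D of the overview; its constants come from terms of type (0, 0). *)
Definition carried (P : B) : Prop := exists ts, represents P ts.

Definition transfer (z : B * K) : Prop :=
  exists2 ts, represents z.1 ts & z.2 = \sum_(t <- ts) val2 t f' e'.

Lemma carried_subring : is_subring carried.
Proof.
split=> [|P Q [ts rP] [us rQ]|P Q [ts rP] [us rQ]].
- by exists [:: one_term]; apply: represents1.
- by exists (ts ++ map (scale_term (-1)) us); apply: represents_sub.
- by exists [seq mul_term t u | t <- ts, u <- us]; apply: represents_mul.
Qed.

Lemma transfer_subring : is_subring transfer.
Proof.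
split=> [|[P y] [Q z] [ts rP /= ->] [us rQ /= ->]|[P y] [Q z] [ts rP /= ->] [us rQ /= ->]].
- by exists [:: one_term]; [apply: represents1 | rewrite big_seq1].
- exists (ts ++ map (scale_term (-1)) us); first exact: represents_sub.
  by rewrite big_sub_terms // => c t; apply: val2_scale.
- exists [seq mul_term t u | t <- ts, u <- us]; first exact: represents_mul.
  by rewrite big_mul_terms // => t u; apply: val2_mul.
Qed.

(** Every frame is given by some point [v], so a representation of the zero polynomial is a sum of
    terms vanishing at all frames, and polarization applies. *)
Lemma transfer_functional : functional transfer.
Proof.
move=> y [ts rP /= ->]; apply: (polarized_vanishing cS) => // f e.
have [v [fE eE]] := frames_of f e.
rewrite -[RHS](meval0 v) rP; apply: eq_bigr => t _.
rewrite /val1; congr (ev _ _ _); apply: eq_from_tnth => i; rewrite !tnth_map //; exact: esym.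
Qed.

End Homomorphism.
End TermOperations.

(** The pairings f_i(e_j) are values of the identity tensor, hence polynomials; at a pair of dual
    bases the determinant is 1. *)
Lemma det_gram_poly (K : closedFieldType) (V : vectType K) n : n = dimW V ->
  exists P : {mpoly K[nvars V n]}, P != 0 /\ forall v, P.@[v] =
    \det (\matrix_(i < n, j < n) (covec_of v i : 'Hom(V, K^o)) (vec_of v j)).
Proof.
move=> nE.
have [P PE] := choice (fun z : 'I_n * 'I_n => ev_poly (tens_id V) [tuple z.1] [tuple z.2]).
have E v : (\det (\matrix_(i < n, j < n) P (i, j))).@[v] =
    \det (\matrix_(i < n, j < n) (covec_of v i : 'Hom(V, K^o)) (vec_of v j)).
  rewrite -det_map_mx; congr (\det _); apply/matrixP => i j.
  by rewrite !mxE /= PE tens_idE !thead_map1.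
exists (\det (\matrix_(i < n, j < n) P (i, j))); split=> //.
have [v [fE eE]] := frames_of (fun i => cobase (cast_ord nE i)) (fun i => base (cast_ord nE i)).
apply/eqP => P0; have := E v; rewrite P0 meval0.
rewrite (_ : \matrix_(i, j) _ = 1%:M) ?det1 => [/esym/eqP|]; first by rewrite oner_eq0.
by apply/matrixP => i j; rewrite !mxE fE eE cobase_base (inj_eq (@cast_ord_inj _ _ _)).
Qed.

(** Realizing the homomorphism attached to a frame (f', e') of W' by a point gives a frame (f, e) of
    W at which each tensor takes the value of its partner at (f', e'). The identity tensors being
    partners, the two Gram matrices agree, so both frames consist of bases, and e_j -> e'_j is the
    isomorphism. *)
Theorem compatible_iso (K : closedFieldType) (W W' : vectType K) (S : tens_rel W W') :
  [pchar K] =i pred0 -> compatible S -> dimW W = dimW W' ->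
  exists (psi : 'Hom(W, W')) (psi' : 'Hom(W', W)),
    [/\ cancel psi psi', cancel psi' psi
      & forall p q (x : tens W p q) x', S p q x x' -> tens_push psi psi' x = x'].
Proof.
move=> char0 cS nE; pose n := dimW W.
(* The point sought has nothing to avoid, so b = 1: the invertibility of its Gram matrix will be
   inherited from the other side. *)
have [|a [[ts ra] na H]] := extend_to_point (carried_subring n cS) _ (oner_neq0 _).
  by move=> c; exists [:: scale_term cS c (one_term n cS)]; apply: representsC.
(* If the image of [a] vanished at all frames, polarization for the inverse relation would give a =
   0. *)
have [f1 [e1 nz]] : exists (f : 'I_n -> dual W') (e : 'I_n -> W'), \sum_(t <- ts) val2 t f e != 0.
  apply/not_existsP => H0; case/negP: na; apply/eqP/eq_mpoly_fun => v; rewrite ra meval0.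
  pose flip (t : term S n) : term (fun p q x' x => S p q x x') n :=
    @Term _ _ _ (fun p q x' x => S p q x x') _ _ _ _ _ (tS t) (tI t) (tJ t).
  have := polarized_vanishing (compatible_sym cS) (ts := map flip ts) _ char0.
  move=> /(_ _ (covec_of v) (vec_of v)); rewrite big_map; apply=> f e.
  rewrite big_map; apply/eqP/negPn/negP => nz; apply: (H0 f); by exists e.
have [Q [nQ QE]] := det_gram_poly nE.
have [P PE] := choice (fun t : term S n => ev_poly (tx' t) (tI t) (tJ t)).
have nP : \sum_(t <- ts) P t != 0.
  have [v [fE eE]] := frames_of f1 e1.
  apply: contraNneq nz => P0; apply/eqP; rewrite -[RHS](meval0 v) -P0 linear_sum.
  apply: eq_bigr => t _; rewrite /= PE /val2; congr (ev _ _ _);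
    apply: eq_from_tnth => i; rewrite !tnth_map //; exact: esym.
have [v' ] := mpoly_nonroot (mulf_neq0 nQ nP).
rewrite mevalM mulf_eq0 negb_or QE => /andP[nd nS].
pose f' := covec_of v'; pose e' := vec_of v'.
have [||||y|v0 _ v0E] := H (transfer S f' e').
- exact: transfer_subring.
- exact: transfer_functional.
- move=> c; exists [:: scale_term cS c (one_term n cS)]; first exact: representsC.
  by rewrite big_seq1 val2_scale mulr1.
- move=> x; split=> [[us rx]|[y [us rx _]]]; last by exists us.
  by exists (\sum_(t <- us) val2 t f' e'); exists us.
(* The representation [us] of [a] is arbitrary; functionality of [transfer] reduces it to [ts], for
   which the frame was chosen. *)
- move=> [us ru /= ->].
  have Ets : transfer S f' e' (a, \sum_(t <- ts) val2 t f' e') by exists ts.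
  have Eus : transfer S f' e' (a, \sum_(t <- us) val2 t f' e') by exists us.
  have -> : \sum_(t <- us) val2 t f' e' = \sum_(t <- ts) val2 t f' e'.
    apply/eqP; rewrite -subr_eq0; apply/eqP.
    apply: (transfer_functional cS char0 (f' := f') (e' := e')).
    rewrite -[X in (X, _)](subrr a); case: (transfer_subring cS f' e') => _ + _.
    by move/(_ _ _ Eus Ets).
  apply: contraNneq nS => E0; apply/eqP; rewrite -[RHS]E0 linear_sum.
  by apply: eq_bigr => t _; rewrite /= PE.
pose f := covec_of v0; pose e := vec_of v0.
have key p q (x : tens W p q) x' (I : p.-tuple 'I_n) (J : q.-tuple 'I_n) : S p q x x' ->
    ev x [tuple of map f I] [tuple of map e J] = ev x' [tuple of map f' I] [tuple of map e' J].
  move=> Sx; have [R RE] := ev_poly x I J.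
  rewrite -RE; apply/esym/v0E; exists [:: Term Sx I J]; rewrite ?big_seq1 //.
  by move=> v; rewrite big_seq1 RE.
pose M := \matrix_(i < n, j < n) (f' i : 'Hom(W', K^o)) (e' j).
have Mf : M = \matrix_(i < n, j < n) (f i : 'Hom(W, K^o)) (e j).
  apply/matrixP => i j; rewrite !mxE.
  have := key _ _ _ _ [tuple i] [tuple j] (compat_id cS); rewrite !tens_idE.
  by rewrite !thead_map1 => <-.
have Mu : M \in unitmx by rewrite unitmxE unitfE.
have [eS' fS'] := gram_spans nE Mu.
have Mu1 : \matrix_(i < n, j < n) (f i : 'Hom(W, K^o)) (e j) \in unitmx by rewrite -Mf.
have [eS fS] := gram_spans (erefl n) Mu1.
(* If g_i(b_j) = M_ij, the inverse of [M] applied to g gives the basis dual to b, so this map sends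
   b_k to d_k. *)
pose mk (U V : vectType K) (g : 'I_n -> dual U) (d : 'I_n -> V) : 'Hom(U, V) :=
  linfun (fun w => \sum_i (\sum_j invmx M i j * (g j : 'Hom(U, K^o)) w) *: d i).
have mkE (U V : vectType K) (g : 'I_n -> dual U) (d : 'I_n -> V) (b : 'I_n -> U) :
    (forall i j, (g i : 'Hom(U, K^o)) (b j) = M i j) -> forall k, mk U V g d (b k) = d k.
  move=> gb k; rewrite linfun_lin => [|c u v].
    rewrite (bigD1 k) //= [X in _ + X]big1 ?addr0 => [|i ne].
      have -> : \sum_j invmx M k j * (g j : 'Hom(U, K^o)) (b k) = (invmx M *m M) k k.
        by rewrite [RHS]mxE; apply: eq_bigr => j _; rewrite gb.
      by rewrite mulVmx // mxE eqxx scale1r.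
    have -> : \sum_j invmx M i j * (g j : 'Hom(U, K^o)) (b k) = (invmx M *m M) i k.
      by rewrite [RHS]mxE; apply: eq_bigr => j _; rewrite gb.
    by rewrite mulVmx // mxE (negPf ne) scale0r.
  rewrite scaler_sumr -big_split; apply: eq_bigr => i _ /=.
  rewrite scalerA -scalerDl; congr (_ *: _).
  rewrite mulr_sumr -big_split; apply: eq_bigr => j _ /=.
  rewrite linearP mulrDr mulrCA; congr (_ + _).
have fE i j : (f i : 'Hom(W, K^o)) (e j) = M i j by rewrite Mf mxE.
have fE' i j : (f' i : 'Hom(W', K^o)) (e' j) = M i j by rewrite mxE.
have psiE := mkE W W' f e' e fE; have psiE' := mkE W' W f' e e' fE'.
exists (mk W W' f e'), (mk W' W f' e).
split=> [w|w|p q x x' Sx].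
- have [c ->] := eS w; rewrite !linear_sum; apply: eq_bigr => i _.
  by rewrite !linearZ /= psiE psiE'.
- have [c ->] := eS' w; rewrite !linear_sum; apply: eq_bigr => i _.
  by rewrite !linearZ /= psiE' psiE.
apply: (eq_tens_on fS' eS') => I J; rewrite tens_pushE -(key _ _ _ _ I J Sx).
congr (ev _ _ _); apply: eq_from_tnth => i; rewrite tnth_mktuple !tnth_map //.
(* The covectors f'_i o psi and f_i agree on the basis e_j, both having the value M_ij. *)
apply/lfunP => w; have [c ->] := eS w; rewrite !linear_sum; apply: eq_bigr => j _.
by rewrite !linearZ; congr (_ *: _); rewrite /= comp_lfunE psiE [LHS]fE' [RHS]fE.
Qed.

(** * Automorphisms of the algebraically closed field *)

Section Automorphisms.
Variables (K : closedFieldType) (M : K -> Prop).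
Hypotheses (char0 : [pchar K] =i pred0) (sM : is_subring M).
Hypothesis MV : forall x, M x -> M x^-1.
Hypothesis algM : forall x, exists q, [/\ coefs_in M q, q != 0 & q.[x] = 0].

Local Notation pr1 := (map_poly (@fst K K)).
Local Notation pr2 := (map_poly (@snd K K)).

Definition diagonal (z : K * K) : Prop := M z.1 /\ z.2 = z.1.

Lemma diagonal_subring : is_subring diagonal.
Proof.
have [M1 MB MM] := sM.
split=> [|[x _] [y _] [/= Mx ->] [/= My ->]|[x _] [y _] [/= Mx ->] [/= My ->]] //.
- by split=> //; apply: MB.
- by split=> //; apply: MM.
Qed.

(** For nonzero x write an annihilating polynomial over M as q X + c. Its value at the pair (x, 0)
    is (0, c), so c = 0 and q(x) = 0; descending in the degree is absurd. Thus a homomorphism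
    extending the identity of M is injective. *)
Lemma graph_injective G x : is_subring G -> functional G ->
  (forall z, diagonal z -> G z) -> G (x, 0) -> x = 0.
Proof.
move=> sG fG GD Gx; apply/eqP/negPn/negP => nx.
have [q [Mq nq qx]] := algM x.
elim/poly_ind: q Mq nq qx => [|q c IH] Mq nq; first by rewrite eqxx in nq.
have [_ _ GM] := sG.
have Mq' : coefs_in M q.
  by move=> i; have := Mq i.+1; rewrite coefD coefMX coefC addr0.
have Mc : M c by have := Mq 0%N; rewrite coefD coefMX coefC add0r.
rewrite !hornerE => qx.
have Gq : G (q.[x], q.[0]).
  have -> : (q.[x], q.[0]) = (\poly_(i < size q) (q`_i, q`_i)).[(x, 0)] :> K * K.
    rewrite horner_pair; congr pair; congr (_.[_]); apply/polyP => i;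
      by rewrite coef_map coef_poly; case: ltnP => //= le; rewrite nth_default.
  suff [P GP ->] : adjoin G (x, 0) ((\poly_(i < size q) (q`_i, q`_i)).[(x, 0)]).
    rewrite horner_coef; apply: subring_sum => // i _.
    by apply: GM => //; apply: subringX.
  exists (\poly_(i < size q) (q`_i, q`_i)) => // i.
  rewrite coef_poly; case: ifP => _; last exact: subring0.
  by apply: GD; split=> //=; apply: Mq'.
have c0 : c = 0.
  apply: fG; have -> : (0, c) = (q.[x], q.[0]) * (x, 0) + (c, c) :> K * K.
    by congr pair; [exact: esym qx | rewrite /= mulr0 add0r].
  by apply: subringD => //; [apply: GM | apply: GD].
move: qx => /eqP; rewrite c0 addr0 mulf_eq0 (negPf nx) orbF => /eqP; apply: IH => //.
by apply: contraNneq nq => ->; rewrite mul0r add0r c0.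
Qed.

(* The roots r of the conjugated minimal polynomial are the possible images of t. *)
Lemma minpoly_over G t : is_subring G -> functional G ->
  (forall z, diagonal z -> G z) ->
  exists P, [/\ coefs_in G P, pr1 P != 0, (pr1 P).[t] = 0,
    (forall q, coefs_in (dom G) q -> q.[t] = 0 -> q != 0 ->
       (size (pr1 P) <= size q)%N)
    & forall r, (pr2 P).[r] = 0 -> functional (adjoin G (t, r))].
Proof.
move=> sG fG GD.
have [|p [Dp np pt] minp] := @minimal_element _
    (fun q => [/\ coefs_in (dom G) q, q != 0 & q.[t] = 0]) (fun q : {poly K} => size q).
  have [q [Mq nq qt]] := algM t; exists q; split=> // i.
  by exists q`_i; apply: GD; split=> //=; apply: Mq.
have [P GP EP] := lift_coefs sG Dp.
have minP q : coefs_in (dom G) q -> q.[t] = 0 -> q != 0 -> (size (pr1 P) <= size q)%N.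
  by rewrite EP => *; apply: minp.
exists P; rewrite EP; split=> // [q *|r Pr]; first exact: minp.
apply: (functional_algebraic sG fG GP) => //; rewrite EP //.
apply: contraNneq np => l0; rewrite -lead_coef_eq0.
have -> : lead_coef p = (P`_(size p).-1).1 by rewrite lead_coefE -{1}EP coef_map.
apply/eqP/(graph_injective sG fG GD); rewrite -[X in G (_, X)]l0.
by rewrite -surjective_pairing; apply: GP.
Qed.

Lemma closed_root (q : {poly K}) : size q != 1%N -> exists r, q.[r] = 0.
Proof. by move/closed_rootP => [r /rootP]; exists r. Qed.

Lemma extend_graph G t : is_subring G -> functional G ->
  (forall z, diagonal z -> G z) ->
  exists r, functional (adjoin G (t, r)).
Proof.
move=> sG fG GD; have [P [GP nP Pt _ H]] := minpoly_over t sG fG GD.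
(* Injectivity keeps the leading coefficient of the minimal polynomial nonzero, so its image is not
   constant. *)
have [r Pr] : exists r, (pr2 P).[r] = 0.
  apply: closed_root; rewrite neq_ltn; apply/orP; right.
  have szp : (1 < size (pr1 P))%N.
    rewrite ltnNge; apply/negP => le; have pC := size1_polyC le.
    by move: nP Pt; rewrite pC hornerC polyC_eq0 => /eqP.
  apply: (leq_trans szp); rewrite -(ltn_predK szp) ltnNge.
  apply/negP => /leq_sizeP/(_ _ (leqnn _)); rewrite coef_map /= => l0.
  have: (pr1 P)`_(size (pr1 P)).-1 = 0.
    apply: (graph_injective sG fG GD); rewrite coef_map /= -[X in G (_, X)]l0.
    by rewrite -surjective_pairing; apply: GP.
  by move/eqP; rewrite -lead_coefE lead_coef_eq0 (negPf nP).
by exists r; apply: H.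
Qed.

Lemma diagonal_functional : functional diagonal.
Proof. by move=> y [_ /= ->]. Qed.

(** The minimal polynomial p = (X - a) s of a over M has a second root. If a were a root of s, the
    derivative of p, nonzero and of smaller degree in characteristic zero, would vanish at a; if s
    is constant, a is up to sign a quotient of coefficients of p and lies in M. *)
Lemma move_graph a : ~ M a ->
  exists r, r != a /\ functional (adjoin diagonal (a, r)).
Proof.
move=> nMa.
have [P [GP nP Pa minP H]] := minpoly_over a diagonal_subring diagonal_functional (fun _ => id).
have E : pr2 P = pr1 P by apply/polyP => i; rewrite !coef_map /=; case: (GP i).
set p := pr1 P in nP Pa minP E.
have domM q : coefs_in M q -> coefs_in (dom diagonal) q.
  by move=> Mq i; exists q`_i; split=> //=; apply: Mq.
have Mp : coefs_in M p by move=> i; rewrite coef_map; case: (GP i).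
have [s ps] := factor_theorem p a (introT rootP Pa).
have ns : s != 0 by apply: contraNneq nP => s0; rewrite ps s0 mul0r.
have szps : size p = (size s).+1 by rewrite ps size_Mmonic ?monicXsubC // size_XsubC addn2.
have [[r sr]|none] := pselect (exists r, s.[r] = 0).
  exists r; split; last by apply: H; rewrite E ps hornerM sr mul0r.
  apply/eqP => ra; rewrite ra in sr.
  have dpa : (deriv p).[a] = 0.
    by rewrite ps derivM derivXsubC hornerD !hornerM hornerXsubC subrr sr mulr0 mul0r addr0.
  have Mdp : coefs_in M (deriv p).
    move=> i; rewrite coef_deriv -mulr_natr; have [M1 _ MM] := sM; apply: MM; first exact: Mp.
    by elim: i.+1 => [|k IHk]; [exact: subring0 sM | rewrite mulrS; apply: subringD].
  have ndp : deriv p != 0.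
    have s0 : (0 < size s)%N by rewrite lt0n size_poly_eq0.
    apply/eqP => /(congr1 (fun q : {poly K} => q`_(size s).-1)).
    rewrite coef0 coef_deriv prednK // -mulr_natr => /eqP.
    rewrite mulf_eq0 ((pcharf0P K).1 char0) (gtn_eqF s0) orbF.
    by rewrite -[size s]/((size s).+1.-1) -szps -lead_coefE lead_coef_eq0 (negPf nP).
  by have := minP _ (domM _ Mdp) dpa ndp; rewrite leqNgt lt_size_deriv.
case: nMa; have /size_poly1P[c nc sc] : size s == 1%N.
  by apply/negPn/negP => /closed_root.
have p1 : p`_1 = c by rewrite ps sc mulrBr coefB coefMX coefC mulrC -polyCM coefC subr0.
have p0 : p`_0 = - (c * a) by rewrite ps sc mulrBr coefB coefMX -polyCM sub0r coefC.
have -> : a = - (p`_0 * (p`_1)^-1) by rewrite p1 p0 mulNr opprK mulrC mulKf.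
have [_ _ MM] := sM; apply: subringN => //; apply: MM; first exact: Mp.
exact/MV/Mp.
Qed.

Definition good (G : K * K -> Prop) : Prop := is_subring G /\ functional G.

(** Zorn's lemma: since any graph extends to one more element, a maximal one has domain K. *)
Lemma maximal_graph (G0 : K * K -> Prop) : good G0 -> (forall z, diagonal z -> G0 z) ->
  exists G, [/\ good G, forall z, G0 z -> G z & forall t, dom G t].
Proof.
move=> gG0 dG0.
(* The base graph is adjoined to each set, so that the property also holds for the union of the
   empty chain. *)
pose P (X : set (K * K)) := good (X `|` G0)%classic.
have [F FP Ftot|X [PX maxX]] := @Zorn_bigcup _ P.
  have dir x y : (\bigcup_(X in F) X `|` G0)%classic x -> (\bigcup_(X in F) X `|` G0)%classic y ->
      exists Z : set (K * K), [/\ good Z, Z x, Z y & (Z `<=` \bigcup_(X in F) X `|` G0)%classic].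
    have sub X : F X -> (X `|` G0 `<=` \bigcup_(X in F) X `|` G0)%classic.
      by move=> FX z [Xz|]; [left; exists X | right].
    move=> [[X FX Xx]|Gx] [[Y FY Yy]|Gy].
    - have [XY|YX] := Ftot _ _ FX FY.
      + by exists (Y `|` G0)%classic; split; [exact: FP | left; apply: XY | left | apply: sub].
      + by exists (X `|` G0)%classic; split; [exact: FP | left | left; apply: YX | apply: sub].
    - by exists (X `|` G0)%classic; split; [exact: FP | left | right | apply: sub].
    - by exists (Y `|` G0)%classic; split; [exact: FP | right | left | apply: sub].
    - by exists G0; split=> // z Gz; right.
  split; last first.
    by move=> y Uy; have [Z [[_ fZ] Zy _ _]] := dir _ _ Uy Uy; apply: fZ.
  split=> [|x y Ux Uy|x y Ux Uy]; first by right; case: gG0 => -[].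
    by have [Z [[[_ ZB _] _] Zx Zy sub]] := dir _ _ Ux Uy; apply/sub/ZB.
  by have [Z [[[_ _ ZM] _] Zx Zy sub]] := dir _ _ Ux Uy; apply/sub/ZM.
set G := (X `|` G0)%classic in PX; have [sG fG] := PX.
exists G; split=> // [z Gz|t]; first by right.
have GD z : diagonal z -> G z by move=> /dG0; right.
have [r fG'] := extend_graph t sG fG GD.
have sub z : G z -> adjoin G (t, r) z by apply: adjoin_base.
have Gt : adjoin G (t, r) (t, r) by apply: adjoin_gen.
have E : (adjoin G (t, r) `|` G0)%classic = adjoin G (t, r).
  by apply/seteqP; split=> z; [case=> // Gz; apply: sub; right | left].
apply/not_existsP => nt; apply: (maxX (adjoin G (t, r))).
  split=> [z Xz|ss]; first by apply: sub; left.
  by apply: (nt r); left; apply: ss.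
by rewrite /P E; split=> //; apply: adjoin_subring.
Qed.

(** A total graph through (a, r) is an embedding of K over M that moves a. It is onto because it
    permutes the finitely many roots of each nonzero polynomial over M. *)
Lemma exists_automorphism a : ~ M a ->
  exists g : field_aut K, (forall x, M x -> g x = x) /\ g a != a.
Proof.
move=> nMa; have [r [nra fG0]] := move_graph nMa.
have [||G [[sG fG] G0G totG]] := @maximal_graph (adjoin diagonal (a, r)).
- by split=> //; apply: adjoin_subring diagonal_subring.
- by move=> z Dz; apply: adjoin_base => //; apply: diagonal_subring.
have [h Gh] := choice totG; have [G1 GB GM] := sG.
have uniqG x y : G (x, y) -> y = h x.
  move=> Gy; apply/eqP; rewrite -subr_eq0; apply/eqP/fG.
  by rewrite -[X in (X, _)](subrr x); apply: (GB (x, y) (x, h x)).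
have hB : {morph h : x y / x - y}.
  by move=> x y; apply/esym/uniqG; apply: (GB (x, h x) (y, h y)).
have hM : {morph h : x y / x * y}.
  by move=> x y; apply/esym/uniqG; apply: (GM (x, h x) (y, h y)).
have h1 : h 1 = 1 by apply/esym/uniqG.
have hD x : M x -> h x = x.
  by move=> Mx; apply/esym/uniqG/G0G/adjoin_base => //; apply: diagonal_subring.
have ha : h a = r by apply/esym/uniqG/G0G/adjoin_gen; apply: diagonal_subring.
pose m1 := GRing.isZmodMorphism.Build K K h hB.
pose m2 := GRing.isMonoidMorphism.Build K K h (h1, hM).
pose g : {rmorphism K -> K} := HB.pack h m1 m2.
have surj y : exists x, g x = y.
  have [q [Mq nq qy]] := algM y.
  have [rs qE] := closed_field_poly_normal q.
  have memq z : (z \in undup rs) = root q z.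
    by rewrite mem_undup qE rootZ ?lead_coef_eq0 // root_prod_XsubC.
  have gq : map_poly g q = q by apply/polyP => i; rewrite coef_map; apply: hD.
  have sub : {subset map g (undup rs) <= undup rs}.
    move=> _ /mapP[z zr ->]; rewrite memq -gq fmorph_root -memq //.
  have ug : uniq (map g (undup rs)) by rewrite (map_inj_uniq (fmorph_inj g)) undup_uniq.
  have [|_ H] := uniq_min_size ug sub; first by rewrite size_map.
  have : y \in map g (undup rs) by rewrite H memq; apply/rootP.
  by case/mapP => x _ ->; exists x.
have [k gk] := choice surj.
have kg x : k (g x) = x by apply: (fmorph_inj g); rewrite gk.
have kB : {morph k : x y / x - y}.
  by move=> x y; apply: (fmorph_inj g); rewrite rmorphB !gk.
have kM : {morph k : x y / x * y}.
  by move=> x y; apply: (fmorph_inj g); rewrite rmorphM !gk.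
have k1 : k 1 = 1 by apply: (fmorph_inj g); rewrite gk rmorph1.
pose m3 := GRing.isZmodMorphism.Build K K k kB.
pose m4 := GRing.isMonoidMorphism.Build K K k (k1, kM).
pose g' : {rmorphism K -> K} := HB.pack k m3 m4.
exists (@FieldAut K g g' kg gk); split=> /=; first exact: hD.
by rewrite ha.
Qed.

End Automorphisms.

(** * Linear relations between tensors *)

Section Bilinearity.
Variables (K : fieldType) (W : vectType K).

Lemma tens_mulDl p q r s a (x y : tens W p q) (z : tens W r s) :
  tens_mul (a *: x + y) z = a *: tens_mul x z + tens_mul y z.
Proof.
by apply: eq_tens => phi w; rewrite ev_lin !tens_mulE ev_lin mulrDl mulrA.
Qed.

Lemma tens_mulDr p q r s a (x y : tens W p q) (z : tens W r s) :
  tens_mul z (a *: x + y) = a *: tens_mul z x + tens_mul z y.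
Proof.
by apply: eq_tens => phi w; rewrite ev_lin !tens_mulE ev_lin mulrDr mulrCA.
Qed.

Lemma tens_mul0l p q r s (z : tens W r s) : tens_mul (0 : tens W p q) z = 0.
Proof. by apply: eq_tens => phi w; rewrite tens_mulE !ev0 mul0r. Qed.

Lemma tens_mul0r p q r s (z : tens W r s) : tens_mul z (0 : tens W p q) = 0.
Proof. by apply: eq_tens => phi w; rewrite tens_mulE !ev0 mulr0. Qed.

Lemma tens_reindex_lin p q p' q' (s : 'I_p -> 'I_p') (t : 'I_q -> 'I_q') a
    (x y : tens W p q) :
  tens_reindex s t (a *: x + y) = a *: tens_reindex s t x + tens_reindex s t y.
Proof. by apply: tens_of_comb => phi w; rewrite ev_lin. Qed.

Lemma tens_reindex0 p q p' q' (s : 'I_p -> 'I_p') (t : 'I_q -> 'I_q') :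
  tens_reindex s t (0 : tens W p q) = 0.
Proof. by apply: tens_of0 => phi w; rewrite ev0. Qed.

Lemma pull_lshift_cat (T : Type) m n (t : m.-tuple T) (u : n.-tuple T) :
  pull (@lshift m n) [tuple of t ++ u] = t.
Proof. by apply: eq_from_tnth => i; rewrite tnth_mktuple tnth_lshift. Qed.

Lemma pull_rshift_cat (T : Type) m n (t : m.-tuple T) (u : n.-tuple T) :
  pull (@rshift m n) [tuple of t ++ u] = u.
Proof. by apply: eq_from_tnth => i; rewrite tnth_mktuple tnth_rshift. Qed.

(** For y nonzero the kernel of [wedge y] is the line of y, and for y in S the map preserves S: this
    makes it an elimination step for linear relations. *)
Definition wedge p q (y x : tens W p q) := tens_mul x y - tens_mul y x.

Lemma wedge_lin p q (y : tens W p q) : linear (wedge y).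
Proof.
move=> a u v; rewrite /wedge tens_mulDl tens_mulDr scalerBr opprD.
by rewrite addrACA.
Qed.

Lemma wedge_eq0 p q (y x : tens W p q) :
  y != 0 -> wedge y x = 0 -> exists c, x = c *: y.
Proof.
move=> ny /eqP; rewrite subr_eq0 => /eqP E.
have [[phi [w nw]]|all0] := pselect (exists phi w, ev y phi w != 0); last first.
  case/eqP: ny; apply: eq_tens => phi w; rewrite ev0.
  by apply/eqP/negPn/negP => nw; apply: all0; exists phi, w.
exists (ev x phi w / ev y phi w); apply: eq_tens => psi u.
have := congr1 (fun z => ev z [tuple of psi ++ phi] [tuple of u ++ w]) E.
rewrite !tens_mulE !pull_lshift_cat !pull_rshift_cat evZ => E'.
by apply: (mulIf nw); rewrite E' mulrAC mulfVK // mulrC.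
Qed.
End Bilinearity.

Lemma free_subfamily (K : fieldType) (V : vectType K) (X : seq V) :
  exists Y, [/\ free Y, {subset Y <= X} & (<<X>> <= <<Y>>)%VS].
Proof.
elim: X => [|x X [Y [fY YX XY]]]; first by exists [::]; split=> //; rewrite nil_free.
have [xY|nxY] := boolP (x \in <<Y>>%VS).
  exists Y; split=> // [y /YX|]; first by rewrite inE orbC => ->.
  by rewrite span_cons subv_add XY -memvE xY.
exists (x :: Y); split; first by rewrite free_cons nxY.
  by move=> y; rewrite !inE => /orP[->|/YX ->]; rewrite ?orbT.
by rewrite !span_cons addvS.
Qed.

(** * Coefficients of linear relations as ratios of tensors *)

Section Ratios.
Variables (K : fieldType) (I : Type) (ty : I -> nat * nat) (W : tstruct K ty).
Local Notation T := (tens (carrier W)).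
Local Notation S := (@S_tens K I ty W _ _).

Lemma S_opp p q (x : T p q) : S x -> S (- x).
Proof. move=> Sx; have := S_scale (-1)%:~R Sx.
by rewrite ratr_int scaleN1r. Qed.

Lemma S_sub p q (x y : T p q) : S x -> S y -> S (x - y).
Proof. by move=> Sx Sy; apply: S_add => //; apply: S_opp. Qed.

Lemma S_reindex p q p' q' (s : 'I_p -> 'I_p') (t : 'I_q -> 'I_q') (x : T p q) :
  bijective s -> bijective t -> S x -> S (tens_reindex s t x).
Proof.
move=> sB tB; move: (bij_ord_eq sB) (bij_ord_eq tB) => Ep Eq.
subst p' q' => Sx; rewrite (tens_reindex_perm _ (bij_inj sB) (bij_inj tB)).
exact: S_perm.
Qed.

Definition ratio (c : K) : Prop :=
  exists p q (x0 x1 : T p q), [/\ S x0, S x1, x1 != 0 & x0 = c *: x1].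

(** Applying [wedge y], for y a nonzero member of the list, removes y from the relation and stays
    within S. Its kernel being the line of y, the image of [x1] remains outside the span of the
    other images. The type doubles at each step, hence the quantification over p and q; in the end
    x0 = c x1. *)
Lemma ratio_coef n : forall p q (X : seq (T p q)) x0 x1 c, size X = n ->
  (forall x, x \in X -> S x) -> S x0 -> S x1 ->
  x1 \notin <<X>>%VS -> x0 - c *: x1 \in <<X>>%VS -> ratio c.
Proof.
elim: n => [|n IH] p q X x0 x1 c.
  move/size0nil=> -> _ S0 S1; rewrite span_nil !memv0 => nx1.
  by rewrite subr_eq0 => /eqP E; exists p, q, x0, x1.
case: X => // y X [szX] SX S0 S1.
have SX' x : x \in X -> S x by move=> xX; apply: SX; rewrite inE xX orbT.
have Sy : S y by apply: SX; rewrite inE eqxx.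
have [->|ny] := eqVneq y 0.
  have -> : <<(0%R : T p q) :: X>>%VS = <<X>>%VS.
    by rewrite span_cons add0v.
  exact: IH.
pose w : 'Hom(T p q, T (p + p)%N (q + q)%N) := linfun (wedge y).
have wE x : w x = wedge y x by apply: linfun_lin; apply: wedge_lin.
have wS x : S x -> S (w x) by move=> Sx; rewrite wE; apply: S_sub; apply: S_mul.
have wy : w y = 0 by rewrite wE /wedge subrr.
rewrite span_cons => nx1 x01.
apply: (IH _ _ (map w X) (w x0) (w x1)); rewrite ?size_map //; try exact: wS.
- by move=> _ /mapP[x xX ->]; apply/wS/SX'.
- rewrite -limg_span; apply: contra nx1 => /memv_imgP[z zX E].
  have [d Ed] : exists d, x1 - z = d *: y.
    by apply: wedge_eq0 => //; rewrite -wE linearB /= E subrr.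
  rewrite -[x1](subrK z) Ed; apply: memv_add => //; exact: memvZ (memv_line _).
- rewrite -linearZ -linearB -limg_span.
  have /memv_addP[_ /vlineP[d ->] [z zX ->]] := x01.
  by rewrite linearD linearZ /= wy scaler0 add0r; apply: memv_img.
Qed.

(** Subtracting from x its component along the i-th basis vector y leaves an element of the span of
    the others, which does not contain y. *)
Lemma ratio_coord p q n (Y : n.-tuple (T p q)) x i :
  (forall y, y \in Y -> S y) -> free Y -> S x -> x \in <<Y>>%VS ->
  ratio (coord Y i x).
Proof.
move=> SY fY Sx xY; set y := tnth Y i.
have yY : y \in Y by apply: mem_tnth.
have uY : uniq Y by apply: free_uniq.
have remY z : z \in rem y Y -> z \in Y by apply: mem_rem.
apply: (@ratio_coef _ p q (rem y Y) x y) => //; try exact: SY.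
- by move=> z /remY; apply: SY.
- by have := fY; rewrite (perm_free (perm_to_rem yY)) free_cons => /andP[].
have -> : x - coord Y i x *: y = \sum_(j | j != i) coord Y j x *: Y`_j.
  by rewrite {1}(coord_span xY) (bigD1 i) //= -tnth_nth addrAC subrr add0r.
apply: memv_suml => j ji; apply/memvZ/memv_span.
rewrite (mem_rem_uniq y uY) inE -tnth_nth mem_tnth andbT.
by apply: contraNneq ji => /(tuple_uniqP _ uY) ->.
Qed.

End Ratios.

(** * Galois twists of tensors and the relation they generate *)

Section TwistCompatibility.
Variables (K : fieldType) (g : field_aut K) (W : vectType K).
Local Notation gW := (Defs_twist__canonical__vector_Vector g W).
Local Notation tw := (@twist_tens K g W _ _).

Lemma twist_tens_lin p q a (x y : tens W p q) : tw (a *: x + y) = g a *: tw x + tw y.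
Proof. by apply: eq_tens => phi w; rewrite ev_lin !twist_tensE ev_lin rmorphD rmorphM. Qed.

Lemma twist_tens0 p q : tw (0 : tens W p q) = 0.
Proof. by apply: eq_tens => phi w; rewrite twist_tensE !ev0 rmorph0. Qed.

Lemma twist_tens_sum p q n c (F : 'I_n -> tens W p q) :
  tw (\sum_i c i *: F i) = \sum_i g (c i) *: tw (F i).
Proof.
elim/big_rec2: _ => [|i x y _ <-]; [exact: twist_tens0 | exact: twist_tens_lin].
Qed.

Lemma untwist_dual_surj (phi : dual W) : exists psi : dual gW, @untwist_dual K g W psi = phi.
Proof.
pose psi : dual gW := linfun (fun w : gW => g ((phi : 'Hom(W, K^o)) (w : W)) : K^o).
exists psi; apply/lfunP => w; rewrite untwist_dualE linfun_lin ?autK // => a u v.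
rewrite -[a *: u]/(aut_inv g a *: (u : W)) linearP rmorphD rmorphM aut_invK.
by [].
Qed.

Lemma twist_tens_inj p q (x : tens W p q) : tw x = 0 -> x = 0.
Proof.
move=> tx; apply: eq_tens => phi w; rewrite ev0.
have [psi psiE] := choice untwist_dual_surj.
have := twist_tensE x [tuple psi (tnth phi i) | i < p] [tuple (tnth w j : gW) | j < q].
rewrite tx ev0 => /esym/eqP; rewrite fmorph_eq0 => /eqP E; rewrite -[RHS]E.
congr (ev _ _ _); apply: eq_from_tnth => i; rewrite !tnth_mktuple ?psiE //.
Qed.

Lemma twist_tens_mul p q r s (x : tens W p q) (y : tens W r s) :
  tw (tens_mul x y) = tens_mul (tw x) (tw y).
Proof.
apply: eq_tens => phi w; rewrite tens_mulE !twist_tensE tens_mulE rmorphM.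
congr (_ * _); apply: congr1; congr ev; apply: eq_from_tnth => i; by rewrite !tnth_mktuple.
Qed.

Lemma twist_tens_reindex p q p' q' (s : 'I_p -> 'I_p') (t : 'I_q -> 'I_q') (x : tens W p q) :
  bijective s -> bijective t -> tw (tens_reindex s t x) = tens_reindex s t (tw x).
Proof.
move=> sB tB; apply: eq_tens => phi w; rewrite twist_tensE !tens_reindexE // twist_tensE.
by apply: congr1; congr ev; apply: eq_from_tnth => i; rewrite !tnth_mktuple.
Qed.

Lemma twist_tens_id : tw (tens_id W) = tens_id gW.
Proof.
apply: eq_tens => phi w; rewrite twist_tensE !tens_idE /thead !tnth_mktuple untwist_dualE.
exact: aut_invK.
Qed.

Lemma twist_dim : dimW gW = dimW W.
Proof. by rewrite /dimW !dimvf. Qed.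

End TwistCompatibility.

Section TwistRelation.
Variables (K : fieldType) (I : Type) (ty : I -> nat * nat) (W : tstruct K ty).
Variable g : field_aut K.
Local Notation gW := (Defs_twist__canonical__vector_Vector g (carrier W)).
Local Notation tw := (@twist_tens K g (carrier W) _ _).

(** The K-span of the pairs (y, tw y) with y in S. Although [tw] is semilinear, both components are
    combined with the same scalars: this is not the graph of [tw], and that it respects vanishing
    has to be derived from g fixing the ratios. *)
Inductive twist_rel : tens_rel (carrier W) gW :=
| twist_rel0 p q : @twist_rel p q 0 0
| twist_rel_cons p q c (y x : tens (carrier W) p q) x' :
    S_tens y -> twist_rel x x' -> twist_rel (c *: y + x) (c *: tw y + x').

Lemma twist_rel_gen p q (y : tens (carrier W) p q) : S_tens y -> twist_rel y (tw y).
Proof.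
move=> Sy; have := twist_rel_cons 1 Sy (twist_rel0 p q).
by rewrite !scale1r !addr0.
Qed.

Lemma twist_rel_lin p q a (x y : tens (carrier W) p q) x' y' :
  twist_rel x x' -> twist_rel y y' -> twist_rel (a *: x + y) (a *: x' + y').
Proof.
move=> Sx; elim: Sx y y' => [p1 q1|p1 q1 c z u u' Sz _ IH] y y' Sy.
  by rewrite !scaler0 !add0r.
rewrite !scalerDr !scalerA -!addrA; apply: twist_rel_cons => //; exact: IH.
Qed.

Lemma twist_rel_mul p q r s (x : tens (carrier W) p q) (y : tens (carrier W) r s) x' y' :
  twist_rel x x' -> twist_rel y y' ->
  twist_rel (tens_mul x y) (tens_mul x' y').
Proof.
move=> Sx Sy; elim: Sx => [p1 q1|p1 q1 c z u u' Sz _ IH].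
  by rewrite !tens_mul0l; apply: twist_rel0.
rewrite !tens_mulDl; apply: twist_rel_lin => //.
elim: Sy => [r1 s1|r1 s1 d v w w' Sv _ IHy].
  by rewrite !tens_mul0r; apply: twist_rel0.
rewrite !tens_mulDr; apply: twist_rel_lin => //.
by rewrite -twist_tens_mul; apply/twist_rel_gen/S_mul.
Qed.

Lemma twist_rel_reindex p q p' q' (s : 'I_p -> 'I_p') (t : 'I_q -> 'I_q') x x' :
  bijective s -> bijective t -> @twist_rel p q x x' ->
  @twist_rel p' q' (tens_reindex s t x) (tens_reindex s t x').
Proof.
move=> sB tB Sx; elim: Sx s t sB tB => [p1 q1|p1 q1 c z u u' Sz _ IH] s t sB tB.
  by rewrite !tens_reindex0; apply: twist_rel0.
rewrite !tens_reindex_lin; apply: twist_rel_lin; last exact: IH.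
by rewrite -twist_tens_reindex //; apply/twist_rel_gen/S_reindex.
Qed.

Lemma twist_rel_sum p q (x : tens (carrier W) p q) x' : twist_rel x x' ->
  exists n (c : 'I_n -> K) (F : 'I_n -> tens (carrier W) p q),
    [/\ forall i, S_tens (F i), x = \sum_i c i *: F i & x' = \sum_i c i *: tw (F i)].
Proof.
elim=> [p1 q1|p1 q1 d z u u' Sz _ [n [c [F [SF -> ->]]]]].
  by exists 0%N, (fun=> 0), (fun=> 0); rewrite !big_ord0; split=> // -[].
exists n.+1, (fun i => if unlift ord0 i is Some j then c j else d),
  (fun i => if unlift ord0 i is Some j then F j else z).
split=> [i||]; first by case: unlift.
  by rewrite big_ord_recl unlift_none; congr (_ + _); apply: eq_bigr => i _; rewrite liftK.
by rewrite big_ord_recl unlift_none; congr (_ + _); apply: eq_bigr => i _; rewrite liftK.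
Qed.

Hypothesis g_ratio : forall c, ratio W c -> g c = c.

(* Over a basis Y of the span of the F_i made of S-tensors, both sums have the same
   coordinates, since g fixes the coordinates of the F_i. *)
Lemma twist_rel_eq0 p q (x : tens (carrier W) p q) x' :
  twist_rel x x' -> (x = 0 <-> x' = 0).
Proof.
case/twist_rel_sum => n [c [F [SF -> ->]]].
have [Y0 [fY0 YX XY]] := free_subfamily [seq F i | i <- enum 'I_n].
pose m := size Y0; pose Y : m.-tuple _ := in_tuple Y0.
have fY : free Y by [].
have fYP := freeP fY.
have SY y : y \in Y -> S_tens y by move=> /YX/mapP[i _ ->].
have FY i : F i \in <<Y>>%VS.
  by apply: (subvP XY); apply/memv_span/map_f; rewrite mem_enum.
pose D j := \sum_i c i * coord Y j (F i).
have E1 : \sum_i c i *: F i = \sum_j D j *: tnth Y j.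
  under [RHS]eq_bigr do rewrite scaler_suml.
  rewrite exchange_big; apply: eq_bigr => i _.
  rewrite {1}(coord_span (FY i)) scaler_sumr; apply: eq_bigr => j _.
  by rewrite scalerA -tnth_nth.
have E2 : \sum_i c i *: tw (F i) = \sum_j D j *: tw (tnth Y j).
  under [RHS]eq_bigr do rewrite scaler_suml.
  rewrite exchange_big; apply: eq_bigr => i _.
  have -> : tw (F i) = \sum_j coord Y j (F i) *: tw (tnth Y j).
    rewrite {1}(coord_span (FY i)).
    rewrite (eq_bigr (fun j => coord Y j (F i) *: tnth Y j)); last by move=> j _; rewrite -tnth_nth.
    rewrite twist_tens_sum; apply: eq_bigr => j _; rewrite g_ratio //.
    exact: ratio_coord.
  rewrite scaler_sumr; apply: eq_bigr => j _.
  by rewrite scalerA.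
rewrite E1 E2.
have D0 : \sum_j D j *: tnth Y j = 0 -> forall j, D j = 0.
  move=> s0; apply: fYP; rewrite -[RHS]s0; apply: eq_bigr => j _.
  by rewrite -tnth_nth.
split=> [/D0 D00|H]; first by rewrite big1 // => j _; rewrite D00 scale0r.
(* The twist is semilinear and injective, so a relation between the twisted basis vectors comes from
   one between the basis vectors, with coefficients moved by the inverse of g. *)
have H' : \sum_j aut_inv g (D j) *: tnth Y j = 0.
  apply: (@twist_tens_inj _ g); rewrite twist_tens_sum -[RHS]H; apply: eq_bigr => j _.
  by rewrite aut_invK.
rewrite big1 // => j _.
have := fYP (fun j => aut_inv g (D j)) _ j.
rewrite (eq_bigr (fun j => aut_inv g (D j) *: tnth Y j)); last by move=> k _; rewrite -tnth_nth.
by move=> /(_ H') /eqP; rewrite fmorph_eq0 => /eqP->; rewrite scale0r.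
Qed.

Lemma twist_rel_compatible : S_tens (1 : tens (carrier W) 0 0) -> compatible twist_rel.
Proof.
move=> S1; split.
- exact: twist_rel0.
- exact: twist_rel_lin.
- exact: twist_rel_mul.
- by move=> p q p' q' s t x x'; apply: twist_rel_reindex.
- by rewrite -twist_tens_id; apply/twist_rel_gen/S_id.
- have := twist_rel_gen S1; congr twist_rel.
  by rewrite -[LHS]/(ev _ [tuple] [tuple]) twist_tensE rmorph1.
- by move=> p q x x'; apply: twist_rel_eq0.
Qed.

End TwistRelation.

Section UnitTensor.
Variables (K : fieldType) (I : Type) (ty : I -> nat * nat) (W : tstruct K ty).

Lemma S_unit (c : K) : c != 0 -> S_tens (c : tens (carrier W) 0 0) ->
  S_tens (1 : tens (carrier W) 0 0).
Proof.
move=> nc Sc; have := S_mul Sc (S_inv nc Sc); congr S_tens.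
have E := @tens_mulE K (carrier W) 0 0 0 0 c c^-1 [tuple] [tuple].
exact: etrans E (divff nc).
Qed.

(** The scalar 1 is not among the generators of S; contracting the identity yields the dimension of
    W, which is invertible in characteristic zero. *)
Lemma S_unit_dim : [pchar K] =i pred0 -> (0 < dimW (carrier W))%N ->
  S_tens (1 : tens (carrier W) 0 0).
Proof.
move=> char0 n0; apply: (@S_unit (dimW (carrier W))%:R).
  by rewrite ((pcharf0P K).1 char0) -lt0n.
have := S_contr (S_id W); congr S_tens.
rewrite -[LHS]/(ev _ [tuple] [tuple]) tens_contrE.
under eq_bigr => i _ do rewrite tens_idE.
rewrite -[RHS]mulr1 -[X in _ = X%:R * _]card_ord mulr_natl -sumr_const.
apply: eq_bigr => i _.
by rewrite !theadE cobase_base eqxx.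
Qed.
End UnitTensor.

(** * The kernel of the contraction with a tensor *)

Section Join.
Variables (a b c : nat) (T : Type).

Definition join3 (f : 'I_a -> T) (g : 'I_b -> T) (h : 'I_c -> T) (k : 'I_(a + b + c)) : T :=
  match split k with
  | inl k' => match split k' with inl i => f i | inr j => g j end
  | inr l => h l
  end.

Lemma join3_1 f g h i : join3 f g h (lshift c (lshift b i)) = f i.
Proof. by rewrite /join3 (unsplitK (inl _)) (unsplitK (inl _)). Qed.
Lemma join3_2 f g h i : join3 f g h (lshift c (rshift a i)) = g i.
Proof. by rewrite /join3 (unsplitK (inl _)) (unsplitK (inr _)). Qed.
Lemma join3_3 f g h i : join3 f g h (rshift (a + b) i) = h i.
Proof. by rewrite /join3 (unsplitK (inr _)). Qed.

Lemma join3_cases k : [\/ exists i, k = lshift c (lshift b i),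
  exists i, k = lshift c (rshift a i) | exists i, k = rshift (a + b) i].
Proof.
case: (split_cases k) => [[k' ->]|[i ->]]; last by constructor 3; exists i.
case: (split_cases k') => [[i ->]|[i ->]]; first by constructor 1; exists i.
by constructor 2; exists i.
Qed.
End Join.

Lemma join3_bij a b c n (f : 'I_a -> 'I_n) (g : 'I_b -> 'I_n) (h : 'I_c -> 'I_n) :
  n = (a + b + c)%N -> injective f -> injective g -> injective h ->
  (forall i j, f i != g j) -> (forall i j, f i != h j) -> (forall i j, g i != h j) ->
  bijective (join3 f g h).
Proof.
move=> nE fI gI hI fg fh gh; apply: inj_card_bij; last by rewrite !card_ord nE.
have fg' i j : g j != f i by rewrite eq_sym.
have fh' i j : h j != f i by rewrite eq_sym.
have gh' i j : h j != g i by rewrite eq_sym.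
move=> k l; case: (join3_cases k) => [] [i ->]; case: (join3_cases l) => [] [j ->];
  rewrite ?join3_1 ?join3_2 ?join3_3; try by [move/fI->|move/gI->|move/hI->];
  by move/eqP; rewrite ?(negPf (fg _ _)) ?(negPf (fh _ _)) ?(negPf (gh _ _))
     ?(negPf (fg' _ _)) ?(negPf (fh' _ _)) ?(negPf (gh' _ _)).
Qed.

Lemma big_tuple_cat (R : nmodType) m n (T : finType) (F : (m + n).-tuple T -> R) :
  \sum_(L : (m + n).-tuple T) F L =
  \sum_(t : m.-tuple T) \sum_(u : n.-tuple T) F [tuple of t ++ u].
Proof.
rewrite pair_big /=.
pose h (z : m.-tuple T * n.-tuple T) : (m + n).-tuple T := [tuple of z.1 ++ z.2].
rewrite (reindex h) //=; exists (fun L => (pull (@lshift m n) L, pull (@rshift m n) L)).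
  by case=> t u _; rewrite /h /= pull_lshift_cat pull_rshift_cat.
move=> L _; apply: eq_from_tnth => k; rewrite /h /=.
by case: (split_cases k) => [[j ->]|[j ->]]; rewrite ?tnth_lshift ?tnth_rshift tnth_mktuple.
Qed.

Lemma sum_delta (R : pzSemiRingType) (T : finType) (a : T) (F : T -> R) :
  \sum_x (a == x)%:R * F x = F a.
Proof.
rewrite (bigD1 a) //= eqxx mul1r big1 ?addr0 // => x ne.
by rewrite eq_sym (negPf ne) mul0r.
Qed.

Lemma prod_delta (R : comNzRingType) (T : eqType) n (t u : n.-tuple T) :
  \prod_(i < n) (tnth t i == tnth u i)%:R = (t == u)%:R :> R.
Proof.
case: eqP => [->|ne]; first by rewrite big1 // => i _; rewrite eqxx.
have [i ni] : exists i, tnth t i != tnth u i.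
  apply/existsP; rewrite -negb_forall; apply/negP => /forallP E; apply: ne.
  by apply: eq_from_tnth => i; apply/eqP.
by rewrite (bigD1 i) //= (negPf ni) mul0r.
Qed.

Section Coordinates.
Variables (K : fieldType) (W : vectType K).
Local Notation n := (dimW W).

Definition crd p q (x : tens W p q) (A : p.-tuple 'I_n) (B : q.-tuple 'I_n) : K :=
  ev x [tuple of map (@cobase K W) A] [tuple of map (@base K W) B].

Lemma tens_with_crd p q (c : p.-tuple 'I_n -> q.-tuple 'I_n -> K) :
  exists x, forall A B, crd x A B = c A B.
Proof.
elim: p c => [|p IHp] c.
  elim: q c => [|q IHq] c.
    exists (c [tuple] [tuple] : tens W 0 0) => A B.
    by rewrite [A]tuple0 [B]tuple0.
  have [x xE] := choice (fun a => IHq (fun A B => c A [tuple of a :: B])).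
  exists (linfun (fun w => \sum_a (cobase a : 'Hom(W, K^o)) w *: (x a : cotens W q))
    : tens W 0 q.+1).
  move=> A B; rewrite (tuple_eta B) -(xE (thead B)) /crd.
  rewrite (_ : [tuple of map (@base K W) _] =
    [tuple of base (thead B) :: [tuple of map (@base K W) [tuple of behead B]]]);
    last exact: val_inj.
  rewrite [LHS]/= theadE linfun_lin => [|d u v]; last first.
    rewrite scaler_sumr -big_split; apply: eq_bigr => a _ /=.
    by rewrite linearP scalerDl scalerA.
  rewrite (bigD1 (thead B)) //= big1 ?addr0 => [|a ne].
    by rewrite cobase_base eqxx scale1r; congr coev; apply: val_inj.
  by rewrite cobase_base (negPf ne) scale0r.
have [x xE] := choice (fun a => IHp (fun A B => c [tuple of a :: A] B)).
exists (linfun (fun phi : dual W => \sum_a (phi : 'Hom(W, K^o)) (base a) *: x a) : tens W p.+1 q).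
move=> A B; rewrite (tuple_eta A) -(xE (thead A)) /crd.
rewrite (_ : [tuple of map (@cobase K W) _] =
  [tuple of cobase (thead A) :: [tuple of map (@cobase K W) [tuple of behead A]]]);
  last exact: val_inj.
rewrite [LHS]/= theadE linfun_lin => [|d u v]; last first.
  rewrite scaler_sumr -big_split; apply: eq_bigr => a _ /=.
  by rewrite add_lfunE scale_lfunE scalerDl scalerA.
rewrite (bigD1 (thead A)) //= big1 ?addr0 => [|a ne].
  by rewrite cobase_base eqxx scale1r; congr ev; apply: val_inj.
by rewrite cobase_base eq_sym (negPf ne) scale0r.
Qed.

Fixpoint tens_idn m : tens W m m :=
  if m is m'.+1 then tens_mul (tens_id W) (tens_idn m') else (1 : K).

Lemma tens_idnE m phi w :
  ev (tens_idn m) phi w = \prod_i (tnth phi i : 'Hom(W, K^o)) (tnth w i).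
Proof.
elim: m phi w => [|m IH] phi w; first by rewrite big_ord0.
rewrite (@tens_mulE _ _ 1 1 m m) tens_idE IH big_ord_recl.
congr (_ * _).
  rewrite /thead !tnth_mktuple (_ : lshift m (ord0 : 'I_1) = (ord0 : 'I_m.+1)) //.
  exact: val_inj.
apply: eq_bigr => i _; rewrite !tnth_mktuple (_ : rshift 1 i = lift ord0 i) //.
exact: val_inj.
Qed.

Lemma tens_idn1 : tens_idn 1 = tens_id W.
Proof.
apply: eq_tens => phi w; rewrite tens_idnE tens_idE big_ord_recl big_ord0 mulr1.
by [].
Qed.

Lemma crd_pairing p q (x : tens W p q) (y : tens W q p) :
  (hom_of_tens (p := q) (q := p) (a := 0) (b := 0) x y : K) =
  \sum_(A : q.-tuple 'I_n) \sum_(B : p.-tuple 'I_n) crd y A B * crd x B A.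
Proof.
rewrite -[LHS]/(ev (hom_of_tens (p := q) (q := p) (a := 0) (b := 0) x y) [tuple] [tuple]).
rewrite hom_of_tensE; apply: eq_bigr => A _; apply: eq_bigr => B _.
by congr (_ * ev _ _ _); apply: val_inj.
Qed.

End Coordinates.

Lemma pull_comp (T : Type) m n k (s : 'I_m -> 'I_n) (t : 'I_n -> 'I_k) (w : k.-tuple T) :
  pull (t \o s) w = pull s (pull t w).
Proof. by apply: eq_from_tnth => i; rewrite !tnth_mktuple. Qed.

Lemma pull_map_comp (A T : Type) m n (s : 'I_m -> 'I_n) (f : A -> T) (w : n.-tuple A) :
  pull s [tuple of map f w] = [tuple of map f (pull s w)].
Proof. by apply: eq_from_tnth => i; rewrite tnth_mktuple !tnth_map tnth_ord_tuple. Qed.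

Section Annihilator.
Variables (K : fieldType) (W : vectType K) (p q : nat) (x : tens W p q).
Local Notation n := (dimW W).

Lemma crd_mul p' q' r s (y : tens W p' q') (z : tens W r s)
    (A : p'.-tuple 'I_n) (A' : r.-tuple 'I_n) (B : q'.-tuple 'I_n) (B' : s.-tuple 'I_n) :
  crd (tens_mul y z) [tuple of A ++ A'] [tuple of B ++ B'] = crd y A B * crd z A' B'.
Proof. by rewrite /crd tens_mulE !pull_cat_l !pull_cat_r. Qed.

Lemma crd_hom p' q' a b (t : tens W (a + q') (b + p')) v (A : a.-tuple 'I_n) (B : b.-tuple 'I_n) :
  crd (hom_of_tens t v) A B =
  \sum_(i : p'.-tuple 'I_n) \sum_(j : q'.-tuple 'I_n)
     crd v i j * crd t [tuple of A ++ j] [tuple of B ++ i].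
Proof.
rewrite /crd hom_of_tensE; apply: eq_bigr => i _; apply: eq_bigr => j _.
by congr (_ * ev _ _ _); apply: val_inj; rewrite /= map_cat.
Qed.

(** The tensor [x] beside q + p identity strands. The maps [f], [g], [h] place the covector slots of
    the first q strands, of the other p strands and of [x]; the primed maps place the vector slots
    in the same order. *)
Definition joined N M (f : 'I_q -> 'I_N) g (h : 'I_p -> 'I_N)
    (f' : 'I_q -> 'I_M) g' (h' : 'I_q -> 'I_M) : tens W N M :=
  tens_reindex (join3 f g h) (join3 f' g' h') (tens_mul (tens_idn W (q + p)) x).

Lemma crd_joined N M f (g : 'I_p -> 'I_N) h f' (g' : 'I_p -> 'I_M) h' A B :
  bijective (join3 f g h) -> bijective (join3 f' g' h') ->
  crd (joined f g h f' g' h') A B =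
  (pull f A == pull f' B)%:R * (pull g A == pull g' B)%:R * crd x (pull h A) (pull h' B).
Proof.
move=> s_bij t_bij; rewrite /crd tens_reindexE // tens_mulE tens_idnE.
congr (_ * _); last first.
  by congr ev; apply: eq_from_tnth => i; rewrite !tnth_mktuple !tnth_map !tnth_ord_tuple join3_3.
rewrite big_split_ord -!prod_delta; congr (_ * _); apply: eq_bigr => i _.
  by rewrite !tnth_mktuple !join3_1 !tnth_map cobase_base.
by rewrite !tnth_mktuple !join3_2 !tnth_map cobase_base.
Qed.

(* As a map W^{q,p} (x) W^{q,p} -> W^{q,p} this is
   y (x) y' |-> <x,y'> y - <x,y> y', with image the kernel of the pairing with x. *)
Definition annihilator : tens W (q + (p + p)) (p + (q + q)) :=
  joined (@lshift q (p + p)) (@rshift q (p + p) \o @lshift p p)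
         (@rshift q (p + p) \o @rshift p p)
         (@rshift p (q + q) \o @lshift q q) (@lshift p (q + q))
         (@rshift p (q + q) \o @rshift q q) -
  joined (@lshift q (p + p)) (@rshift q (p + p) \o @rshift p p)
         (@rshift q (p + p) \o @lshift p p)
         (@rshift p (q + q) \o @rshift q q) (@lshift p (q + q))
         (@rshift p (q + q) \o @lshift q q).

Lemma annihilator_bij :
  [/\ bijective (join3 (@lshift q (p + p)) (@rshift q (p + p) \o @lshift p p)
         (@rshift q (p + p) \o @rshift p p)),
      bijective (join3 (@rshift p (q + q) \o @lshift q q) (@lshift p (q + q))
         (@rshift p (q + q) \o @rshift q q)),
      bijective (join3 (@lshift q (p + p)) (@rshift q (p + p) \o @rshift p p)
         (@rshift q (p + p) \o @lshift p p)) &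
      bijective (join3 (@rshift p (q + q) \o @rshift q q) (@lshift p (q + q))
         (@rshift p (q + q) \o @lshift q q))].
Proof.
have lI m k := @lshift_inj m k; have rI m k := @rshift_inj m k.
by split; apply: join3_bij => [||||i j|i j|i j] /=; try lia;
  rewrite ?(inj_eq (@rshift_inj _ _)) ?lr_neq 1?eq_sym ?(inj_eq (@rshift_inj _ _)) ?lr_neq //;
  try exact: inj_comp.
Qed.

Lemma crd_annihilator (A i1 i2 : q.-tuple 'I_n) (B j1 j2 : p.-tuple 'I_n) :
  crd annihilator [tuple of A ++ [tuple of j1 ++ j2]] [tuple of B ++ [tuple of i1 ++ i2]] =
  (A == i1)%:R * (j1 == B)%:R * crd x j2 i2 - (A == i2)%:R * (j2 == B)%:R * crd x j1 i1.
Proof.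
have [b1 b2 b3 b4] := annihilator_bij.
by rewrite {1}/crd evB -!/(crd _ _ _) !crd_joined // !pull_comp
  !pull_rshift_cat !pull_lshift_cat ?pull_rshift_cat.
Qed.

Definition annihilator_map : 'Hom(tens W (q + q) (p + p), tens W q p) :=
  hom_of_tens annihilator.

(** Summing out the Kronecker deltas leaves the contraction of [x] with the second factor of v minus
    that with the first. *)
Lemma crd_annihilator_map v A B :
  crd (annihilator_map v) A B =
  \sum_(i : q.-tuple 'I_n) \sum_(j : p.-tuple 'I_n)
    (crd v [tuple of A ++ i] [tuple of B ++ j] -
     crd v [tuple of i ++ A] [tuple of j ++ B]) * crd x j i.
Proof.
rewrite crd_hom big_tuple_cat.
under eq_bigr do under eq_bigr do rewrite big_tuple_cat.
under eq_bigr do under eq_bigr do under eq_bigr do under eq_bigr do rewrite crd_annihilator mulrBr.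
under eq_bigr do under eq_bigr do under eq_bigr do rewrite sumrB.
under eq_bigr do under eq_bigr do rewrite sumrB.
under eq_bigr do rewrite sumrB.
rewrite sumrB.
transitivity (\sum_(i : q.-tuple 'I_n) \sum_(j : p.-tuple 'I_n)
     crd v [tuple of A ++ i] [tuple of B ++ j] * crd x j i -
   \sum_(i : q.-tuple 'I_n) \sum_(j : p.-tuple 'I_n)
     crd v [tuple of i ++ A] [tuple of j ++ B] * crd x j i); last first.
  rewrite -sumrB; apply: eq_bigr => i _; rewrite -sumrB; apply: eq_bigr => j _.
  by rewrite mulrBl.
congr (_ - _).
  rewrite -(sum_delta A (fun i1 => \sum_(i : q.-tuple 'I_n) \sum_(j : p.-tuple 'I_n)
     crd v [tuple of i1 ++ i] [tuple of B ++ j] * crd x j i)).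
  apply: eq_bigr => i1 _; rewrite mulr_sumr; apply: eq_bigr => i2 _.
  rewrite -(sum_delta B (fun j1 => \sum_(j : p.-tuple 'I_n)
     crd v [tuple of i1 ++ i2] [tuple of j1 ++ j] * crd x j i2)).
  rewrite mulr_sumr; apply: eq_bigr => j1 _; rewrite !mulr_sumr; apply: eq_bigr => j2 _.
  by rewrite [j1 == B]eq_sym; ring.
apply: eq_bigr => i1 _.
rewrite -(sum_delta A (fun i2 => \sum_(j : p.-tuple 'I_n)
     crd v [tuple of i1 ++ i2] [tuple of j ++ B] * crd x j i1)).
apply: eq_bigr => i2 _; rewrite mulr_sumr; apply: eq_bigr => j1 _.
rewrite -(sum_delta B (fun j2 => crd v [tuple of i1 ++ i2] [tuple of j1 ++ j2] * crd x j1 i1)).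
rewrite mulr_sumr; apply: eq_bigr => j2 _.
by rewrite [j2 == B]eq_sym; ring.
Qed.

Definition pairing : 'Hom(tens W q p, K^o) :=
  hom_of_tens (p := q) (q := p) (a := 0) (b := 0) x.

(** In coordinates the value is, for any v, a double sum minus the same sum with its two summation
    indices exchanged. *)
Lemma pairing_annihilator v : pairing (annihilator_map v) = 0.
Proof.
rewrite /pairing crd_pairing.
under eq_bigr do under eq_bigr do rewrite crd_annihilator_map.
pose G (P Q : q.-tuple 'I_n * p.-tuple 'I_n) : K :=
  crd v [tuple of P.1 ++ Q.1] [tuple of P.2 ++ Q.2] * crd x Q.2 Q.1 * crd x P.2 P.1.
transitivity (\sum_P \sum_Q G P Q - \sum_P \sum_Q G Q P).
  rewrite -sumrB pair_big; apply: eq_bigr => -[A B] _ /=.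
  rewrite -sumrB pair_big mulr_suml; apply: eq_bigr => -[i j] _ /=.
  rewrite /G /=; ring.
by rewrite [X in _ - X]exchange_big subrr.
Qed.

Lemma annihilator_mul y y' :
  annihilator_map (tens_mul y y') = pairing y' *: y - pairing y *: y'.
Proof.
apply: eq_tens_base => A B; rewrite -!/(crd _ _ _) crd_annihilator_map.
rewrite [RHS]evB !evZ /pairing !crd_pairing -!/(crd _ _ _).
rewrite !mulr_suml -sumrB; apply: eq_bigr => i _.
rewrite !mulr_suml -sumrB; apply: eq_bigr => j _.
by rewrite !crd_mul; ring.
Qed.

Lemma pairing_neq0 : x != 0 -> exists y, pairing y = 1.
Proof.
move=> nx; have [A [B nAB]] : exists A B, crd x B A != 0.
  apply/not_existsP => H; case/eqP: nx; apply: eq_tens_base => B A.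
  rewrite ev0; apply/eqP/negPn/negP => nz; apply: (H A); by exists B.
have [y yE] := @tens_with_crd _ W q p (fun A' B' => (A == A')%:R * ((B == B')%:R * (crd x B A)^-1)).
exists y; rewrite /pairing crd_pairing.
under eq_bigr do under eq_bigr do rewrite yE -!mulrA.
under eq_bigr do rewrite -mulr_sumr sum_delta.
by rewrite sum_delta mulVf.
Qed.

(** If <x, y> = 0 and <x, y'> = 1, the tensor product of y and y' is sent to y. *)
Lemma limg_annihilator : x != 0 -> limg annihilator_map = lker pairing.
Proof.
move=> nx; apply/vspaceP => y; apply/idP/idP => [/memv_imgP[v _ ->]|].
  by rewrite memv_ker pairing_annihilator.
rewrite memv_ker => /eqP y0; have [y' y'1] := pairing_neq0 nx.
apply/memv_imgP; exists (tens_mul y y'); rewrite ?memvf //.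
by rewrite annihilator_mul y0 y'1 scale0r subr0 scale1r.
Qed.

End Annihilator.

(** * Scalars in the tower of kernel completions *)

Section SingletonMaps.
Variables (K : fieldType) (I : Type) (ty : I -> nat * nat) (W : tstruct K ty).
Local Notation fib1 := (fib1 W).

Definition lift1 (A B : ob0) (f : 'Hom(fib0 W A, fib0 W B)) : 'Hom(fib1 [:: A], fib1 [:: B]) :=
  linfun (fun v : fib1 [:: A] => ((f v.1, 0) : fib1 [:: B])).

Lemma fib1_eq A (u v : fib1 [:: A]) : u.1 = v.1 -> u = v.
Proof.
case: u v => [u1 u2] [v1 v2] /= ->; congr pair.
by apply/rowP => -[].
Qed.

Lemma lift1E A B f (v : fib1 [:: A]) : @lift1 A B f v = (f v.1, 0).
Proof.
rewrite linfun_lin // => a u w; apply: fib1_eq.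
by rewrite /= linearP.
Qed.

Lemma hom_lift1 A B f : hom_C0 f -> @hom_C1 _ _ _ W [:: A] [:: B] (lift1 f).
Proof.
move=> hf; split=> //; split=> //.
rewrite (_ : linfun _ = f) //; apply/lfunP => v.
have E u : linfun (fun v : fib0 W A => lift1 f (v, 0)) u = lift1 f (u, 0).
  rewrite linfun_lin // => a w w'; rewrite -linearP; congr (lift1 f _).
  by apply: fib1_eq.
rewrite linfun_lin => [|a u w]; first by rewrite E lift1E.
by rewrite !E !lift1E /= linearP.
Qed.

Lemma hom_unlift1 A B (f : 'Hom(fib1 [:: A], fib1 [:: B])) (f' : 'Hom(fib0 W A, fib0 W B)) :
  (forall v, (f (v, 0)).1 = f' v) -> hom_C1 f -> hom_C0 f'.
Proof.
move=> ff' [[hf _] _].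
rewrite (_ : f' = linfun (fun v => (linfun (fun v : fib0 W A => f (v, 0)) v).1)) //.
apply/lfunP => v.
have E u : linfun (fun v : fib0 W A => f (v, 0)) u = f (u, 0).
  rewrite linfun_lin // => a w w'; rewrite -linearP; congr (f _).
  by apply: fib1_eq.
by rewrite linfun_lin => [|a u w]; rewrite !E ?ff' // linearP.
Qed.

Lemma S_idn m : (0 < m)%N \/ S_tens (1 : tens (carrier W) 0 0) ->
  S_tens (tens_idn (carrier W) m).
Proof.
elim: m => [|[|m] IH] H; first by case: H.
  by rewrite tens_idn1; apply: S_id.
by apply: (S_mul (S_id W)); apply: IH; left.
Qed.

Lemma S_annihilator p q (x : tens (carrier W) p q) :
  S_tens x -> x != 0 -> S_tens (annihilator x).
Proof.
move=> Sx nx; have [b1 b2 b3 b4] := annihilator_bij p q.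
have Sid : S_tens (tens_idn (carrier W) (q + p)).
  (* For p = q = 0 the identity strands reduce to the scalar 1, which lies in S because x is then a
     nonzero scalar of S. *)
  apply: S_idn; have [qp|] := ltnP 0 (q + p); [by left | right].
  have p0 : p = 0%N by lia. have q0 : q = 0%N by lia.
  subst p q; exact (@S_unit K I ty W x nx Sx).
by apply: S_sub; apply: S_reindex => //; apply: S_mul.
Qed.

End SingletonMaps.

(** * Endomorphisms of the unit along the tower *)

Section UnitTower.
Variables (K : fieldType) (C : vcat K).

Fixpoint unit_at n : ob (tower C n) :=
  if n is n'.+1 then incl (unit_at n') else unit_ob C.

Definition scalar_at n (c : K) : Prop :=
  Defs.hom (c *: \1%VF : 'Hom(fib (unit_at n), fib (unit_at n))).

End UnitTower.

Section ScalarHoms.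
Variables (K : fieldType) (C : vcat K) (U : ob C).

Lemma lker_incl : lker (arr (incl U)) = fullv.
Proof. by apply/vspaceP => v; rewrite memv_ker lfunE /= eqxx memvf. Qed.

(** The sequence X -> Y -> U -> 0 is good, so f0 identifies the cokernel of f1 with U, and h = c f0
    induces c on it. *)
Lemma scalar_induced (c : K) (X Y : ob C) (f1 : 'Hom(fib X, fib Y)) (f0 h : 'Hom(fib Y, fib U)) :
  Defs.hom f1 -> Defs.hom f0 -> Defs.hom h -> limg f1 = lker f0 -> limg f0 = fullv ->
  h = c *: f0 -> ker_hom (c *: \1%VF : 'Hom(ker_fib (incl U), ker_fib (incl U))).
Proof.
move=> hf1 hf0 hh ex1 ex0 hE.
apply: (@ker_hom_induced K C (incl U) (incl U) X Y f1 f0 h) => //.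
- by rewrite lker_incl.
- by rewrite /= comp_lfun0l.
- apply/lfunP => v; rewrite comp_lfunE hE scale_lfunE zero_lfunE.
  have : f1 v \in lker f0 by rewrite -ex1 memv_img ?memvf.
  by rewrite memv_ker => /eqP->; rewrite scaler0.
- by move=> k y E; rewrite scale_lfunE id_lfunE linearZ hE scale_lfunE E.
Qed.

End ScalarHoms.

Section LimitScalars.
Variables (K : fieldType) (C : vcat K).

Lemma incl_isoE (D : vcat K) (A : ob D) (v : ker_fib (incl A)) : incl_iso A v = vsval v.
Proof. by rewrite linfun_lin // => a u w; rewrite linearP. Qed.

Lemma incl_iso_inj (D : vcat K) (A : ob D) : injective (incl_iso A).
Proof. by move=> u v; rewrite !incl_isoE => /val_inj. Qed.

Fixpoint unit_iso n : 'Hom(fib (unit_at C n), fib (unit_ob C)) :=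
  if n is n'.+1 then (unit_iso n' \o incl_iso (unit_at C n'))%VF else \1%VF.

Lemma unit_iso_inj n : injective (unit_iso n).
Proof.
elim: n => [|n IH] u v /=; first by rewrite !id_lfunE.
by rewrite !comp_lfunE => /IH/incl_iso_inj.
Qed.

Lemma reaches_unit n : @reaches K C 0 (unit_ob C) n (unit_at C n) (unit_iso n).
Proof. by elim: n => [|n IH]; [apply: reaches_refl | apply: reaches_incl]. Qed.

Let iso_to_unit m := {B : ob (tower C m) & 'Hom(fib B, fib (unit_ob C))}.

(** The type of [i] depends on [B], so the pair is compared as a whole. Uniqueness lets any
    representative of the unit in the direct limit be replaced by the standard one. *)
Lemma reaches_unit_uniq m (B : ob (tower C m)) i :
  @reaches K C 0 (unit_ob C) m B i ->
  existT _ B i = existT _ (unit_at C m) (unit_iso m) :> iso_to_unit m.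
Proof.
elim=> [//|{}m {}B {}i _ IH].
pose up (z : iso_to_unit m) : iso_to_unit m.+1 :=
  existT (fun B : ob (tower C m.+1) => 'Hom(fib B, fib (unit_ob C)))
    (incl (projT1 z)) (projT2 z \o incl_iso (projT1 z))%VF.
exact: (congr1 up IH).
Qed.

Lemma lim_scalarP c :
  Defs.hom (c *: \1%VF : 'Hom(fib (unit_ob (lim C)), fib (unit_ob (lim C)))) <->
  exists n, scalar_at C n c.
Proof.
split=> [[n [A [B [i [j [f [rA rB hf E]]]]]]]|[n hn]].
  exists n; have EA := reaches_unit_uniq rA; have EB := reaches_unit_uniq rB.
  have gen (z1 z2 : iso_to_unit n) : z1 = existT _ (unit_at C n) (unit_iso n) ->
      z2 = existT _ (unit_at C n) (unit_iso n) ->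
      forall f : 'Hom(fib (projT1 z1), fib (projT1 z2)), Defs.hom f ->
      (c *: \1 \o projT2 z1 = projT2 z2 \o f)%VF -> scalar_at C n c.
    move=> -> -> {A B i j f rA rB hf E EA EB} /= f hf E.
    rewrite /scalar_at (_ : c *: \1%VF = f) //.
    apply/lfunP => v; apply: (@unit_iso_inj n).
    have := congr1 (fun h : 'Hom(_, _) => h v) E.
    by rewrite !comp_lfunE !scale_lfunE !id_lfunE linearZ.
  exact: (gen _ _ EA EB f hf E).
exists n, (unit_at C n), (unit_at C n), (unit_iso n), (unit_iso n), (c *: \1%VF).
split=> //; try exact: reaches_unit.
by apply/lfunP => v; rewrite !comp_lfunE !scale_lfunE !id_lfunE linearZ.
Qed.

Lemma scalar_at0 n : scalar_at C n 0.
Proof. by rewrite /scalar_at scale0r; apply: hom0. Qed.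

(** The good sequence is 0 -> U -> U -> 0, with U the unit; its middle arrow must be a morphism,
    which is the hypothesis on the scalar 1. *)
Lemma scalar_at_push n c : scalar_at C n 1 -> scalar_at C n c -> scalar_at C n.+1 c.
Proof.
move=> h1 hc; apply: (@scalar_induced _ _ _ c (zob _) (unit_at C n) 0 \1%VF (c *: \1%VF)) => //.
- exact: hom0.
- by move: h1; rewrite /scalar_at scale1r.
- apply/vspaceP => v; rewrite memv_ker id_lfunE; apply/memv_imgP/eqP.
    by case=> u _ ->; rewrite zero_lfunE.
  by move=> ->; exists 0; rewrite ?mem0v // zero_lfunE.
- by rewrite lim1g.
Qed.

Lemma scalar_at_sub n c d : scalar_at C n.+1 c -> scalar_at C n.+1 d -> scalar_at C n.+1 (c - d).
Proof.
move=> hc hd; rewrite /scalar_at scalerBl; apply: ker_hom_add => //.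
exact: ker_hom_opp.
Qed.

Lemma scalar_at_mul n c d : scalar_at C n.+1 c -> scalar_at C n.+1 d -> scalar_at C n.+1 (c * d).
Proof.
move=> hc hd; rewrite /scalar_at.
have := ker_hom_comp hd hc; congr ker_hom.
by apply/lfunP => v; rewrite comp_lfunE !scale_lfunE !id_lfunE scalerA.
Qed.

Lemma scalar_at_inv n c : c != 0 -> scalar_at C n.+1 c -> scalar_at C n.+1 c^-1.
Proof.
move=> nc hc; apply: (ker_hom_inv hc) => v; rewrite !scale_lfunE !id_lfunE scalerA.
  by rewrite mulVf // scale1r.
by rewrite divff // scale1r.
Qed.

End LimitScalars.

(** * The field of invariants: ratios and field operations *)

Section FieldOfInvariants.
Variables (K : fieldType) (I : Type) (ty : I -> nat * nat) (W : tstruct K ty).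
Local Notation FOI := (field_of_invariants W).
Local Notation T := (tens (carrier W)).

Lemma FOI_P c : FOI c <-> exists n, scalar_at (C1 W) n c.
Proof. exact: lim_scalarP. Qed.

Lemma scalar_C1 c : scalar_at (C1 W) 0 c <-> S_tens (c : T 0 0).
Proof.
have homE (t : T 0 0) (v : T 0 0) :
    hom_of_tens (p := 0) (q := 0) (a := 0) (b := 0) t v = (t : K) *: v.
  rewrite -[LHS]/(pairing t v) /pairing crd_pairing big_tuple0 big_tuple0.
  exact: mulrC.
split=> [hc|Sc].
  have [t St E] : @hom_C0 _ _ _ W (0%N, 0%N) (0%N, 0%N) (c *: \1%VF).
    apply: (hom_unlift1 _ hc) => v.
    by rewrite !scale_lfunE !id_lfunE.
  have -> : c = t :> K; last exact: St.
  have := congr1 (fun f : 'Hom(T 0 0, T 0 0) => f (1 : K)) E.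
  rewrite scale_lfunE id_lfunE homE => {}E.
  by have := E; rewrite -[c *: _]/(c * 1) -[t *: _]/((t : K) * 1) !mulr1.
have -> : scalar_at (C1 W) 0 c = hom_C1 (@lift1 _ _ _ W (0, 0)%N (0, 0)%N
    (hom_of_tens (p := 0) (q := 0) (a := 0) (b := 0) (c : T 0 0))).
  rewrite /scalar_at; congr hom_C1; apply/lfunP => v; apply: fib1_eq.
  by rewrite lift1E homE scale_lfunE id_lfunE.
by apply: (@hom_lift1 _ _ _ W (0, 0)%N (0, 0)%N); exists (c : T 0 0).
Qed.

(** The good sequence W^{2q,2p} -> W^{q,p} -> 1 -> 0 consists of the annihilator of [x1] and the
    pairing with [x1], and the inducing morphism is the pairing with [x0]. The scalar thus appears
    after one kernel completion. *)
Lemma ratio_FOI c : ratio W c -> FOI c.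
Proof.
move=> [p [q [x0 [x1 [S0 S1 nx1 E]]]]]; apply/FOI_P; exists 1%N.
pose F (x : T p q) := @lift1 _ _ _ W (q, p) (0, 0)%N
  (hom_of_tens (p := q) (q := p) (a := 0) (b := 0) x).
have homF x : S_tens x -> hom_C1 (F x).
  by move=> Sx; apply: (@hom_lift1 _ _ _ W (q, p) (0, 0)%N); exists x.
pose A := @lift1 _ _ _ W (q + q, p + p)%N (q, p) (annihilator_map x1).
apply: (@scalar_induced _ (C1 W) [:: (0, 0)%N] c [:: (q + q, p + p)%N] [:: (q, p)] A (F x1) (F x0)).
- apply: (@hom_lift1 _ _ _ W (q + q, p + p)%N (q, p)).
  by exists (annihilator x1) => //; apply: S_annihilator.
- exact: homF.
- exact: homF.
- apply/vspaceP => v; rewrite memv_ker; apply/memv_imgP/eqP.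
    case=> u _ ->; apply: fib1_eq; rewrite !lift1E /=.
    exact: pairing_annihilator.
  move=> Fv; have : v.1 \in lker (pairing x1).
    by rewrite memv_ker; have := congr1 fst Fv; rewrite lift1E /= => ->.
  rewrite -limg_annihilator // => /memv_imgP[u _ vE].
  by exists (u, 0); rewrite ?memvf //; apply: fib1_eq; rewrite lift1E.
- apply/vspaceP => v; rewrite memvf; apply/memv_imgP.
  have [y y1] := pairing_neq0 nx1.
  exists ((v.1 : K) *: y, 0); rewrite ?memvf //; apply: fib1_eq; rewrite lift1E /=.
  have -> : hom_of_tens (p := q) (q := p) (a := 0) (b := 0) x1 ((v.1 : K) *: y) = v.1.
    rewrite -[LHS]/(pairing x1 ((v.1 : K) *: y)) linearZ /= y1; exact: mulr1.
  by [].
apply/lfunP => v; apply: fib1_eq; rewrite scale_lfunE !lift1E /= E.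
rewrite -[LHS]/(pairing (c *: x1) v.1) -[hom_of_tens _ _]/(pairing x1 v.1) /pairing !crd_pairing.
rewrite -[RHS]/(c * _) mulr_sumr; apply: eq_bigr => i _; rewrite mulr_sumr; apply: eq_bigr => j _.
by rewrite /crd evZ mulrCA.
Qed.

Lemma scalar_at_unit n c : c != 0 -> scalar_at (C1 W) n c -> scalar_at (C1 W) n 1.
Proof.
case: n => [|n] nc hc; first by apply/scalar_C1/(S_unit nc)/scalar_C1.
by rewrite -(divff nc); apply: scalar_at_mul => //; apply: scalar_at_inv.
Qed.

Lemma scalar_at_leq n m c : (n <= m)%N -> scalar_at (C1 W) n c -> scalar_at (C1 W) m c.
Proof.
(* Passing to a higher level requires the identity of the unit, which a nonzero c supplies; the zero
   map is a morphism at every level. *)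
have [->|nc] := eqVneq c 0; first by move=> _ _; apply: scalar_at0.
move=> /subnK <-; elim: (m - n)%N => // k IH hc.
by apply: scalar_at_push; last exact: IH; apply: scalar_at_unit nc (IH hc).
Qed.

Lemma FOI_common c d : FOI c -> FOI d ->
  exists n, scalar_at (C1 W) n.+1 c /\ scalar_at (C1 W) n.+1 d.
Proof.
move=> /FOI_P[n hc] /FOI_P[m hd]; exists (n + m)%N.
by split; [apply: scalar_at_leq hc | apply: scalar_at_leq hd]; lia.
Qed.

Lemma FOI_subring : FOI 1 -> is_subring FOI.
Proof.
move=> F1; split=> [|c d Fc Fd|c d Fc Fd]; first exact: F1.
  have [n [hc hd]] := FOI_common Fc Fd; apply/FOI_P; exists n.+1.
  exact: scalar_at_sub.
have [n [hc hd]] := FOI_common Fc Fd; apply/FOI_P; exists n.+1.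
exact: scalar_at_mul.
Qed.

Lemma FOI_inv c : FOI c -> FOI c^-1.
Proof.
have [->|nc] := eqVneq c 0; first by rewrite invr0.
move=> Fc; have [n [hc _]] := FOI_common Fc Fc; apply/FOI_P; exists n.+1.
exact: scalar_at_inv nc hc.
Qed.

End FieldOfInvariants.

(** * Semilinear automorphisms of the fibre functor *)

Section DualBases.
Variables (K : fieldType) (W : vectType K).
Local Notation n := (dimW W).
Variables (c : 'I_n -> dual W) (b : 'I_n -> W).
Hypothesis cb : forall w : W, \sum_i (c i : 'Hom(W, K^o)) w *: b i = w.

(** The sum of the c_i tensor b_i is the identity of W for every pair of dual bases. One pair of
    arguments is exchanged at a time: c_a is expanded in the standard covectors and the b_a are
    collected by [cb]. *)
Lemma contraction_invariant p (B : p.-tuple (dual W) -> p.-tuple W -> K) :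
  (forall w, multilinear (B^~ w)) -> (forall phi, multilinear (B phi)) ->
  \sum_(i : p.-tuple 'I_n) B [tuple of map c i] [tuple of map b i] =
  \sum_(i : p.-tuple 'I_n) B [tuple of map (@cobase K W) i] [tuple of map (@base K W) i].
Proof.
elim: p B => [|p IH] B BL BR.
  by rewrite !big_tuple0; congr B; rewrite [LHS]tuple0 [RHS]tuple0.
have mapS (T : Type) (f : 'I_n -> T) a (i : p.-tuple 'I_n) :
    [tuple of map f [tuple of a :: i]] = [tuple of f a :: [tuple of map f i]].
  exact: val_inj.
rewrite !big_tuple_cons.
transitivity (\sum_a \sum_(i : p.-tuple 'I_n)
    B [tuple of c a :: [tuple of map (@cobase K W) i]]
      [tuple of b a :: [tuple of map (@base K W) i]]).
  apply: eq_bigr => a _; under eq_bigr do rewrite !mapS.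
  apply: (IH (fun phi w => B [tuple of c a :: phi] [tuple of b a :: w])) => [w|phi].
    exact: (multilinear_tl (f := B^~ _)).
  exact: multilinear_tl.
rewrite exchange_big [RHS]exchange_big; apply: eq_bigr => i _ /=.
under [RHS]eq_bigr do rewrite !mapS.
set phi := [tuple of map _ i]; set w := [tuple of map _ i].
transitivity (\sum_a \sum_d (c a : 'Hom(W, K^o)) (base d) *
    B [tuple of cobase d :: phi] [tuple of b a :: w]).
  apply: eq_bigr => a _.
  have /= <- := multilinear_hd_sum phi (fun d => (c a : 'Hom(W, K^o)) (base d))
    (@cobase K W) (BL [tuple of b a :: w]).
  by congr B; apply: val_inj; rewrite //= -cobase_expansion.
rewrite exchange_big; apply: eq_bigr => d _ /=.
by rewrite -[in RHS](cb (base d)) multilinear_hd_sum.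
Qed.
End DualBases.

Section Semilinear.
Variables (K : fieldType) (g : field_aut K) (W : vectType K).
Local Notation gW := (Defs_twist__canonical__vector_Vector g W).
Variables (psi : 'Hom(gW, W)) (psi' : 'Hom(W, gW)).
Hypotheses (psiK : cancel psi psi') (psi'K : cancel psi' psi).

Definition pull_covec (phi : dual W) : dual W :=
  @untwist_dual K g W ((phi : 'Hom(W, K^o)) \o psi)%VF.
Definition pull_vec (w : W) : W := psi' w.

(** Regarded as a map from W to itself, [psi] is g-semilinear; this is the g-semilinear operator it
    induces on W^{p,q}. *)
Definition semi p q (x : tens W p q) : tens W p q :=
  tens_push psi psi' (@twist_tens K g W p q x).

Lemma semiE p q (x : tens W p q) phi w :
  ev (semi x) phi w = g (ev x [tuple of map pull_covec phi] [tuple of map pull_vec w]).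
Proof.
rewrite tens_pushE twist_tensE; apply: congr1; congr ev; apply: eq_from_tnth => i;
  by rewrite !tnth_mktuple tnth_map.
Qed.

Lemma pull_covecE phi w : (pull_covec phi : 'Hom(W, K^o)) w =
  aut_inv g ((phi : 'Hom(W, K^o)) (psi (w : gW))).
Proof. by rewrite untwist_dualE comp_lfunE. Qed.

Lemma pull_pair phi w : (pull_covec phi : 'Hom(W, K^o)) (pull_vec w) =
  aut_inv g ((phi : 'Hom(W, K^o)) w).
Proof. by rewrite pull_covecE psi'K. Qed.

Lemma pull_dual_basis (w : W) :
  \sum_i (pull_covec (cobase i) : 'Hom(W, K^o)) w *: pull_vec (base i) = w.
Proof.
rewrite -[RHS](psiK (w : gW)) {1}[psi _]base_expansion linear_sum.
by apply: eq_bigr => i _; rewrite linearZ pull_covecE.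
Qed.

Lemma map_pull_cobase p (i : p.-tuple 'I_(dimW W)) :
  [tuple of map pull_covec [tuple of map (@cobase K W) i]] =
  [tuple of map (fun a => pull_covec (cobase a)) i].
Proof. by apply: val_inj; rewrite /= -map_comp. Qed.

Lemma map_pull_base p (i : p.-tuple 'I_(dimW W)) :
  [tuple of map pull_vec [tuple of map (@base K W) i]] =
  [tuple of map (fun a => pull_vec (base a)) i].
Proof. by apply: val_inj; rewrite /= -map_comp. Qed.

Lemma semi_lin p q a (x y : tens W p q) : semi (a *: x + y) = g a *: semi x + semi y.
Proof. by apply: eq_tens => phi w; rewrite ev_lin !semiE ev_lin rmorphD rmorphM. Qed.

Lemma semi0 p q : semi (0 : tens W p q) = 0.
Proof. by apply: eq_tens => phi w; rewrite semiE !ev0 rmorph0. Qed.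

Lemma semi_eq0 p q (x : tens W p q) : semi x = 0 -> x = 0.
Proof.
move=> sx; apply: (ev_eq0 (f := fun a => pull_covec (cobase a)) (e := fun a => pull_vec (base a))).
- move=> phi; exists (fun i => (phi : 'Hom(W, K^o)) (pull_vec (base i))).
  apply/lfunP => w; rewrite -{1}[w]pull_dual_basis linear_sum sum_lfunE.
  by apply: eq_bigr => i _; rewrite linearZ scale_lfunE; apply: mulrC.
- by move=> w; exists (fun i => (pull_covec (cobase i) : 'Hom(W, K^o)) w); rewrite pull_dual_basis.
move=> A B; rewrite -map_pull_cobase -map_pull_base; apply: (fmorph_inj g).
by rewrite -semiE sx ev0 rmorph0.
Qed.

Lemma semi_mul p q r s (x : tens W p q) (y : tens W r s) :
  semi (tens_mul x y) = tens_mul (semi x) (semi y).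
Proof.
by apply: eq_tens => phi w; rewrite tens_mulE !semiE tens_mulE rmorphM -!pull_map_comp.
Qed.

Lemma semi_id : semi (tens_id W) = tens_id W.
Proof.
apply: eq_tens => phi w; rewrite semiE !tens_idE /thead !tnth_map pull_pair.
exact: aut_invK.
Qed.

Lemma semi_perm p q (s : 'S_p) (t : 'S_q) (x : tens W p q) :
  semi (tens_perm s t x) = tens_perm s t (semi x).
Proof. by apply: eq_tens => phi w; rewrite tens_permE !semiE tens_permE -!pull_map_comp. Qed.

Lemma big_tuple1 (R : nmodType) (T : finType) (F : 1.-tuple T -> R) :
  \sum_(L : 1.-tuple T) F L = \sum_(a : T) F [tuple a].
Proof.
by rewrite big_tuple_cons; apply: eq_bigr => a _; rewrite big_tuple0; congr F; apply: val_inj.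
Qed.

(** On the right the contraction runs over the pulled back dual bases, which give the same
    contraction as the standard ones. *)
Lemma semi_contr p q (x : tens W p.+1 q.+1) : semi (tens_contr x) = tens_contr (semi x).
Proof.
apply: eq_tens => phi w; rewrite semiE !tens_contrE rmorph_sum.
set phi' := [tuple of map _ phi]; set w' := [tuple of map _ w].
pose B (al : 1.-tuple (dual W)) (u : 1.-tuple W) :=
  ev x [tuple of thead al :: phi'] [tuple of thead u :: w'].
have thead_tset (T : Type) (t : 1.-tuple T) i v : thead (tset t i v) = v.
  by rewrite /thead tnth_mktuple (ord1 i).
have BL u : multilinear (B^~ u).
  move=> al i a v v'; rewrite /B !thead_tset.
  exact: (multilinear_hd (f := fun phi => ev x phi _) _ _ _ _ (ev_multiL x _)).
have BR al : multilinear (B al).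
  move=> u i a v v'; rewrite /B !thead_tset.
  exact: (multilinear_hd _ _ _ _ (ev_multiR x _)).
have := contraction_invariant pull_dual_basis BL BR.
rewrite !big_tuple1 /B => E; transitivity (g (\sum_a
   ev x [tuple of cobase a :: phi'] [tuple of base a :: w'])).
  by rewrite rmorph_sum.
transitivity (g (\sum_a ev x [tuple of pull_covec (cobase a) :: phi']
                             [tuple of pull_vec (base a) :: w'])).
  congr (Defs.aut g _); move: E; under eq_bigr do rewrite !thead_map1.
  by under [RHS]eq_bigr do rewrite !thead_map1.
rewrite rmorph_sum; apply: eq_bigr => a _; rewrite semiE.
by congr (Defs.aut g _); congr ev; apply: val_inj.
Qed.

(** The two summations in [hom_of_tens] are moved one after the other to the pulled back dual bases;
    then g passes through the sums and the invariance of [t] applies. *)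
Lemma semi_hom_of_tens p q a b (t : tens W (a + q) (b + p)) (v : tens W p q) :
  semi t = t -> semi (hom_of_tens t v) = hom_of_tens t (semi v).
Proof.
move=> tE; apply: eq_tens => phi w; rewrite semiE !hom_of_tensE.
set phi' := [tuple of map pull_covec phi]; set w' := [tuple of map pull_vec w].
pose c i := pull_covec (cobase i); pose d i := pull_vec (base i).
transitivity (g (\sum_(i : p.-tuple 'I_(dimW W)) \sum_(j : q.-tuple 'I_(dimW W))
   ev v [tuple of map c i] [tuple of map d j] *
   ev t [tuple of phi' ++ [tuple of map c j]] [tuple of w' ++ [tuple of map d i]])).
  apply: congr1; rewrite exchange_big [RHS]exchange_big /=.
  pose B (i : p.-tuple 'I_(dimW W)) (u : q.-tuple W) (al : q.-tuple (dual W)) :=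
    ev v [tuple of map (@cobase K W) i] u *
    ev t [tuple of phi' ++ al] [tuple of w' ++ [tuple of map (@base K W) i]].
  transitivity (\sum_(j : q.-tuple 'I_(dimW W)) \sum_(i : p.-tuple 'I_(dimW W))
     ev v [tuple of map (@cobase K W) i] [tuple of map d j] *
     ev t [tuple of phi' ++ [tuple of map c j]] [tuple of w' ++ [tuple of map (@base K W) i]]).
    rewrite exchange_big [RHS]exchange_big /=; apply: eq_bigr => i _; apply: esym.
    apply: (contraction_invariant pull_dual_basis (B := fun al u => B i u al)) => [u|al].
      apply: multilinearZ.
      exact: (multilinear_cat_l (F := fun phi => ev t phi _) phi' (ev_multiL t _)).
    exact: (multilinearZr _ (ev_multiR v _)).
  apply: eq_bigr => j _; apply: esym.
  apply: (contraction_invariant pull_dual_basis (B := fun al u =>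
    ev v al [tuple of map d j] *
    ev t [tuple of phi' ++ [tuple of map c j]] [tuple of w' ++ u])) => [u|al].
    exact: (multilinearZr _ (ev_multiL v _)).
  exact: (multilinearZ _ (multilinear_cat_l _ (ev_multiR t _))).
rewrite rmorph_sum; apply: eq_bigr => i _; rewrite rmorph_sum; apply: eq_bigr => j _.
rewrite rmorphM -{2}tE !semiE map_pull_cobase map_pull_base; congr (_ * _).
by congr (Defs.aut g _); congr ev; apply: val_inj; rewrite /= map_cat -!map_comp.
Qed.

End Semilinear.

(** The data that an induction along the tower can carry: naturality makes the self-maps of the
    fibres restrict to kernels of morphisms, and semilinearity and the trivial kernel are
    inherited. *)
Record semilinear_family (K : fieldType) (g : K -> K) (C : vcat K) := SemilinearFamily {
  slf : forall A : ob C, fib A -> fib A;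
  slf_lin : forall (A : ob C) a (u v : fib A), slf (a *: u + v) = g a *: slf u + slf v;
  slf_eq0 : forall (A : ob C) (u : fib A), slf u = 0 -> u = 0;
  slf_nat : forall (A B : ob C) (f : 'Hom(fib A, fib B)) u, Defs.hom f -> f (slf u) = slf (f u) }.

Section KernelFamily.
Variables (K : fieldType) (g : {rmorphism K -> K}) (C : vcat K) (s : semilinear_family g C).

Lemma slf0 (A : ob C) : slf s (0 : fib A) = 0.
Proof.
by have := slf_lin s (-1) (0 : fib A) 0; rewrite scaler0 addr0 rmorphN1 scaleN1r addNr.
Qed.

Lemma slfD (A : ob C) (u v : fib A) : slf s (u + v) = slf s u + slf s v.
Proof. by have := slf_lin s 1 u v; rewrite rmorph1 !scale1r. Qed.

Lemma slfZ (A : ob C) a (u : fib A) : slf s (a *: u) = g a *: slf s u.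
Proof. by have := slf_lin s a u 0; rewrite slf0 !addr0. Qed.

Definition ker_slf (f : arrow C) (k : ker_fib f) : ker_fib f :=
  vsproj (lker (arr f)) (slf s (vsval k)).

Lemma ker_slfE f (k : ker_fib f) : vsval (ker_slf k) = slf s (vsval k).
Proof.
rewrite vsprojK // memv_ker slf_nat; last exact: arrP.
have := subvsP k; rewrite memv_ker => /eqP ->; by rewrite slf0.
Qed.

Lemma ker_slf_lin (f : arrow C) a (u v : ker_fib f) :
  ker_slf (a *: u + v) = g a *: ker_slf u + ker_slf v.
Proof. by apply: subvs_inj; rewrite ker_slfE [RHS]linearP [in LHS]linearP slf_lin /= !ker_slfE. Qed.

Lemma ker_slf_eq0 (f : arrow C) (u : ker_fib f) : ker_slf u = 0 -> u = 0.
Proof.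
move=> /(congr1 vsval); rewrite ker_slfE linear0 => /slf_eq0 u0.
by apply: subvs_inj; rewrite u0 linear0.
Qed.

(** Induction on the generation of the morphisms. For an induced map, k is lifted along f0, and
    naturality holds for f0 and for the inducing morphism; for an inverse v of u, v s = v s u v = v
    u s v = s v. *)
Lemma ker_slf_nat (f h : arrow C) (u : 'Hom(ker_fib f, ker_fib h)) k :
  ker_hom u -> u (ker_slf k) = ker_slf (u k).
Proof.
move=> hu; elim: hu k => {f h u}
  [f h X Y f1 f0 e u hf1 hf0 he _ ex _ _ uE k | f h l u v _ IHu _ IHv k
  | f h u v _ IHu uv vu k | f h k | f h u v _ IHu _ IHv k | f h u _ IHu k].
- have : vsval k \in limg f0 by rewrite ex; apply: subvsP.
  case/memv_imgP => y _ ky; apply: subvs_inj; rewrite ker_slfE.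
  rewrite (uE k y (esym ky)) (uE (ker_slf k) (slf s y)); first exact: slf_nat.
  by rewrite ker_slfE ky; apply: slf_nat.
- by rewrite !comp_lfunE IHu IHv.
- by rewrite -{1}[k]vu -IHu uv.
- by rewrite !zero_lfunE; apply: subvs_inj; rewrite ker_slfE linear0 slf0.
- rewrite !add_lfunE IHu IHv; apply: subvs_inj.
  by rewrite ker_slfE [LHS]linearD [X in slf s X]linearD slfD /= !ker_slfE.
- rewrite !opp_lfunE IHu; apply: subvs_inj.
  rewrite ker_slfE [LHS]linearN [X in slf s X]linearN -[X in slf s X]scaleN1r slfZ.
  by rewrite rmorphN1 scaleN1r /= !ker_slfE.
Qed.

Definition ker_family : semilinear_family g (Ker C) :=
  @SemilinearFamily K g (Ker C) ker_slf ker_slf_lin ker_slf_eq0 ker_slf_nat.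

End KernelFamily.

Section TowerFamily.
Variables (K : fieldType) (g : {rmorphism K -> K}) (C : vcat K).

Lemma tower_family n : semilinear_family g C -> semilinear_family g (tower C n).
Proof. by move=> s; elim: n => [//|n IH]; apply: ker_family. Qed.

Lemma unit_at_neq0 (u : fib (unit_ob C)) n : u != 0 -> exists v : fib (unit_at C n), v != 0.
Proof.
move=> nu; elim: n => [|n [v nv]]; first by exists u.
exists (vsproj (lker (arr (incl (unit_at C n)))) v); apply: contraNneq nv.
move=> /(congr1 vsval); rewrite linear0 vsprojK ?lker_incl ?memvf // => ->.
by rewrite eqxx.
Qed.

(** On a nonzero v in the fibre of the unit, c s(v) = s(c v) = g(c) s(v), and s(v) is nonzero. *)
Lemma scalar_fixed (s : semilinear_family g C) (u : fib (unit_ob C)) n c :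
  u != 0 -> scalar_at C n c -> g c = c.
Proof.
move=> nu hc; have [v nv] := unit_at_neq0 n nu.
pose sn := tower_family n s; have := slf_nat sn v hc.
rewrite !scale_lfunE !id_lfunE slfZ => /eqP.
rewrite -subr_eq0 -scalerBl scaler_eq0 subr_eq0 => /orP[/eqP E|/eqP/slf_eq0 v0].
  exact: esym.
by rewrite v0 eqxx in nv.
Qed.

End TowerFamily.

Section C1Family.
Variables (K : fieldType) (I : Type) (ty : I -> nat * nat) (W : tstruct K ty).
Variables (g : {rmorphism K -> K}) (s : forall A : ob0, fib0 W A -> fib0 W A).
Hypothesis s_lin : forall A a (u v : fib0 W A), s (a *: u + v) = g a *: s u + s v.
Hypothesis s_eq0 : forall A (u : fib0 W A), s u = 0 -> u = 0.
Hypothesis s_nat : forall A B (f : 'Hom(fib0 W A, fib0 W B)) u,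
  hom_C0 f -> f (s u) = s (f u).

Fixpoint sum_slf (l : seq ob0) : fib1 W l -> fib1 W l :=
  if l is A :: l' then fun v => (s v.1, sum_slf v.2) else id.

Lemma sum_slf_lin l a (u v : fib1 W l) :
  sum_slf (a *: u + v) = g a *: sum_slf u + sum_slf v.
Proof.
elim: l u v => [|A l IH] u v /=; first by apply/rowP => -[].
by rewrite s_lin IH.
Qed.

Lemma sum_slf0 l : sum_slf (0 : fib1 W l) = 0.
Proof.
by have := sum_slf_lin (-1) (0 : fib1 W l) 0; rewrite scaler0 addr0 rmorphN1 scaleN1r addNr.
Qed.

Lemma sum_slf_eq0 l (u : fib1 W l) : sum_slf u = 0 -> u = 0.
Proof.
elim: l u => [|A l IH] u /=; first by move=> _; apply/rowP => -[].
by case: u => u v [/s_eq0 -> /IH ->].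
Qed.

Lemma sum_slf_to A l (f : 'Hom(fib0 W A, fib1 W l)) u :
  hom_to_sum f -> f (s u) = sum_slf (f u).
Proof.
elim: l f => [|B l IH] f /=; first by move=> _; apply/rowP => -[].
have E1 v : linfun (fun v => (f v).1) v = (f v).1.
  by apply: linfun_lin => a x y; rewrite linearP.
have E2 v : linfun (fun v => (f v).2) v = (f v).2.
  by apply: linfun_lin => a x y; rewrite linearP.
case=> /s_nat h1 /IH h2; rewrite [LHS]surjective_pairing; congr pair.
  by rewrite -E1 h1 E1.
by rewrite -E2 h2 E2.
Qed.

Lemma sum_slf_nat l m (f : 'Hom(fib1 W l, fib1 W m)) u :
  hom_C1 f -> f (sum_slf u) = sum_slf (f u).
Proof.
elim: l f u => [|A l IH] f u /=.
  by move=> _; rewrite (_ : u = 0) ?linear0 ?sum_slf0 //; apply/rowP => -[].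
have E1 v : linfun (fun v : fib0 W A => f (v, 0)) v = f (v, 0).
  apply: linfun_lin => a x y; rewrite -linearP; congr (f _); congr pair.
  by rewrite /= scaler0 addr0.
have E2 v : linfun (fun v : fib1 W l => f (0, v)) v = f (0, v).
  apply: linfun_lin => a x y; rewrite -linearP; congr (f _); congr pair.
  by rewrite /= scaler0 addr0.
case=> h1 h2; have h1' v := sum_slf_to v h1; have h2' v := IH _ v h2.
have split_pair (x : fib0 W A) (y : fib1 W l) : f (x, y) = f (x, 0) + f (0, y).
  by rewrite -linearD; congr (f _); congr pair; rewrite ?addr0 ?add0r.
rewrite split_pair -E1 -E2 h1' h2' E1 E2 [in RHS](surjective_pairing u) [in RHS]split_pair.
by have := sum_slf_lin 1 (f (u.1, 0)) (f (0, u.2)); rewrite rmorph1 !scale1r => ->.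
Qed.

Definition C1_family : semilinear_family g (C1 W) :=
  @SemilinearFamily K g (C1 W) sum_slf sum_slf_lin sum_slf_eq0 sum_slf_nat.

End C1Family.

(** * The stabilizer fixes the field of invariants *)

Section Stabilizer.
Variables (K : fieldType) (g : field_aut K) (I : Type) (ty : I -> nat * nat) (W : tstruct K ty).
Local Notation gW := (Defs_twist__canonical__vector_Vector g (carrier W)).
Variables (psi : 'Hom(gW, carrier W)) (psi' : 'Hom(carrier W, gW)).
Hypotheses (psiK : cancel psi psi') (psi'K : cancel psi' psi).
Hypothesis psiT : forall i,
  tens_push psi psi' (@twist_tens K g (carrier W) _ _ (tensor W i)) = tensor W i.
Local Notation sigma := (@semi K g (carrier W) psi psi' _ _).

(** Each closure rule of S commutes with the semilinear operators; the rules on scalars use that g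
    respects inverses and fixes the rational numbers. *)
Lemma semi_S p q (x : tens (carrier W) p q) : S_tens x -> sigma x = x.
Proof.
elim=> {p q x} [i||p q r s x y _ IHx _ IHy|p q x _ IH|p q s t x _ IH|x nx _ IH|p q
  |p q x y _ IHx _ IHy|p q a x _ IH].
- exact: psiT.
- exact: semi_id.
- by rewrite semi_mul IHx IHy.
- by rewrite (semi_contr psiK) IH.
- by rewrite semi_perm IH.
- have semi_scalar (c : K) : sigma (c : tens (carrier W) 0 0) = g c.
    by rewrite -[LHS]/(ev _ [tuple] [tuple]) semiE.
  by have := semi_scalar x^-1; rewrite fmorphV -(semi_scalar x) IH.
- exact: semi0.
- by have := semi_lin psi psi' 1 x y; rewrite rmorph1 !scale1r IHx IHy.
- by have := semi_lin psi psi' (ratr a) x 0; rewrite semi0 !addr0 fmorph_rat IH.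
Qed.

Lemma semi_hom A B (f : 'Hom(fib0 W A, fib0 W B)) u :
  hom_C0 f -> f (sigma u) = sigma (f u).
Proof. by case=> t St ->; rewrite (semi_hom_of_tens psiK) // semi_S. Qed.

Lemma stabilizer_fixes c : field_of_invariants W c -> g c = c.
Proof.
move=> /FOI_P[n hc].
have fam : semilinear_family g (C1 W).
  apply: (@C1_family _ _ _ W g (fun A => @semi K g (carrier W) psi psi' A.1 A.2))
    => [A a u v|A u|A B f u].
  - exact: semi_lin.
  - exact: semi_eq0.
  - exact: semi_hom.
apply: (scalar_fixed fam _ hc (u := ((1 : K), 0) : fib1 W [:: (0, 0)%N])).
apply/eqP => /(congr1 fst) /= /eqP; exact/negP/oner_neq0.
Qed.

End Stabilizer.

(** * Automorphisms fixing the ratios stabilize the class of W *)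

Section TwistIso.
Variables (K : closedFieldType) (char0 : [pchar K] =i pred0).
Variables (I : Type) (ty : I -> nat * nat) (W : tstruct K ty) (g : field_aut K).
Hypothesis g_ratio : forall c, ratio W c -> g c = c.
Local Notation gW := (Defs_twist__canonical__vector_Vector g (carrier W)).

(** In dimension 0 the contraction of the identity no longer provides 1 in S. But then a nonzero
    tensor of W must be a scalar x of type (0, 0), in which case 1 = x x^-1 lies in S and x = x / 1
    is a ratio, fixed by g. *)
Lemma twist_iso_dim0 : dimW (carrier W) = 0%N -> tstruct_iso (twist_struct g W) W.
Proof.
move=> n0.
have no_ord (i : 'I_(dimW (carrier W))) : False.
  by case: i => i; rewrite n0.
have W0 (w : carrier W) : w = 0.
  by rewrite [w]base_expansion big1 // => i; case: (no_ord i).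
exists (0 : 'Hom(gW, carrier W)), (0 : 'Hom(carrier W, gW)); split=> [w|w|i].
- rewrite zero_lfunE; exact/esym/(W0 w).
- by rewrite zero_lfunE [RHS]W0.
rewrite [LHS]/(tens_push _ _ _) /=.
move: (S_tensor W i); move: (tensor W i).
case: (ty i) => p q /= x Sx.
apply: eq_tens_base => A B; rewrite tens_pushE twist_tensE.
case: p A x Sx => [|p] A x Sx; last by case: (no_ord (thead A)).
case: q B x Sx => [|q] B x Sx; last by case: (no_ord (thead B)).
rewrite -[LHS]/(g (x : K)) -[RHS]/(x : K).
have [->|nx] := eqVneq (x : K) 0; first exact: rmorph0.
apply: g_ratio; exists 0%N, 0%N, x, (1 : K); split=> //.
- exact: S_unit nx Sx.
- exact: oner_neq0.
- exact/esym/mulr1.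
Qed.

Lemma twist_iso : tstruct_iso (twist_struct g W) W.
Proof.
have [n0|n0] := posnP (dimW (carrier W)); first exact: twist_iso_dim0.
have cS := twist_rel_compatible g_ratio (S_unit_dim char0 n0).
(* The relation is reversed because the isomorphism sought goes from the twist to W. *)
have [psi [psi' [K1 K2 H]]] := compatible_iso char0 (compatible_sym cS) (twist_dim g (carrier W)).
exists psi, psi'; split=> // i; apply: H; apply: twist_rel_gen; exact: S_tensor.
Qed.

End TwistIso.

Theorem theorem1p4 (K : closedFieldType) (charK : [pchar K] =i pred0)
    (I : Type) (ty : I -> nat * nat) (W : tstruct K ty)
    (L : fieldType) (iota : {rmorphism L -> K})
    (LK0 : forall a : L, field_of_invariants W (iota a))
    (galKL : galois_extension iota) :
  forall a : K, fixed_field (in_stabilizer iota W) a <-> field_of_invariants W a.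
Proof.
(* That K_0 contains 1 comes from L; with it, K_0 is a subfield, over which K is algebraic as it is
   over L. *)
have F1 : field_of_invariants W 1 by rewrite -(rmorph1 iota); apply: LK0.
move=> a; split=> [fix_a|Fa g [_ [psi [psi' [psiK psi'K psiT]]]]]; last first.
  exact: (stabilizer_fixes psiK psi'K psiT Fa).
apply: contrapT => nFa.
have algF x : exists q, [/\ coefs_in (field_of_invariants W) q, q != 0 & q.[x] = 0].
  have [p np /rootP px] := galKL.1 x; exists (map_poly iota p).
  split; [|by rewrite map_poly_eq0 | exact: px].
  by move=> i; rewrite coef_map; apply: LK0.
have [g [gF nga]] := exists_automorphism charK (FOI_subring F1) (@FOI_inv _ _ _ W) algF nFa.
have g_iota b : g (iota b) = iota b by apply: gF; apply: LK0.
have g_ratio c : ratio W c -> g c = c by move=> rc; apply: gF; apply: ratio_FOI.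
apply/(elimN eqP nga)/fix_a; split; [exact: g_iota | exact: (@twist_iso K charK I ty W g g_ratio)].
Qed.
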